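(* Let $W:\mathbb{R}^d\to\mathbb{R}$ be of class $C^2$, symmetric ($W(z)=W(-z)$), with $\sup_{z,v\in\mathbb{R}^d,|v|=1}|v\cdot\nabla^2W(z)\cdot v|<+\infty$, and let $\mu^{\mathrm{in}},\mu^{\mathrm{fin}}\in\mathcal{P}_2(\mathbb{R}^d)$ satisfy $\tilde{\mathcal F}(\mu^{\mathrm{in}})<+\infty$ and $\tilde{\mathcal F}(\mu^{\mathrm{fin}})<+\infty$. Then the mean field Schrödinger problem $$\inf\left\{\mathcal H(P|\Gamma(P)):\ P\in\mathcal P_1(\Omega),\ P_0=\mu^{\mathrm{in}},\ P_T=\mu^{\mathrm{fin}}\right\}$$ admits at least one optimal solution.
   Context: Fix $d\ge1$, $T>0$. $\Omega=C([0,T];\mathbb{R}^d)$ with the uniform topology; $X=(X_t)_{t\in[0,T]}$ is the canonical process and $(\mathcal F_t)$ the canonical filtration. $P_t$ is the law of $X_t$ under a Borel probability measure $P$ on $\Omega$; $\mathcal P_1(\Omega)$ is the set of Borel probability measures $P$ on $\Omega$ with $\mathbb E_P[\sup_{t\le T}|X_t|]<\infty$; $\mathcal P_2(\mathbb R^d)$ is the set of Borel probability measures on $\mathbb R^d$ with finite second moment. A measure and its Lebesgue density are denoted by the same symbol. $\mathcal H(P|Q)=\mathbb E_P[\log\frac{dP}{dQ}]$ if $P\ll Q$ and $+\infty$ otherwise. $\nabla W*\mu(x)=\int\nabla W(x-y)\,\mu(dy)$, and similarly for $W*\mu$. For $\mu\in\mathcal P_2(\mathbb R^d)$, $\tilde{\mathcal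 F}(\mu)=\int\log\mu(x)\,\mu(dx)+\int W*\mu(x)\,\mu(dx)$ if $\mu$ is absolutely continuous with respect to Lebesgue measure, and $+\infty$ otherwise. For $P\in\mathcal P_1(\Omega)$, $\Gamma(P)\in\mathcal P(\Omega)$ is the law of the unique strong solution of $dZ_t=-\nabla W*P_t(Z_t)\,dt+dB_t$, $Z_0\sim\mu^{\mathrm{in}}$, with $B$ a Brownian motion. *)

(* Defs.v *)
From HB Require Import structures.
From mathcomp Require Import all_boot all_order all_algebra.
From mathcomp Require Import all_classical all_reals all_analysis.
From mathcomp Require Import measurable_realfun.

Set Implicit Arguments.
Unset Strict Implicit.
Unset Printing Implicit Defensive.

Import Order.TTheory GRing.Theory Num.Theory.
Import numFieldTopology.Exports numFieldNormedType.Exports.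

Local Open Scope classical_set_scope.
Local Open Scope ring_scope.

(* The library norm on ['rV[R]_d] is the sup norm; it induces the same topology
   and uniformity as this one. *)
Definition enorm (R : realType) (d : nat) (x : 'rV[R]_d) : R :=
  Num.sqrt (\sum_(i < d) x 0 i ^+ 2).

Section Calculus.
Context {R : realType} {d : nat}.
Implicit Types (f W : 'rV[R]_d -> R) (x : 'rV[R]_d).

Definition partial (i : 'I_d) f x : R := 'D_(delta_mx 0 i) f x.

Definition classC1 f : Prop := forall i : 'I_d,
  (forall x, derivable f x (delta_mx 0 i)) /\ continuous (partial i f).

Definition classC2 f : Prop :=
  classC1 f /\ forall i : 'I_d, classC1 (partial i f).

Definition grad W x : 'rV[R]_d := \row_i partial i W x.

Definition hessian W x : 'M[R]_d := \matrix_(i, j) partial i (partial j W) x.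

End Calculus.

(* ['rV[R]_d] with its Borel sigma-algebra. *)
Notation Rd R d := (g_sigma_algebraType (@open 'rV[R]_d)).

Section RdMeasurability.
Context {R : realType}.

Lemma measurable_coord d (i : 'I_d) :
  measurable_fun [set: Rd R d] (fun v : Rd R d => (v : 'rV[R]_d) 0 i).
Proof.
apply: (measurability _ (RGenOpens.measurableE R)).
move=> _ [_ [x [y ->]] <-]; rewrite setTI; apply: sub_sigma_algebra.
apply: open_comp; last exact: interval_open.
by move=> v _; exact: coord_continuous.
Qed.

Lemma measurable_rV dsp (T : measurableType dsp) d (f : T -> Rd R d) :
  (forall i, measurable_fun [set: T] (fun t => (f t : 'rV[R]_d) 0 i)) ->
  measurable_fun [set: T] f.
Proof.
move=> mf; apply: (@measurability _ _ T (Rd R d) setT f (@open 'rV[R]_d) erefl).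
move=> _ [U oU <-]; rewrite setTI.
pose bx (p : 'rV[rat]_d * nat) := [set v : 'rV[R]_d |
  forall i, `|ratr (p.1 0 i) - v 0 i| < p.2.+1%:R^-1].
have -> : f @^-1` U = \bigcup_(p in [set p | bx p `<=` U]) f @^-1` bx p.
  apply/seteqP; split=> [t /= Ut|t [p /= pU /pU]//].
  have /nbhs_ballP[e /= e0 eU] : nbhs (f t : 'rV[R]_d) U.
    by apply: open_nbhs_nbhs; split.
  have [n ne] : exists n : nat, (n.+1%:R : R)^-1 < e / 2.
    have e2 : 0 < e / 2 by rewrite divr_gt0.
    have [n _ /(_ n (leqnn n)) h] := near_infty_natSinv_lt (PosNum e2).
    by exists n.
  have /choice[q qP] : forall i, exists r : rat,
      `|ratr r - (f t : 'rV[R]_d) 0 i| < (n.+1%:R : R)^-1.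
    move=> i; set x := (f t : 'rV[R]_d) 0 i.
    have /rat_in_itvoo[r] : x - n.+1%:R^-1 < x + n.+1%:R^-1.
      by rewrite ltrBlDr -addrA ltrDl addr_gt0.
    by rewrite in_itv/= -ltr_distl => ?; exists r.
  exists (\row_i q i, n) => /=; last by move=> i; rewrite mxE.
  move=> v /= vP; apply: eU; split=> // i j; rewrite /ball/= ord1.
  rewrite -(subrKA (ratr (q j))) (le_lt_trans (ler_normD _ _))//.
  rewrite (splitr e) ltrD// (lt_trans _ ne)// 1?distrC //.
  by have := vP j; rewrite mxE distrC.
rewrite bigcup_mkcond; apply: countable_bigcupT_measurable => //.
move=> p; case: ifPn => // _.
have -> : f @^-1` bx p = \bigcap_(i in [set: 'I_d])
    (fun t => (f t : 'rV[R]_d) 0 i) @^-1` ball (ratr (p.1 0 i) : R) p.2.+1%:R^-1.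
  by apply/seteqP; split=> [t /= h i _|t h i]; [exact: h|exact: (h i)].
apply: fin_bigcap_measurable => // i _; rewrite -[X in measurable X]setTI.
by apply: mf => //; exact: measurable_ball.
Qed.

End RdMeasurability.

(* Lebesgue measure on ['rV[R]_d]: by recursion on [d], the image of the product
   of one-dimensional Lebesgue measure and [d - 1]-dimensional Lebesgue measure
   under the isomorphism between [R * 'rV[R]_(d-1)] and ['rV[R]_d]. *)
Section Lebesgue.
Context {R : realType}.

Definition consR d (p : R * Rd R d) : Rd R d.+1 :=
  \row_i (if unlift ord0 i is Some j then (p.2 : 'rV[R]_d) 0 j else p.1).

Definition unconsR d (v : Rd R d.+1) : R * Rd R d :=
  ((v : 'rV[R]_d.+1) 0 ord0, (\row_j (v : 'rV[R]_d.+1) 0 (lift ord0 j) : Rd R d)).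

Lemma measurable_consR d : measurable_fun [set: R * Rd R d] (@consR d).
Proof.
apply: measurable_rV => i; rewrite /consR.
under eq_fun do rewrite mxE.
case: unliftP => [j _|_]; last exact: measurable_fst.
exact: (measurableT_comp (measurable_coord j) measurable_snd).
Qed.
HB.instance Definition _ d :=
  isMeasurableFun.Build _ _ _ _ (@consR d) (@measurable_consR d).

Lemma measurable_unconsR d : measurable_fun [set: Rd R d.+1] (@unconsR d).
Proof.
apply: measurable_fun_pair; first exact: measurable_coord.
apply: measurable_rV => i; under eq_fun do rewrite mxE.
exact: measurable_coord.
Qed.

Lemma unconsRK d : cancel (@unconsR d) (@consR d).
Proof.
move=> v; apply/rowP => i; rewrite mxE /=.
by case: unliftP => [j ->|->]; rewrite ?mxE.
Qed.
Lemma consRK d : cancel (@consR d) (@unconsR d).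
Proof.
move=> [x v]; rewrite /unconsR /consR /= mxE unlift_none; congr pair.
by apply/rowP => j; rewrite !mxE liftK.
Qed.

Section Step.
Variables (d : nat) (m : {sigma_finite_measure set (Rd R d) -> \bar R}).

Definition lebesgue_step : set (Rd R d.+1) -> \bar R :=
  pushforward (@lebesgue_measure R \x m)%E (@consR d).

Let step0 : lebesgue_step set0 = 0%E.
Proof. by rewrite /lebesgue_step /pushforward preimage_set0 measure0. Qed.

Let step_ge0 A : (0 <= lebesgue_step A)%E.
Proof. by rewrite /lebesgue_step /pushforward; exact: measure_ge0. Qed.

Let step_sigma_additive : semi_sigma_additive lebesgue_step.
Proof.
move=> F mF tF mUF; rewrite /lebesgue_step /pushforward preimage_bigcup.
apply: measure_semi_sigma_additive.
- by move=> n; rewrite -[X in measurable X]setTI; exact: measurable_consR.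
- apply/trivIsetP => /= i j _ _ ij; rewrite -preimage_setI.
  by move/trivIsetP : tF => /(_ _ _ _ _ ij) ->//; rewrite preimage_set0.
- rewrite -preimage_bigcup -[X in measurable X]setTI.
  exact: measurable_consR.
Qed.

HB.instance Definition _ := isMeasure.Build _ _ _ lebesgue_step
  step0 step_ge0 step_sigma_additive.

Let step_sigma_finite : sigma_finite setT lebesgue_step.
Proof.
have /sigma_finiteP[F1 [F1T F1nd F1oo]] := sigma_finiteT (@lebesgue_measure R).
have /sigma_finiteP[F2 [F2T F2nd F2oo]] := sigma_finiteT m.
pose F i := F1 i `*` F2 i.
have FT : [set: R * Rd R d] = \bigcup_i F i.
  rewrite -setXTT F1T F2T predeqE => -[x y]; split.
    move=> [/= [n _ Fnx] [k _ Gky]]; exists (maxn n k) => //; split.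
    - by move: x Fnx; exact/subsetPset/F1nd/leq_maxl.
    - by move: y Gky; exact/subsetPset/F2nd/leq_maxr.
  by move=> [n _ []/= ? ?]; split; exists n.
have Fm i : measurable (F i) /\ ((@lebesgue_measure R \x m)%E (F i) < +oo)%E.
  have [? ?] := F1oo i; have [? ?] := F2oo i.
  split; first exact: measurableX.
  by rewrite product_measure1E// lte_mul_pinfty// ge0_fin_numE.
exists (fun i => @unconsR d @^-1` F i).
  by rewrite -preimage_bigcup -FT preimage_setT.
move=> i; have [mFi Fioo] := Fm i; split.
  by rewrite -[X in measurable X]setTI; exact: measurable_unconsR.
rewrite /lebesgue_step /pushforward -comp_preimage.
by rewrite (_ : _ \o _ = id) //; apply/funext => p /=; rewrite consRK.
Qed.

HB.instance Definition _ := Measure_isSigmaFinite.Build _ _ _ lebesgue_step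
  step_sigma_finite.

End Step.

End Lebesgue.

Fixpoint lebesgueRd (R : realType) (d : nat) :
    {sigma_finite_measure set (Rd R d) -> \bar R} :=
  match d with
  | 0 => [the {sigma_finite_measure set (Rd R 0) -> \bar R} of
           \d_((0 : 'rV[R]_0) : Rd R 0)]
  | d'.+1 => [the {sigma_finite_measure set (Rd R d'.+1) -> \bar R} of
               lebesgue_step (lebesgueRd R d')]
  end.

Section Entropy.
Context {dsp : measure_display} {E : measurableType dsp} {R : realType}.

(* [int log (dP/dm) dP]; only meaningful when [P `<< m]. *)
Definition int_log_density (P : probability E R)
    (m : {sigma_finite_measure set E -> \bar R}) : \bar R :=
  (\int[P]_x lne (Radon_Nikodym (charge_of_finite_measure P) m x))%E.

Definition rel_entropy (P Q : probability E R) : \bar R :=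
  if `[< P `<< Q >] then int_log_density P Q else +oo%E.

End Entropy.

Section FreeEnergy.
Context {R : realType} {d : nat}.
Implicit Types (W : 'rV[R]_d -> R) (mu : probability (Rd R d) R).

Definition second_moment_finite mu : Prop :=
  (\int[mu]_x (enorm x ^+ 2)%:E < +oo)%E.

(* [Rintegral] is real-valued; the integral is finite when [W] grows at most
   quadratically and [mu] has a finite second moment. *)
Definition convolution W mu (x : 'rV[R]_d) : R :=
  (\int[mu]_y W (x - y))%R.

Definition free_energy W mu : \bar R :=
  if `[< mu `<< lebesgueRd R d >] then
    (int_log_density mu (lebesgueRd R d) + \int[mu]_x (convolution W mu x)%:E)%E
  else +oo%E.

End FreeEnergy.

Section PathSpace.
Variables (R : realType) (T : R) (d : nat).

Definition cpath : Type := continuousType (set_type `[0, T]) 'rV[R]_d.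
HB.instance Definition _ := Choice.on cpath.
(* The topology of uniform convergence on [0, T]. *)
HB.instance Definition _ := Uniform.copy cpath (initial_topology
  (fun w : cpath => (w : {uniform set_type `[0, T] -> 'rV[R]_d}))).
HB.instance Definition _ := isPointed.Build cpath
  (cst (0 : 'rV[R]_d) : continuousType (set_type `[0, T]) 'rV[R]_d).

End PathSpace.

Notation Omega R T d := (g_sigma_algebraType (@open (@cpath R T d))).

Section Canonical.
Context {R : realType} {T : R} {d : nat}.

(* [X t w] is only meaningful for [t \in `[0, T]]; it is 0 for other [t]. *)
Definition X (t : R) (w : Omega R T d) : Rd R d :=
  if insub t is Some s then (w : cpath T d) (s : set_type `[0, T]) else 0.

Lemma measurable_X t : measurable_fun [set: Omega R T d] (X t).
Proof.
rewrite /X; case: insubP => [s _ _|_]; last exact: measurable_cst.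
apply: (@measurability _ _ (Omega R T d) (Rd R d) setT _ (@open 'rV[R]_d) erefl).
move=> _ [U oU <-]; rewrite setTI; apply: sub_sigma_algebra.
rewrite openE => w Uw /=.
have /nbhs_ballP[e /= e0 eU] : nbhs ((w : cpath T d) s : 'rV[R]_d) U.
  by apply: open_nbhs_nbhs; split.
pose toU (v : cpath T d) : {uniform set_type `[0, T] -> 'rV[R]_d} := v.
have Us : nbhs (toU w) [set h | U (h s)].
  apply/uniform_nbhs; exists [set p | ball p.1 e p.2].
  split; first exact: (entourage_ball _ (PosNum e0)).
  by move=> h /= hP; apply: eU; exact: (hP s I).
exact: (@initial_continuous _ _ toU w _ Us).
Qed.
HB.instance Definition _ t :=
  isMeasurableFun.Build _ _ _ _ (X t) (@measurable_X t).

Definition marginal (P : probability (Omega R T d) R) (t : R) :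
  probability (Rd R d) R := distribution P (X t).

Definition sup_norm (w : Omega R T d) : \bar R :=
  ereal_sup [set (enorm (X t w))%:E | t in `[0, T]].

Definition class_P1 (P : probability (Omega R T d) R) : Prop :=
  (\int[P]_w sup_norm w < +oo)%E.

End Canonical.

Section SDE.
Context {R : realType} {T : R} {d : nat}.
Variables (W : 'rV[R]_d -> R) (mu_in : probability (Rd R d) R).

(* Standard d-dimensional Brownian motion on [0, T]: starts at 0, and all
   coordinates of all increments over consecutive intervals are jointly
   independent centred Gaussians whose variance is the interval's length. *)
Definition brownian_motion dsp (E : measurableType dsp) (Pr : probability E R)
    (B : {RV Pr >-> Omega R T d}) : Prop :=
  {ae Pr, forall e, X 0 (B e) = 0} /\
  forall (k : nat) (t : nat -> R) (A : 'I_k -> 'I_d -> set R),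
    0 <= t 0%N -> t k <= T -> (forall i, (i < k)%N -> t i < t i.+1) ->
    (forall i j, measurable (A i j)) ->
    Pr [set e | forall (i : 'I_k) (j : 'I_d),
          A i j (((X (t i.+1) (B e) : 'rV[R]_d) - X (t i) (B e)) 0 j)] =
    (\prod_(i < k) \prod_(j < d)
       normal_prob 0 (Num.sqrt (t i.+1 - t i)) (A i j))%E.

Definition independent_RV dsp (E : measurableType dsp) (Pr : probability E R)
    d1 d2 (T1 : measurableType d1) (T2 : measurableType d2)
    (U : {RV Pr >-> T1}) (V : {RV Pr >-> T2}) : Prop :=
  forall A1 A2, measurable A1 -> measurable A2 ->
    Pr (U @^-1` A1 `&` V @^-1` A2) = (Pr (U @^-1` A1) * Pr (V @^-1` A2))%E.

(* The sets generating [sigma(xi, B_s : s <= t)]. *)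
Definition events_upto dsp (E : measurableType dsp) (xi : E -> Rd R d)
    (B : E -> Omega R T d) (t : R) : set (set E) :=
  [set xi @^-1` A | A in @measurable _ (Rd R d)] `|`
  [set C | exists s A, [/\ 0 <= s <= t, @measurable _ (Rd R d) A &
                            C = (fun e => X s (B e)) @^-1` A]].

(* Adaptedness to the filtration generated by [xi] and [B], augmented by the
   null sets. *)
Definition adapted_to dsp (E : measurableType dsp) (Pr : probability E R)
    (xi : E -> Rd R d) (B Z : E -> Omega R T d) : Prop :=
  forall t A, 0 <= t <= T -> @measurable _ (Rd R d) A ->
    exists2 C, <<s events_upto xi B t >> C &
               Pr.-negligible ((fun e => X t (Z e)) @^-1` A `+` C).

(* [(grad W * P_t) (x)] *)
Definition interaction (P : probability (Omega R T d) R) (t : R)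
    (x : 'rV[R]_d) : 'rV[R]_d :=
  \row_i (\int[marginal P t]_y grad W (x - y) 0 i)%R.

(* Since the noise is additive, the equation is an integral equation involving
   no stochastic integral. *)
Definition strong_solution (P : probability (Omega R T d) R)
    dsp (E : measurableType dsp) (Pr : probability E R)
    (xi : {RV Pr >-> Rd R d}) (B Z : {RV Pr >-> Omega R T d}) : Prop :=
  adapted_to Pr xi B Z /\
  {ae Pr, forall e, X 0 (Z e) = xi e /\
    forall t, 0 <= t <= T ->
      (forall i : 'I_d, (@lebesgue_measure R).-integrable `[0, t]
         (fun s => (interaction P s (X s (Z e)) 0 i)%:E)) /\
      (X t (Z e) : 'rV[R]_d) =
        (X 0 (Z e) : 'rV[R]_d)
        - \row_i (\int[@lebesgue_measure R]_(s in `[0, t])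
                    interaction P s (X s (Z e)) 0 i)%R
        + X t (B e)}.

Definition solution_law (P Q : probability (Omega R T d) R) : Prop :=
  exists (dsp : measure_display) (E : measurableType dsp)
    (Pr : probability E R) (xi : {RV Pr >-> Rd R d})
    (B Z : {RV Pr >-> Omega R T d}),
  [/\ forall A, measurable A -> distribution Pr xi A = mu_in A,
      brownian_motion B, independent_RV xi B, strong_solution P xi B Z &
      forall A, measurable A -> Q A = distribution Pr Z A].

(* The law of the strong solution, picked by choice: when [W] has a bounded
   Hessian it exists and is unique (as a Borel measure) for every [P] in
   [class_P1]; the Dirac mass only fills in for the other [P]. *)
Definition Gamma (P : probability (Omega R T d) R) :
    probability (Omega R T d) R :=
  if pselect (exists Q, solution_law P Q) is left QP then projT1 (cid QP)
  else [the probability (Omega R T d) R of \d_(point : Omega R T d)].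

End SDE.

Section MeanFieldSchrodinger.
Context {R : realType} {T : R} {d : nat}.
Variables (W : 'rV[R]_d -> R) (mu_in mu_fin : probability (Rd R d) R).

(* Measures are functions on all sets: equality of Borel measures is tested on
   measurable sets. *)
Definition admissible (P : probability (Omega R T d) R) : Prop :=
  [/\ class_P1 P, forall A, measurable A -> marginal P 0 A = mu_in A &
      forall A, measurable A -> marginal P T A = mu_fin A].

Definition cost (P : probability (Omega R T d) R) : \bar R :=
  rel_entropy P (Gamma W mu_in P).

Definition mfsp_value : \bar R := ereal_inf [set cost P | P in admissible].

Definition mfsp_optimal (P : probability (Omega R T d) R) : Prop :=
  admissible P /\ cost P = mfsp_value.

End MeanFieldSchrodinger.

(* Main.v *)
Require Import Defs.
From HB Require Import structures.
From mathcomp Require Import all_boot all_order all_algebra.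
From mathcomp Require Import all_classical all_reals all_analysis.
From mathcomp Require Import measurable_realfun.
From mathcomp Require Import ring lra.

Set Implicit Arguments.
Unset Strict Implicit.
Unset Printing Implicit Defensive.

Import Order.TTheory GRing.Theory Num.Theory.
Import numFieldTopology.Exports numFieldNormedType.Exports.

Local Open Scope classical_set_scope.
Local Open Scope ring_scope.


(** The noise in dZ = - grad W * P_t (Z) dt + dB is additive, so for a fixed [P] it can be read off
    a path: the map w |-> (w_t + int_0^t grad W * P_s (w_s) ds)_t sends a solution to xi + B. Since
    the integral equation is uniquely solvable for every driving path, this map is a bijection of
    path space. It carries [Gamma P] to the law M of xi + B, which does not depend on [P], and it
    carries [P] to a law Q with H(P | Gamma P) = H(Q | M). Conversely Q gives [P] back: solve the
    mean-field equation Z(y)_t = y_t - int_0^t grad W * (law of Z under Q)_s (Z(y)_s) ds for every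
    path y and take the image of Q under Z. The Picard map is contractive for the distance sup_t
    exp(- lam t) |w_t - v_t|, because a bounded Hessian makes grad W Lipschitz ([partial_lipschitz],
    [flow_lip], [mean_field_solution]).

    Let P_n be a minimising sequence and Q_n its noise laws. The entropies H(Q_n | M) are bounded,
    so a subsequence converges setwise to some Q ([setwise_compact]). The entropy is a supremum of
    functionals that pass to this limit ([entropy_dual], [rel_entropy_dual], [dual_rel_entropy]), so
    H(Q | M) is at most the infimum. The entropy bound and the Gaussian increments of M control
    second moments of the whole path uniformly ([second_moment_bound]), so that integrals of
    functions of linear growth converge as well ([cvg_Rintegral_entropy]).

    Let Z solve the mean-field equation for Q, and let P be the image of Q under Z. A path
    distributed as P_n gets close to Z of its own noise in mean ([stability]), so P inherits the
    terminal marginal ([final_marginal]); the initial one is kept because a path and its noise start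
    at the same point. Finally the cost of P is at most H(Q | M) ([mean_field_cost]), and
    [admissible_limit] collects these facts.

    No Brownian motion is constructed. When no solution exists [Gamma] is a Dirac mass, and an
    admissible law is not absolutely continuous with respect to it because [mu_in] has a density. So
    a finite cost provides a solution ([finite_cost_solution]), hence a probability space with xi
    and B on which the equation is solved again for other laws ([solution_exists]). If the infimum
    is +oo, any admissible law is optimal and [admissible_exists] gives one. *)

(** * Real-valued integrals: domination, comparison, limits *)

Section Integrals.
Context dsp (E : measurableType dsp) (R : realType).
Implicit Types (P Q : probability E R) (f g h : E -> R).

Lemma dominated_integrable (mu : {measure set E -> \bar R}) (D : set E) f g :
  measurable D -> measurable_fun D f -> (forall x, D x -> `|f x| <= g x) ->
  mu.-integrable D (EFin \o g) -> mu.-integrable D (EFin \o f).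
Proof.
move=> mD mf fg ig; apply: (le_integrable mD) ig; first exact/measurable_EFinP.
by move=> x Dx /=; rewrite lee_fin (le_trans (fg _ Dx))// ler_norm.
Qed.

Lemma bounded_integrable P f K : measurable_fun setT f ->
  (forall x, `|f x| <= K) -> P.-integrable setT (EFin \o f).
Proof.
move=> mf fK; apply: (@dominated_integrable _ _ _ (cst K)) => //.
exact: finite_measure_integrable_cst.
Qed.

Lemma cst_integrable P (c : R) : P.-integrable setT (EFin \o cst c).
Proof. exact: finite_measure_integrable_cst. Qed.

Lemma Rintegral_cstT P (c : R) : \int[P]_x c = c.
Proof.
rewrite Rintegral_cst// (_ : _ setT = 1%E) ?mulr1//; exact: probability_setT.
Qed.

Lemma EFin_Rintegral (mu : {measure set E -> \bar R}) D f : measurable D ->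
  mu.-integrable D (EFin \o f) ->
  (\int[mu]_(x in D) f x)%:E = (\int[mu]_(x in D) (f x)%:E)%E.
Proof. by move=> mD fi; rewrite /Rintegral fineK//; exact: integrable_fin_num. Qed.

Lemma finite_ge0_integrable (mu : {measure set E -> \bar R}) f :
  measurable_fun setT f -> (forall x, 0 <= f x) ->
  (\int[mu]_x (f x)%:E < +oo)%E -> mu.-integrable setT (EFin \o f).
Proof.
move=> mf f0 fi; apply/integrableP; split; first exact/measurable_EFinP.
by under eq_integral do rewrite /= ger0_norm//.
Qed.

Lemma dominated_cvg_Rintegral (mu : {measure set E -> \bar R}) (D : set E)
    (f_ : nat -> E -> R) f g : measurable D ->
  (forall n, measurable_fun D (f_ n)) ->
  (forall x, D x -> f_ n x @[n --> \oo] --> f x) ->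
  mu.-integrable D (EFin \o g) ->
  (forall n x, D x -> `|f_ n x| <= g x) ->
  \int[mu]_(x in D) f_ n x @[n --> \oo] --> \int[mu]_(x in D) f x.
Proof.
move=> mD mf_ ff ig fg.
have mf : measurable_fun D f by exact: (measurable_fun_cvg (h := f_)).
have [] := @dominated_convergence _ _ _ mu D mD (fun n => EFin \o f_ n)
  (EFin \o f) (EFin \o g).
- by move=> n; exact/measurable_EFinP.
- exact/measurable_EFinP.
- by apply: aeW => x Dx; apply: cvg_EFin; [exact: nearW|exact: ff].
- exact: ig.
- by apply: aeW => x n Dx; rewrite lee_fin fg.
move=> fi _ h; apply: fine_cvg; rewrite fineK//; exact: integrable_fin_num fi.
Qed.

Lemma le_RintegralT P f g : P.-integrable setT (EFin \o f) ->
  P.-integrable setT (EFin \o g) -> (forall x, f x <= g x) ->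
  \int[P]_x f x <= \int[P]_x g x.
Proof. by move=> fi gi fg; exact: le_Rintegral. Qed.

Lemma normr_RintegralT P f g : measurable_fun setT f ->
  P.-integrable setT (EFin \o g) -> (forall x, `|f x| <= g x) ->
  `|\int[P]_x f x| <= \int[P]_x g x.
Proof.
move=> mf gi fg; have fi := dominated_integrable measurableT mf (fun x _ => fg x) gi.
apply: (le_trans (le_normr_Rintegral _ fi)) => //.
by apply: le_RintegralT => //; exact: integrable_norm.
Qed.

Lemma ge0_integral_scale (mu : {measure set E -> \bar R}) f (k : R) :
  measurable_fun setT f -> (forall x, 0 <= f x) -> 0 <= k ->
  (\int[mu]_x (k * f x)%:E = k%:E * \int[mu]_x (f x)%:E)%E.
Proof.
move=> mf f0 k0; under eq_integral do rewrite EFinM.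
rewrite ge0_integralZl//; first exact/measurable_EFinP.
by move=> x _; rewrite lee_fin.
Qed.

End Integrals.

(** * Entropy bounds tested on bounded functions *)

Section Duality.
Context dsp (E : measurableType dsp) (R : realType).
Implicit Types (P Q : probability E R) (f g h : E -> R).

(** The Legendre dual form of H(P | Q) <= C, from the conjugate pair u ln u - u + 1 and exp(v) - 1.
    For a fixed [phi] both sides are integrals of bounded functions, so the property passes to image
    measures and to setwise limits. *)
Definition entropy_dual (C : R) P Q : Prop :=
  forall phi : E -> R, measurable_fun setT phi ->
    (exists K, forall x, `|phi x| <= K) ->
    \int[P]_x phi x <= C - 1 + \int[Q]_x expR (phi x).

(** A version of dP/dQ that is finite and nonnegative everywhere, so that the entropy becomes the
    integral of a real function. On the set h = 0 the function [ln] takes a default value instead of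
    -oo; that set is [P]-null. *)
Lemma density P Q : P `<< Q -> exists h : E -> R,
  [/\ measurable_fun setT h, forall x, 0 <= h x, P [set x | h x = 0] = 0,
      forall g, measurable_fun setT g -> (forall x, 0 <= g x) ->
        (\int[P]_x (g x)%:E = \int[Q]_x (g x * h x)%:E)%E &
      rel_entropy P Q = (\int[P]_x (ln (h x))%:E)%E].
Proof.
move=> PQ; pose f0 := Radon_Nikodym_SigmaFinite.f P Q.
have f0ge x := Radon_Nikodym_SigmaFinite.f_ge0 PQ x.
have f0fin x := Radon_Nikodym_SigmaFinite.f_fin_num PQ x.
pose h x := fine (f0 x).
have f0E x : f0 x = (h x)%:E by rewrite /h fineK//; exact: f0fin.
have mf0 : measurable_fun setT f0.
  by case/integrableP : (Radon_Nikodym_SigmaFinite.f_integrable PQ).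
have mh : measurable_fun setT h.
  by apply/measurable_EFinP; apply: eq_measurable_fun mf0 => x _; exact: f0E.
have h0 x : 0 <= h x by rewrite fine_ge0//; exact: f0ge.
have cov g : measurable_fun setT g -> (forall x, 0 <= g x) ->
    (\int[P]_x (g x)%:E = \int[Q]_x (g x * h x)%:E)%E.
  move=> mg g0; have := @Radon_Nikodym_SigmaFinite.change_of_variables _ _ _ P Q
    PQ (EFin \o g) setT _ measurableT.
  rewrite -/f0 => <-; last 2 first.
  - by move=> x; rewrite lee_fin.
  - exact/measurable_EFinP.
  by apply: eq_integral => x _ /=; rewrite f0E EFinM.
have mN : measurable [set x | h x = 0].
  have := mh measurableT [set 0] (measurable_set1 _); rewrite setTI.
  by congr (measurable _); apply/seteqP; split => x /=.
have PN : P [set x | h x = 0] = 0.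
  have := Radon_Nikodym_SigmaFinite.f_integral PQ mN => ->.
  apply: integral0_eq => x /= hx; rewrite -/f0 f0E hx//.
exists h; split => //.
rewrite /rel_entropy; case: asboolP => // _; rewrite /int_log_density.
set rn := Radon_Nikodym _ _.
have rnfin x : rn x \is a fin_num by apply: Radon_Nikodym_fin_num.
have mrn : measurable_fun setT rn by apply: measurable_int; exact: Radon_Nikodym_integrable.
have mlne : measurable_fun setT (fun x => lne (rn x)).
  have -> : (fun x => lne (rn x)) = (fun x => if fine (rn x) <= 0 then -oo%E else (ln (fine (rn x)))%:E).
    by apply/funext => x; rewrite -[in LHS](fineK (rnfin x)).
  have mfrn : measurable_fun setT (fun x => fine (rn x)).
    by apply: measurableT_comp.
  apply: measurable_fun_ifT => //.
    apply: measurable_fun_ler => //; exact: measurable_cst.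
  by apply/measurable_EFinP; exact: (measurableT_comp (@measurable_ln _)).
have mln : measurable_fun setT (fun x => (ln (h x))%:E).
  by apply/measurable_EFinP; exact: (measurableT_comp (@measurable_ln _)).
apply: ae_eq_integral => //.
have [N [mN1 N10 subN1]] := ae_eq_Radon_Nikodym_SigmaFinite PQ measurableT.
have PN1 : P N = 0 by have /null_content_dominatesP := PQ; exact.
exists (N `|` [set x | h x = 0]); split.
- exact: measurableU.
- by rewrite null_set_setU.
- move=> x /=; apply: contra_notP => /not_orP[xN hx] _.
  have -> : rn x = f0 x.
    apply/esym; apply: contrapT => nE; apply: xN; apply: subN1 => /= /(_ I).
    exact.
  rewrite f0E lne_EFin// lt_neqAle eq_sym h0 andbT; exact/eqP.
Qed.


Lemma expRN_ln_mul_le1 (u : R) : 0 <= u -> expR (- ln u) * u <= 1.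
Proof.
rewrite le_eqVlt => /predU1P[<-|u0]; first by rewrite mulr0.
by rewrite expRN lnK ?posrE// mulVf// gt_eqF.
Qed.

(** 1/h is the density, with respect to [P], of the part of [Q] living on h > 0. It is written
    [expR (- ln (h x))] so as to combine with other exponentials; only an inequality holds since [Q]
    may charge h = 0. *)
Lemma inv_density_integrable P Q h :
  measurable_fun setT h -> (forall x, 0 <= h x) ->
  (forall g, measurable_fun setT g -> (forall x, 0 <= g x) ->
        (\int[P]_x (g x)%:E = \int[Q]_x (g x * h x)%:E)%E) ->
  forall g, measurable_fun setT g -> (forall x, 0 <= g x) ->
    Q.-integrable setT (EFin \o g) ->
  P.-integrable setT (EFin \o (fun x => g x * expR (- ln (h x)))) /\
  \int[P]_x (g x * expR (- ln (h x))) <= \int[Q]_x g x.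
Proof.
move=> mh h0 cov g mg g0 gi.
have ml : measurable_fun setT (fun x => ln (h x)).
  exact: (measurableT_comp (@measurable_ln _)).
have me : measurable_fun setT (fun x => expR (- ln (h x))).
  apply: (measurableT_comp (@measurable_expR _)); exact: measurableT_comp.
have mr : measurable_fun setT (fun x => g x * expR (- ln (h x))).
  exact: measurable_funM.
have r0 x : 0 <= g x * expR (- ln (h x)) by rewrite mulr_ge0// expR_ge0.
have le : (\int[P]_x (g x * expR (- ln (h x)))%:E <= \int[Q]_x (g x)%:E)%E.
  rewrite cov//; apply: ge0_le_integral => //.
  - by move=> x _; rewrite lee_fin mulr_ge0.
  - by apply/measurable_EFinP; apply: measurable_funM.
  - exact/measurable_EFinP.
  - by move=> x _; rewrite lee_fin -mulrA ler_piMr// expRN_ln_mul_le1.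
have lt : (\int[Q]_x (g x)%:E < +oo)%E.
  rewrite -ge0_fin_numE; first exact: (integrable_fin_num measurableT gi).
  by apply: integral_ge0 => x _; rewrite lee_fin.
have ri := finite_ge0_integrable mr r0 (le_lt_trans le lt).
by split => //; rewrite -lee_fin !EFin_Rintegral.
Qed.

(** Integrate 1 + u <= exp u with u = phi - ln h against [P]; the exponential becomes exp(phi) / h,
    whose integral is at most that of exp(phi) against [Q]. *)
Lemma rel_entropy_dual P Q C : (rel_entropy P Q <= C%:E)%E -> entropy_dual C P Q.
Proof.
move=> PQC; have [PQ|nPQ] := pselect (P `<< Q); last first.
  by move: PQC; rewrite /rel_entropy asboolF.
have [h [mh h0 _ cov PQE]] := density PQ.
move=> phi mphi [K phiK]; set l := fun x => ln (h x).
have ml : measurable_fun setT l by exact: (measurableT_comp (@measurable_ln _)).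
have [e1 _] := inv_density_integrable mh h0 cov (measurable_cst (1:R)) (fun=> ler01)
  (cst_integrable Q 1).
have nl x : (- l x <= 1 * expR (- ln (h x)))%R.
  by rewrite mul1r (le_trans _ (expR_ge1Dx _))// /l lerDr.
(* The negative part of ln h is below 1/h, which is [P]-integrable; the positive part then has a
   finite integral because the entropy is finite. *)
have li : P.-integrable setT (EFin \o l).
  have mlE : measurable_fun setT (EFin \o l) by exact/measurable_EFinP.
  have ln_lt : (\int[P]_x (EFin \o l)^\- x < +oo)%E.
    apply: le_lt_trans (integral_funepos_lt_pinfty measurableT e1).
    apply: ge0_le_integral => //.
    - exact: measurable_funeneg.
    - by apply: measurable_funepos; case/integrableP : e1.
    - move=> x _; rewrite funenegE funeposE ge_max; apply/andP; split.
        by rewrite le_max/= lee_fin nl.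
      by rewrite le_max lexx orbT.
  have lp_lt : (\int[P]_x (EFin \o l)^\+ x < +oo)%E.
    rewrite ltey; apply/eqP => lpoo; move: PQC; rewrite PQE integralE lpoo.
    have : (\int[P]_x (EFin \o l)^\- x)%E \is a fin_num.
      by rewrite ge0_fin_numE// integral_ge0.
    by move=> /fineK <-.
  apply/integrableP; split => //.
  under eq_integral do rewrite -/((abse \o (EFin \o l)) _) fune_abse.
  rewrite ge0_integralD//; first by rewrite lte_add_pinfty.
  - exact: measurable_funepos.
  - exact: measurable_funeneg.
have lC : \int[P]_x l x <= C by rewrite -lee_fin EFin_Rintegral// -PQE.
have mep : measurable_fun setT (fun x => expR (phi x)) by exact: measurableT_comp.
have ei : Q.-integrable setT (EFin \o (fun x => expR (phi x))).
  apply: (bounded_integrable Q mep (K := expR K)) => x.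
  by rewrite ger0_norm ?expR_ge0// ler_expR (le_trans (ler_norm _)).
have [ri rle] := inv_density_integrable mh h0 cov mep (fun=> expR_ge0 _) ei.
have phii := bounded_integrable P mphi phiK.
have : \int[P]_x (phi x - l x) <= \int[P]_x (expR (phi x) * expR (- ln (h x)) - 1).
  apply: le_RintegralT.
  - exact: (integrableB measurableT phii li).
  - exact: (integrableB measurableT ri (cst_integrable P 1)).
  - by move=> x; rewrite -expRD lerBrDl expR_ge1Dx.
rewrite RintegralB// (RintegralB measurableT ri (cst_integrable P 1)) Rintegral_cstT.
lra.
Qed.

End Duality.

(** * Recovering the entropy from its dual form *)

Section DualityConverse.
Context dsp (E : measurableType dsp) (R : realType).
Implicit Types (P Q : probability E R) (f g h : E -> R).

(** Test with a 1_A and use exp(a 1_A) <= 1 + exp(a) 1_A. Taking [a] large and then Q(A) small, this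
    is absolute continuity uniform over all [P] with entropy at most [C]. *)
Lemma entropy_dual_le C P Q : entropy_dual C P Q ->
  forall (a : R) A, measurable A -> 0 < a ->
    fine (P A) <= (C + expR a * fine (Q A)) / a.
Proof.
move=> D a A mA a0; rewrite ler_pdivlMr//.
have mi : measurable_fun setT (\1_A : E -> R) by exact: measurable_indic.
have ii P' : P'.-integrable setT (EFin \o (\1_A : E -> R)) by exact: integrable_indic.
have IE (P' : probability E R) : \int[P']_x (\1_A x) = fine (P' A).
  by rewrite /Rintegral integral_indic// setIT.
have ZE (P' : probability E R) (r : R) : \int[P']_x (r * \1_A x) = r * fine (P' A).
  by rewrite (RintegralZl _ measurableT (ii P')); congr (_ * _); exact: IE.
have := D (fun x => a * \1_A x); rewrite ZE => H.
have {}H : a * fine (P A) <= C - 1 + \int[Q]_x expR (a * \1_A x).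
  apply: H; first exact: measurable_funM.
  exists a => x; rewrite indicE normrM (ger0_norm (ltW a0)).
  by case: (_ \in _); rewrite ?normr1 ?normr0 ?mulr1 ?mulr0// ltW.
have -> : fine (P A) * a = a * fine (P A) by rewrite mulrC.
apply: (le_trans H).
have : \int[Q]_x expR (a * \1_A x) <= \int[Q]_x (1 + expR a * \1_A x).
  have i2 : Q.-integrable setT (EFin \o (fun x => expR a * \1_A x)).
    exact: (integrableZl measurableT _ (ii Q)).
  apply: le_RintegralT.
  - apply: (bounded_integrable Q (K := expR a)).
      by apply: measurableT_comp => //; exact: measurable_funM.
    move=> x; rewrite ger0_norm ?expR_ge0// ler_expR indicE.
    by case: (_ \in _); rewrite ?mulr1 ?mulr0// ltW.
  - exact: (integrableD measurableT (cst_integrable Q 1) i2).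
  - move=> x; rewrite indicE.
    by case: (_ \in _); rewrite ?mulr1 ?mulr0 ?expR0 ?addr0// lerDr.
rewrite (RintegralD measurableT (cst_integrable Q 1)); last first.
  exact: (integrableZl measurableT _ (ii Q)).
rewrite Rintegral_cstT ZE.
by lra.
Qed.

(** If Q(A) = 0, the previous bound reads P(A) <= C / a for every a > 0. *)
Lemma entropy_dual_dominates C P Q : entropy_dual C P Q -> P `<< Q.
Proof.
move=> D; apply/null_content_dominatesP => A mA QA.
have PAfin : P A \is a fin_num by rewrite fin_num_measure.
apply/eqP; rewrite eq_le measure_ge0 andbT -(fineK PAfin) lee_fin.
apply/ler_addgt0Pr => e e0; rewrite add0r.
have C0 : 0 < `|C| + 1 by rewrite ltr_wpDl.
have := entropy_dual_le D mA (divr_gt0 C0 e0); rewrite QA mulr0 addr0 => /le_trans; apply.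
rewrite invf_div mulrA ler_pdivrMr// mulrC ler_pM2l//.
by rewrite (le_trans (ler_norm _))// lerDl.
Qed.

(** The optimal test function ln h is replaced by phi_k = min (ln (h + exp(-k)), k), which takes
    values in [-k, k]. As exp(phi_k) <= h + exp(-k), its [P]-integral is at most C + exp(-k). The
    negative part [m] of ln h is integrable, and the positive part follows by monotone
    convergence. *)
Lemma dual_rel_entropy C P Q : entropy_dual C P Q -> (rel_entropy P Q <= C%:E)%E.
Proof.
move=> D; have PQ := entropy_dual_dominates D.
have [h [mh h0 PN cov ->]] := density PQ.
pose l := fun x => ln (h x).
have ml : measurable_fun setT l by exact: (measurableT_comp (@measurable_ln _)).
have mlE : measurable_fun setT (EFin \o l) by exact/measurable_EFinP.
have [e1 _] := inv_density_integrable mh h0 cov (measurable_cst (1:R)) (fun=> ler01)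
  (cst_integrable Q 1).
have nl x : (- l x <= 1 * expR (- ln (h x)))%R.
  by rewrite mul1r (le_trans _ (expR_ge1Dx _))// /l lerDr.
pose m := fun x => Num.max (- l x) 0.
have mm : measurable_fun setT m by apply: measurable_maxr => //; exact: measurableT_comp.
have m0 x : 0 <= m x by rewrite le_max lexx orbT.
have mi : P.-integrable setT (EFin \o m).
  apply: dominated_integrable e1 => // x _.
  by rewrite ger0_norm// ge_max nl mulr_ge0// expR_ge0.
pose phi (k : nat) x := Num.min (ln (h x + expR (- k%:R))) (k%:R : R).
have hk k x : 0 < h x + expR (- (k%:R : R)) by rewrite ltr_wpDl// expR_gt0.
have philb k x : - (k%:R : R) <= phi k x.
  rewrite le_min -[leLHS](@expRK R) ler_ln ?posrE ?expR_gt0//.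
  by rewrite lerDr h0/= ge0_cp// oppr_le0.
have phiub k x : phi k x <= k%:R by rewrite ge_min lexx orbT.
have mphi k : measurable_fun setT (phi k).
  apply: measurable_minr => //; apply: measurableT_comp => //.
  by apply: measurable_funD.
have phib k x : `|phi k x| <= k%:R by rewrite ler_norml philb phiub.
have phii k := bounded_integrable P (mphi k) (phib k).
have hi : Q.-integrable setT (EFin \o h) /\ \int[Q]_x h x = 1.
  have hE : (\int[Q]_x (h x)%:E = 1)%E.
    transitivity (\int[P]_x (1%R)%:E)%E.
      rewrite (cov (cst 1) (measurable_cst _) (fun=> ler01)).
      by apply: eq_integral => x _; rewrite mul1r.
    rewrite integral_cst// mul1e; exact: probability_setT.
  by split; [apply: finite_ge0_integrable => //; rewrite hE ltry|rewrite /Rintegral hE].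
have phile k : \int[P]_x phi k x <= C + expR (- k%:R).
  apply: (le_trans (D _ (mphi k) _)); first by exists k%:R.
  have : \int[Q]_x expR (phi k x) <= \int[Q]_x (h x + expR (- k%:R)).
    apply: le_RintegralT.
    - apply: (bounded_integrable Q (K := expR k%:R)); first exact: measurableT_comp.
      by move=> x; rewrite ger0_norm ?expR_ge0// ler_expR.
    - exact: (integrableD measurableT hi.1 (cst_integrable Q _)).
    - move=> x; rewrite -[leRHS]lnK ?posrE// ler_expR.
      by rewrite ge_min lexx.
  rewrite (RintegralD measurableT hi.1 (cst_integrable Q (expR (- k%:R)))) hi.2 Rintegral_cstT.
  by lra.
(* the positive part truncated at k *)
pose g (k : nat) x := Num.min (Num.max (l x) 0) (k%:R : R).
have mg k : measurable_fun setT (g k).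
  by apply: measurable_minr => //; exact: measurable_maxr.
have g0 k x : 0 <= g k x by rewrite le_min le_max lexx orbT/=.
have gk k x : `|g k x| <= k%:R by rewrite ger0_norm// ge_min lexx orbT.
have gi k := bounded_integrable P (mg k) (gk k).
have gle k : \int[P]_x g k x <= C + expR (- k%:R) + \int[P]_x m x.
  rewrite (le_trans _ (lerD (phile k) (lexx _)))//.
  rewrite -(RintegralD measurableT (phii k) mi).
  rewrite -lee_fin !EFin_Rintegral//; last exact: (integrableD measurableT (phii k) mi).
  (* Where h = 0 the sum phi_k + m need not dominate [g k]. Adding 2k on this [P]-null set leaves
     the integral unchanged and makes the comparison pointwise. *)
  pose w x := phi k x + m x + (k%:R + k%:R) * \1_[set x | h x = 0] x.
  have mN : measurable [set x | h x = 0].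
    have := mh measurableT [set 0] (measurable_set1 _); rewrite setTI.
    by congr (measurable _); apply/seteqP; split => x /=.
  have mw : measurable_fun setT w.
    apply: measurable_funD; first exact: measurable_funD.
    by apply: measurable_funM => //; exact: measurable_indic.
  have -> : (\int[P]_x (phi k x + m x)%:E = \int[P]_x (w x)%:E)%E.
    apply: ae_eq_integral => //.
    - by apply/measurable_EFinP; apply: measurable_funD.
    - exact/measurable_EFinP.
    - exists [set x | h x = 0]; split => // x /=; apply: contra_notP => hx _.
      by rewrite /w indicE memNset// mulr0 addr0.
  apply: ge0_le_integral => //.
  - by move=> x _; rewrite lee_fin.
  - exact/measurable_EFinP.
  - exact/measurable_EFinP.
  move=> x _; rewrite lee_fin /w indicE.
  have [hx|hx] := eqVneq (h x) 0.
    rewrite mem_set// mulr1.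
    have := gk k x; rewrite ger0_norm// => gkx.
    by have := m0 x; have := philb k x; lra.
  rewrite memNset ?mulr0 ?addr0; last exact/eqP.
  have : Num.min (l x) k%:R <= phi k x.
    rewrite le_min ge_min [X in _ && X]ge_min lexx orbT andbT ler_ln ?posrE//.
      by rewrite lerDl expR_ge0.
    by rewrite lt_neqAle eq_sym hx h0.
  rewrite /g /m; have [l0|l0] := leP (l x) 0.
    rewrite (min_l (ler0n R k)) (min_l (le_trans l0 (ler0n R k))).
    by rewrite max_l ?oppr_ge0//; lra.
  rewrite (_ : Num.max (- l x) 0 = 0) ?addr0//.
  by apply: max_r; rewrite oppr_le0 ltW.
rewrite integralE.
have nE : (\int[P]_x (EFin \o l)^\- x = (\int[P]_x m x)%:E)%E.
  rewrite EFin_Rintegral//; apply: eq_integral => x _.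
  by rewrite funenegE /m EFin_max.
have -> : (\int[P]_x (fun x => (ln (h x))%:E)^\- x = (\int[P]_x m x)%:E)%E by exact: nE.
rewrite leeBlDr//.
have -> : (\int[P]_x (fun x => (ln (h x))%:E)^\+ x =
    limn (fun k => \int[P]_x (g k x)%:E))%E.
  rewrite -monotone_convergence//.
  - apply: eq_integral => x _; apply/esym/cvg_lim => //; rewrite funeposE.
    apply: cvg_near_cst.
    near=> k; rewrite /g -EFin_max -/(l x) min_l//.
    near: k; exact: nbhs_infty_ger.
  - by move=> k; exact/measurable_EFinP.
  - by move=> k x _; rewrite lee_fin.
  - move=> x _ i j ij; rewrite lee_fin /g le_min ge_min lexx/= ge_min.
    by rewrite ler_nat ij orbT.
have ec : (C + expR (- k%:R) + \int[P]_x m x)%:E @[k --> \oo] --> (C%:E + (\int[P]_x m x)%:E)%E.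
  rewrite -EFinD; apply: cvg_EFin; first exact: nearW.
  apply: cvgD; last exact: cvg_cst.
  rewrite -[X in _ --> X]addr0; apply: cvgD; first exact: cvg_cst.
  exact: cvgn_expR.
rewrite -(cvg_lim _ ec)//; apply: lee_lim.
- apply: ereal_nondecreasing_is_cvgn => i j ij.
  apply: ge0_le_integral => //.
  + by move=> x _; rewrite lee_fin.
  + exact/measurable_EFinP.
  + exact/measurable_EFinP.
  + move=> x _; rewrite lee_fin /g le_min ge_min lexx/= ge_min.
    by rewrite ler_nat ij orbT.
- by apply/cvg_ex; eexists; exact: ec.
- by apply: nearW => k; rewrite -EFin_Rintegral// lee_fin.
Unshelve. all: by end_near. Qed.

End DualityConverse.

(** * Image measures *)

Section Law.
Context d1 d2 (E1 : measurableType d1) (E2 : measurableType d2) (R : realType).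
Implicit Types (mu : {measure set E1 -> \bar R}) (nu : {measure set E2 -> \bar R}).
Variable F : E1 -> E2.
Hypothesis mF : measurable_fun setT F.

(** Equality with the image measure is asked on measurable sets only, so any measure with these
    values can stand for the image. *)
Definition has_law (mu : set E1 -> \bar R) (nu : set E2 -> \bar R) :=
  forall A, measurable A -> nu A = mu (F @^-1` A).

Lemma ge0_integral_law mu nu (f : E2 -> \bar R) : has_law mu nu ->
  measurable_fun setT f -> (forall x, 0 <= f x)%E ->
  (\int[nu]_y f y = \int[mu]_x f (F x))%E.
Proof.
move=> law mf f0.
pose F' : {mfun E1 >-> E2} := HB.pack F (isMeasurableFun.Build _ _ _ _ F mF).
rewrite (eq_measure_integral (pushforward mu F')).
  by rewrite ge0_integral_pushforward//.
by move=> A mA _; rewrite law.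
Qed.

Lemma Rintegral_law mu nu (f : E2 -> R) : has_law mu nu ->
  measurable_fun setT f -> \int[nu]_y f y = \int[mu]_x f (F x).
Proof.
move=> law mf; have mfE : measurable_fun setT (EFin \o f) by exact/measurable_EFinP.
rewrite /Rintegral integralE [in RHS]integralE; congr (fine (_ - _)).
  rewrite (ge0_integral_law law)//; last exact: measurable_funepos.
  by apply: eq_integral => x _; rewrite !funeposE.
rewrite (ge0_integral_law law)//; last exact: measurable_funeneg.
by apply: eq_integral => x _; rewrite !funenegE.
Qed.

Lemma integrable_law mu nu (f : E2 -> R) : has_law mu nu ->
  measurable_fun setT f -> mu.-integrable setT (EFin \o (f \o F)) ->
  nu.-integrable setT (EFin \o f).
Proof.
move=> law mf /integrableP[_ fi]; apply/integrableP; split; first exact/measurable_EFinP.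
rewrite (ge0_integral_law law)//.
by apply: measurableT_comp => //; exact/measurable_EFinP.
Qed.

End Law.

Lemma has_law_distribution d1 d2 (E1 : measurableType d1) (E2 : measurableType d2)
  (R : realType) (P : probability E1 R) (F : E1 -> E2) : measurable_fun setT F ->
  exists P' : probability E2 R, has_law F P P'.
Proof.
move=> mF.
pose F' : {mfun E1 >-> E2} := HB.pack F (isMeasurableFun.Build _ _ _ _ F mF).
by exists (distribution P F').
Qed.

(** Bounded test functions on the target pull back along [F]: in dual form, entropy does not
    increase under images. *)
Lemma entropy_dual_law d1 d2 (E1 : measurableType d1) (E2 : measurableType d2)
  (R : realType) (F : E1 -> E2) C (P Q : probability E1 R) (P' Q' : probability E2 R) :
  measurable_fun setT F -> has_law F P P' -> has_law F Q Q' ->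
  entropy_dual C P Q -> entropy_dual C P' Q'.
Proof.
move=> mF lP lQ D phi mphi [K phiK].
rewrite (Rintegral_law mF lP)// (Rintegral_law mF lQ).
  by apply: (D (phi \o F)); [exact: measurableT_comp|exists K => x /=].
exact: measurableT_comp.
Qed.

(** * Exponential moments, and masses as real numbers *)

Section Duality2.
Context dsp (E : measurableType dsp) (R : realType).
Implicit Types (P Q : probability E R).

(** Test with min (g, k) - c and let k grow. The free shift [c] trades a large exponential moment
    [B] against an additive term; the optimum would be c = ln B. *)
Lemma entropy_dual_integral C P Q (g : E -> R) (B c : R) : entropy_dual C P Q ->
  measurable_fun setT g -> (forall x, 0 <= g x) ->
  (\int[Q]_x (expR (g x))%:E <= B%:E)%E ->
  (\int[P]_x (g x)%:E <= (C - 1 + c + expR (- c) * B)%:E)%E.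
Proof.
move=> D mg g0 gB.
have mgk k : measurable_fun setT (fun x => Num.min (g x) (k%:R : R)).
  exact: measurable_minr.
have gk0 k x : 0 <= Num.min (g x) (k%:R : R) by rewrite le_min g0/=.
have gkk k x : `|Num.min (g x) (k%:R : R)| <= k%:R.
  by rewrite ger0_norm// ge_min lexx orbT.
have me : measurable_fun setT (fun x => expR (g x)) by exact: measurableT_comp.
have ei : Q.-integrable setT (EFin \o (fun x => expR (g x))).
  by apply: finite_ge0_integrable => //; exact: le_lt_trans gB (ltry _).
have -> : (\int[P]_x (g x)%:E = limn (fun k => \int[P]_x (Num.min (g x) k%:R)%:E))%E.
  rewrite -monotone_convergence//.
  - apply: eq_integral => x _; apply/esym/cvg_lim => //.
    apply: cvg_near_cst; near=> k; rewrite min_l//.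
    near: k; exact: nbhs_infty_ger.
  - by move=> k; exact/measurable_EFinP.
  - by move=> k x _; rewrite lee_fin.
  - move=> x _ i j ij; rewrite lee_fin le_min ge_min lexx/= ge_min.
    by rewrite ler_nat ij orbT.
apply: lime_le.
  apply: ereal_nondecreasing_is_cvgn => i j ij.
  apply: ge0_le_integral => //.
  + by move=> x _; rewrite lee_fin.
  + exact/measurable_EFinP.
  + exact/measurable_EFinP.
  + move=> x _; rewrite lee_fin le_min ge_min lexx/= ge_min.
    by rewrite ler_nat ij orbT.
apply: nearW => k.
have ki := bounded_integrable P (mgk k) (gkk k).
rewrite -EFin_Rintegral// lee_fin.
have := D (fun x => Num.min (g x) (k%:R : R) - c).
rewrite (RintegralB measurableT ki (cst_integrable P c)) Rintegral_cstT => H.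
have {}H := le_trans (H (measurable_funB (mgk k) (measurable_cst _)) _) (lexx _).
have bd : exists K, forall x, `|Num.min (g x) (k%:R : R) - c| <= K.
  by exists (k%:R + `|c|) => x; rewrite (le_trans (ler_normB _ _))// lerD2r.
have {H bd} H := H bd.
have : \int[Q]_x expR (Num.min (g x) k%:R - c) <= \int[Q]_x (expR (- c) * expR (g x)).
  apply: le_RintegralT.
  - apply: (bounded_integrable Q (K := expR (k%:R - c))).
      by apply: measurableT_comp => //; exact: measurable_funB.
    move=> x; rewrite ger0_norm ?expR_ge0// ler_expR lerD2r.
    by rewrite ge_min lexx orbT.
  - exact: (integrableZl measurableT _ ei).
  - by move=> x; rewrite -expRD ler_expR addrC lerD2l ge_min lexx.
rewrite (RintegralZl _ measurableT ei) => H2.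
have H3 : \int[Q]_x expR (g x) <= B by rewrite -lee_fin EFin_Rintegral.
have : expR (- c) * \int[Q]_x expR (g x) <= expR (- c) * B by rewrite ler_pM2l ?expR_gt0.
by lra.
Unshelve. all: by end_near. Qed.

Lemma fine_probability_ge0 P A : 0 <= fine (P A).
Proof. exact: fine_ge0. Qed.

Lemma fine_probability_setT P : fine (P setT) = 1.
Proof. by rewrite probability_setT. Qed.

Lemma fine_probability_le1 P A : measurable A -> fine (P A) <= 1.
Proof.
move=> mA; rewrite -lee_fin fineK ?fin_num_measure//.
exact: probability_le1.
Qed.

Lemma fine_probabilityD P A B : measurable A -> measurable B -> A `<=` B ->
  fine (P (B `\` A)) = fine (P B) - fine (P A).
Proof.
move=> mA mB AB; rewrite measureD//; last first.
  by rewrite -ge0_fin_numE ?fin_num_measure.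
by rewrite setIidr// fineB// fin_num_measure.
Qed.

End Duality2.

(** * Sequential compactness for setwise convergence *)

Section Setwise.
Context dsp (E : measurableType dsp) (R : realType).
Variables (M : probability E R) (C : R) (Q_ : nat -> probability E R).
Hypothesis Q_D : forall n, entropy_dual C (Q_ n) M.
Implicit Types (A : set E) (F : (set E)^nat).

(** Fix a = (|C| + 1) / e first, then wait until exp(a) m_k <= 1: the bound becomes (C + 1) / a <=
    e. *)
Lemma small_of_entropy_bound (x m : nat -> R) : (forall k, 0 <= x k) ->
  (forall k a, 0 < a -> x k <= (C + expR a * m k) / a) ->
  m k @[k --> \oo] --> 0 ->
  forall e, 0 < e -> \forall k \near \oo, x k <= e.
Proof.
move=> x0 xm m0 e e0.
have a0 : 0 < (`|C| + 1) / e by rewrite divr_gt0// ltr_wpDl.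
set a := (`|C| + 1) / e in a0 *.
have ea : 0 < (expR a)^-1 by rewrite invr_gt0 expR_gt0.
move/cvgrPdist_le : m0 => /(_ _ ea); apply: filter_app; near=> k => mk.
apply: (le_trans (xm k a a0)); rewrite ler_pdivrMr//.
have -> : e * a = `|C| + 1 by rewrite mulrC divfK// gt_eqF.
apply: lerD; first exact: ler_norm.
rewrite -(@ler_pM2l _ (expR a)^-1)// mulrA mulVf ?gt_eqF ?expR_gt0// mul1r mulr1.
by move: mk; rewrite sub0r normrN; apply: le_trans; exact: ler_norm.
Unshelve. all: by end_near. Qed.

Let tail F k := \bigcup_n F n `\` F k.

Let tail_cvg0 F : nondecreasing_seq F -> (forall n, measurable (F n)) ->
  fine (M (tail F k)) @[k --> \oo] --> 0.
Proof.
move=> ndF mF.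
have mU : measurable (\bigcup_n F n) by exact: bigcupT_measurable.
have mt k : measurable (tail F k) by exact: measurableD.
have t0 : \bigcap_n tail F n = set0.
  apply/seteqP; split => // x tx; have [[n _ Fnx] _] := tx 0%N I.
  by have [_] := tx n I.
have := @nonincreasing_cvg_mu _ _ _ M (tail F).
rewrite t0 measure0; move=> /(_ _ mt measurable0) H.
apply: (@fine_cvg _ _ _ _ (M \o tail F) 0); apply: H.
  by rewrite -ge0_fin_numE ?fin_num_measure.
move=> i j ij; apply/subsetPset => x [Ux nx]; split => // Fx; apply: nx.
by have /subsetPset := ndF _ _ ij; exact.
Qed.

Let tail_le F n k a : (forall n, measurable (F n)) -> 0 < a ->
  fine (Q_ n (tail F k)) <= (C + expR a * fine (M (tail F k))) / a.
Proof.
move=> mF; apply: entropy_dual_le => //; apply: measurableD => //.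
exact: bigcupT_measurable.
Qed.

(** Finite additivity passes to the limit. Countable additivity does because the tails of an
    increasing sequence are small under [M], hence small under all Q_n at once by [entropy_dual_le].
    The filter is arbitrary so that an ultrafilter can be used. *)
Lemma setwise_limit (G : set_system nat) (GF : ProperFilter G) (q : set E -> R) :
  (forall A, measurable A -> fine (Q_ n A) @[n --> G] --> q A) ->
  exists Q : probability E R, forall A, measurable A -> Q A = (q A)%:E.
Proof.
move=> qlim.
have q0 A : measurable A -> 0 <= q A.
  move=> mA; apply: (cvgr_to_ge (qlim A mA)); apply: nearW => n.
  exact: fine_probability_ge0.
have qD A B : measurable A -> measurable B -> A `<=` B -> q (B `\` A) = q B - q A.
  move=> mA mB AB; apply: (cvg_unique _ (qlim _ (measurableD mB mA))) => //.
  have : fine (Q_ n B) - fine (Q_ n A) @[n --> G] --> q B - q A.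
    by apply: cvgB; exact: qlim.
  apply: cvg_trans; apply: near_eq_cvg; apply: nearW => n.
  by rewrite fine_probabilityD.
(* [q] is controlled on measurable sets only, whereas a measure has to be nonnegative on every set;
   0 is the filler. *)
pose m A : \bar R := if `[< measurable A >] then (q A)%:E else 0%E.
have mE A : measurable A -> m A = (q A)%:E by move=> mA; rewrite /m asboolT.
have q00 : q set0 = 0.
  have := qD set0 set0 measurable0 measurable0 (@sub0set _ _).
  by rewrite setD0 subrr.
have m0 : m set0 = 0%E by rewrite mE// q00.
have m_ge0 A : (0 <= m A)%E.
  by rewrite /m; case: asboolP => // mA; rewrite lee_fin q0.
have qU A B : measurable A -> measurable B -> A `&` B = set0 ->
    q (A `|` B) = q A + q B.
  move=> mA mB AB; have := qD A (A `|` B) mA (measurableU _ _ mA mB) (@subsetUl _ _ _).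
  rewrite setDUl setDv set0U setDidl; last by rewrite setIC.
  by move=> ->; rewrite addrC subrK.
have m_sigma : semi_sigma_additive m.
  move=> F mF tF mUF; rewrite mE//.
  pose S k := \big[setU/set0]_(i < k) F i.
  have mS k : measurable (S k) by exact: bigsetU_measurable.
  have SE k : (\sum_(0 <= i < k) m (F i))%E = (q (S k))%:E.
    rewrite /S; elim: k => [|k IH]; first by rewrite big_geq// big_ord0 q00.
    have dis : S k `&` F k = set0.
      rewrite /S -bigcup_mkord; apply/seteqP; split => // x [[i /= ik Fi] Fk].
      have ei := tF i k I I (ex_intro _ x (conj Fi Fk)).
      by rewrite ei ltnn in ik.
    rewrite big_nat_recr//= IH mE// big_ord_recr/= -EFinD.
    by rewrite -(qU _ _ (mS k) (mF k) dis).
  have US : \bigcup_n F n = \bigcup_n S n.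
    rewrite eqEsubset; split => x [n _]; last first.
      by rewrite /S -bigcup_mkord => -[k _ Fk]; exists k.
    by exists n.+1 => //; rewrite /S big_ord_recr/=; right.
  have ndS : nondecreasing_seq S.
    by move=> i j ij; apply/subsetPset; exact: subset_bigsetU.
  rewrite (eq_cvg _ _ SE) US; apply: cvg_EFin; first exact: nearW.
  apply/cvgrPdist_le => e e0.
  have mt k : measurable (tail S k) by apply: measurableD => //; exact: bigcupT_measurable.
  have xm k a : 0 < a -> q (tail S k) <= (C + expR a * fine (M (tail S k))) / a.
    move=> a0; apply: (cvgr_to_le (qlim _ (mt k))); apply: nearW => n.
    exact: tail_le.
  apply: filterS (small_of_entropy_bound (fun k => q0 _ (mt k)) xm (tail_cvg0 ndS mS) e0) => k.
  have SU : S k `<=` \bigcup_n S n by move=> x Sx; exists k.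
  have := q0 _ (mt k); rewrite /tail (qD _ _ (mS k) (bigcupT_measurable _ mS) SU).
  by move=> ?; rewrite ger0_norm.
pose mm := isMeasure.Build _ _ _ m m0 m_ge0 m_sigma.
have mT : m setT = 1%E.
  rewrite mE//; congr (_%:E); apply: (cvg_unique _ (qlim _ measurableT)) => //.
  apply: cvg_near_cst; apply: nearW => n; exact: fine_probability_setT.
pose m1 : {measure set E -> \bar R} := HB.pack m mm.
have m1T : m1 setT = 1%E by exact: mT.
pose m2 : probability E R := HB.pack m mm (Measure_isProbability.Build _ _ _ m1 m1T).
by exists m2 => A mA; exact: mE.
Qed.

(** Along an ultrafilter every sequence Q_n(A) converges in [0, 1], and [setwise_limit] makes the
    limit a probability. A subsequence then converges on the countable pi-system [A_]; the sets on
    which it converges form a lambda-system, again because tails are uniformly small. *)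
Lemma setwise_compact (A_ : nat -> set E) : setI_closed (range A_) ->
  (forall n, measurable (A_ n)) -> measurable `<=` <<s range A_ >> ->
  exists (Q : probability E R) (n_ : nat -> nat), (forall j, (j <= n_ j)%N) /\
    forall A, measurable A -> fine (Q_ (n_ j) A) @[j --> \oo] --> fine (Q A).
Proof.
move=> AI mA gA.
have [G [GU oG]] := ultraFilterLemma (@eventually_filter).
have GP : ProperFilter G by exact: ultra_proper.
have /choice[q qlim] : forall A, exists x : R, measurable A -> fine (Q_ n A) @[n --> G] --> x.
  move=> A; have [mA'|nmA] := pselect (measurable A); last by exists 0.
  have := @segment_compact R 0 1; rewrite compact_ultra => H.
  have [||x [_ xP]] := H [set B | G ((fun n => fine (Q_ n A)) @^-1` B)].
  - split; first exact: fmap_proper_filter.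
    move=> K KP sK; apply/seteqP; split; last exact: sK.
    move=> B KB; have [//|nB] := in_ultra_setVsetC ((fun n => fine (Q_ n A)) @^-1` B) GU.
    have KnB : K (~` B) by apply: sK.
    by have [x []] := filter_ex (filterI KB KnB).
  - have : G [set n | fine (Q_ n A) \in `[0, 1]%R].
      apply: filterS (@filterT _ G _) => n _ /=.
      by rewrite in_itv/= fine_probability_ge0 fine_probability_le1.
    by [].
  by exists x.
have [Q QE] := setwise_limit GP qlim.
have Qlim A : measurable A -> fine (Q_ n A) @[n --> G] --> fine (Q A).
  by move=> mA'; rewrite QE//; exact: qlim.
(* Finitely many conditions hold together on a set of the ultrafilter, so index j can be chosen
   1/(j+1)-accurate on A_0, ..., A_j. *)
have /choice[n_ n_P] : forall j, exists n, (j <= n)%N /\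
    forall k, (k <= j)%N -> `|fine (Q (A_ k)) - fine (Q_ n (A_ k))| <= j.+1%:R^-1.
  move=> j; have ej : 0 < (j.+1%:R^-1 : R) by rewrite invr_gt0.
  have G1 : G [set n | (j <= n)%N] by apply: oG; exact: nbhs_infty_ge.
  have G2 : G [set n | forall k, (k <= j)%N -> `|fine (Q (A_ k)) - fine (Q_ n (A_ k))| <= j.+1%:R^-1].
    pose H (k : 'I_j.+1) := [set n | `|fine (Q (A_ k)) - fine (Q_ n (A_ k))| <= j.+1%:R^-1].
    have GH k : G (H k) by move/cvgrPdist_le : (Qlim _ (mA k)) => /(_ _ ej).
    apply: filterS (filter_forall (f := H) _ GH) => n Hn k kj; rewrite -ltnS in kj.
    exact: (Hn (Ordinal kj)).
  by have [n [? ?]] := filter_ex (filterI G1 G2); exists n.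
exists Q, n_; split; first by move=> j; have [] := n_P j.
pose D := [set A | measurable A /\ fine (Q_ (n_ j) A) @[j --> \oo] --> fine (Q A)].
suff mD : measurable `<=` D by move=> A /mD[].
apply: (subset_trans gA); apply: lambda_system_subset => //; last first.
  move=> _ [k _ <-]; split => //; apply/cvgrPdist_le => e e0.
  near=> j; have [_ /(_ k)] := n_P j; move=> /(_ _)/le_trans; apply.
    by near: j; exact: nbhs_infty_ge.
  apply/ltW; near: j; exact: (near_infty_natSinv_lt (PosNum e0)).
split => //.
- split => //; rewrite fine_probability_setT; apply: cvg_near_cst; apply: nearW => j.
  exact: fine_probability_setT.
- move=> A B BA [mA' Al] [mB Bl]; split; first exact: measurableD.
  rewrite fine_probabilityD//.
  have : fine (Q_ (n_ j) A) - fine (Q_ (n_ j) B) @[j --> \oo] --> fine (Q A) - fine (Q B).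
    exact: cvgB.
  apply: cvg_trans; apply: near_eq_cvg; apply: nearW => j.
  by rewrite fine_probabilityD.
- move=> F ndF DF; have mF n : measurable (F n) by case: (DF n).
  have mU : measurable (\bigcup_n F n) by exact: bigcupT_measurable.
  split => //; apply/cvgrPdist_le => e e0; have e30 : 0 < e / 3 by rewrite divr_gt0.
  have mt k : measurable (tail F k) by exact: measurableD.
  have FU k : F k `<=` \bigcup_n F n by move=> x; exists k.
  (* The supremum over n satisfies the same entropy bound as each term, so a single K serves all
     n. *)
  pose x k := sup [set fine (Q_ n (tail F k)) | n in setT].
  have hs k : has_sup [set fine (Q_ n (tail F k)) | n in setT].
    split; first by exists (fine (Q_ 0%N (tail F k))); exists 0%N.
    by exists 1 => _ [n _ <-]; exact: fine_probability_le1.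
  have Qx n k : fine (Q_ n (tail F k)) <= x k.
    by apply: ub_le_sup; [case: (hs k)|exists n].
  have x0 k : 0 <= x k by apply: le_trans (Qx 0%N k); exact: fine_probability_ge0.
  have xm k a : 0 < a -> x k <= (C + expR a * fine (M (tail F k))) / a.
    by move=> a0; apply: ge_sup; [case: (hs k)|move=> _ [n _ <-]; exact: tail_le].
  have [K _ /(_ K (leqnn K)) xK] := small_of_entropy_bound x0 xm (tail_cvg0 ndF mF) e30.
  have [_ /cvgrPdist_le/(_ _ e30)] := DF K; apply: filterS => j.
  have QK : fine (Q (tail F K)) <= e / 3.
    by apply: (cvgr_to_le (Qlim _ (mt K))); apply: nearW => n; exact: le_trans (Qx _ _) xK.
  have := le_trans (Qx (n_ j) K) xK; move: QK.
  rewrite !fine_probabilityD// => QK QnK.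
  have a1 := fine_probability_ge0 Q (tail F K).
  have a2 := fine_probability_ge0 (Q_ (n_ j)) (tail F K).
  rewrite fine_probabilityD// in a1; rewrite fine_probabilityD// in a2.
  by rewrite !ler_norml => /andP[h1 h2]; apply/andP; split; lra.
Unshelve. all: by end_near. Qed.

End Setwise.

(** * Convergence of integrals along setwise convergence *)

Section SetwiseIntegral.
Context dsp (E : measurableType dsp) (R : realType).
Implicit Types (P Q M : probability E R).

(** The sum counts the integers 1, ..., N not exceeding u; below N it is the integer part of u. *)
Lemma level_count (u : R) (N : nat) : 0 <= u ->
  (N%:R <= u -> \sum_(i < N) ((i.+1%:R <= u)%R : nat)%:R = N%:R :> R) /\
  (u < N%:R -> u - 1 <= \sum_(i < N) ((i.+1%:R <= u)%R : nat)%:R <= u).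
Proof.
move=> u0; elim: N => [|N [IH1 IH2]].
  by rewrite big_ord0; split => // /lt_le_trans/(_ u0); rewrite ltxx.
rewrite big_ord_recr/=; split => [uN|uN].
  by rewrite uN IH1 ?natr1// (le_trans _ uN)// ler_nat.
rewrite [N.+1%:R <= u]leNgt uN/= addr0; have [Nu|uN'] := leP N%:R u; last exact: IH2.
by rewrite IH1// Nu andbT lerBlDr natr1 ltW.
Qed.

Lemma sum_indic P n (B : 'I_n -> set E) : (forall i, measurable (B i)) ->
  P.-integrable setT (EFin \o (fun x => \sum_(i < n) \1_(B i) x : R)) /\
  \int[P]_x (\sum_(i < n) \1_(B i) x) = \sum_(i < n) fine (P (B i)).
Proof.
elim: n B => [|n IH] B mB.
  rewrite big_ord0; split.
    by under [X in _.-integrable _ X]eq_fun do rewrite /= big_ord0; exact: cst_integrable.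
  by under eq_Rintegral do rewrite big_ord0; rewrite Rintegral_cstT.
have [IH1 IH2] := IH _ (fun i => mB (widen_ord (leqnSn n) i)).
have ii : P.-integrable setT (EFin \o (\1_(B ord_max) : E -> R)).
  exact: integrable_indic.
split.
  under [X in _.-integrable _ X]eq_fun do rewrite /= big_ord_recr/=.
  exact: (integrableD measurableT IH1 ii).
under eq_Rintegral do rewrite big_ord_recr/=.
rewrite (RintegralD measurableT IH1 ii) IH2 big_ord_recr/=; congr (_ + _).
by rewrite /Rintegral integral_indic// setIT.
Qed.

(** Layer-cake approximation: replacing (g + K) m by its integer part costs at most 1, that is 1/m
    after rescaling. The error does not depend on [P]. *)
Lemma Rintegral_level P (g : E -> R) (K m : R) (N : nat) : measurable_fun setT g ->
  0 < m -> (forall x, `|g x| <= K) -> (K + K) * m < N%:R ->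
  `|\int[P]_x g x - (m^-1 * \sum_(i < N) fine (P [set x | i.+1%:R <= (g x + K) * m]) - K)|
  <= m^-1.
Proof.
move=> mg m0 gK KN.
pose A (i : 'I_N) := [set x | i.+1%:R <= (g x + K) * m].
have mgm : measurable_fun setT (fun x => (g x + K) * m).
  by apply: measurable_funM => //; apply: measurable_funD.
have mA i : measurable (A i).
  have := mgm measurableT `[i.+1%:R, +oo[%classic (measurable_itv _); rewrite setTI.
  by congr measurable; apply/seteqP; split => x /=; rewrite in_itv/= andbT.
pose s x : R := m^-1 * \sum_(i < N) \1_(A i) x - K.
have [si sE] := sum_indic P mA.
have zi := integrableZl measurableT m^-1 si.
have sI : P.-integrable setT (EFin \o s).
  exact: (integrableB measurableT zi (cst_integrable P K)).
have <- : \int[P]_x s x = m^-1 * \sum_(i < N) fine (P (A i)) - K.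
  rewrite (RintegralB measurableT zi (cst_integrable P K)) Rintegral_cstT.
  by rewrite (RintegralZl _ measurableT si) sE.
have gi := bounded_integrable P mg gK.
rewrite -RintegralB//.
rewrite -[leRHS](Rintegral_cstT P); apply: normr_RintegralT.
- by apply: measurable_funB => //; apply/measurable_EFinP; case/integrableP : sI.
- exact: cst_integrable.
move=> x; have u0 : 0 <= (g x + K) * m.
  apply: mulr_ge0; last exact: ltW.
  by have := gK x; rewrite ler_norml => /andP[+ _]; lra.
have uN : (g x + K) * m < N%:R.
  apply: le_lt_trans KN; rewrite ler_pM2r//; have := gK x; rewrite ler_norml => /andP[_]; lra.
have [_ /(_ uN)] := level_count N u0.
have -> : \sum_(i < N) ((i.+1%:R <= (g x + K) * m)%R : nat)%:R = \sum_(i < N) \1_(A i) x :> R.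
  apply: eq_bigr => i _; rewrite indicE; congr (_%:R); congr nat_of_bool.
  by apply/idP/idP; rewrite inE.
move=> /andP[h1 h2]; rewrite /s.
set S := \sum_(i < N) _ in h1 h2 *.
have -> : g x - (m^-1 * S - K) = m^-1 * ((g x + K) * m - S).
  by field; rewrite gt_eqF.
have mi0 : 0 <= m^-1 by rewrite invr_ge0 ltW.
rewrite normrM (ger0_norm mi0) ler_piMr//.
by rewrite ler_norml; apply/andP; split; lra.
Qed.

(** With levels of height e/3 only finitely many sets matter, and the mass of each of them
    converges. *)
Lemma setwise_cvg_bounded (Q_ : nat -> probability E R) Q (g : E -> R) K :
  (forall A, measurable A -> fine (Q_ n A) @[n --> \oo] --> fine (Q A)) ->
  measurable_fun setT g -> (forall x, `|g x| <= K) ->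
  \int[Q_ n]_x g x @[n --> \oo] --> \int[Q]_x g x.
Proof.
move=> QQ mg gK; apply/cvgrPdist_le => e e0.
pose m := 3 / e; have m0 : 0 < m by rewrite divr_gt0.
have [N KN] : exists N : nat, (K + K) * m < N%:R.
  by exists (Num.truncn ((K + K) * m)).+1; exact: truncnS_gt.
have L P := Rintegral_level P mg m0 gK KN.
have cS : m^-1 * \sum_(i < N) fine (Q_ n [set x | i.+1%:R <= (g x + K) * m]) - K @[n --> \oo]
    --> m^-1 * \sum_(i < N) fine (Q [set x | i.+1%:R <= (g x + K) * m]) - K.
  apply: cvgB; last exact: cvg_cst.
  apply: cvgMr; apply: (cvg_big (op := +%R)) => [|i _]; first exact: add_continuous.
  apply: QQ.
  have mgm : measurable_fun setT (fun x => (g x + K) * m).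
    by apply: measurable_funM => //; apply: measurable_funD.
  have := mgm measurableT `[i.+1%:R, +oo[%classic (measurable_itv _); rewrite setTI.
  by congr measurable; apply/seteqP; split => x /=; rewrite in_itv/= andbT.
have e3 : 0 < e / 3 by rewrite divr_gt0.
move/cvgrPdist_le : cS => /(_ _ e3); apply: filterS => n.
have := L Q; have := L (Q_ n); rewrite /m invf_div.
set a := \int[Q_ n]_x _; set b := \int[Q]_x _.
set u := _ - K; set v := _ - K.
rewrite !ler_norml => /andP[? ?] /andP[? ?] /andP[? ?]; apply/andP; split; lra.
Qed.

Definition trunc (k u : R) : R := Num.max (- k) (Num.min u k).

Lemma trunc_bound k u : 0 <= k -> `|trunc k u| <= k.
Proof.
move=> k0; rewrite /trunc ler_norml le_max lexx/= ge_max ge_min lexx orbT andbT.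
by lra.
Qed.

Lemma trunc_lip k u v : `|trunc k u - trunc k v| <= `|u - v|.
Proof.
have lip1 (a b : R) : `|Num.min a k - Num.min b k| <= `|a - b|.
  have := ler_norm (a - b); have := ler_norm (b - a); rewrite distrC ler_norml.
  by case: (leP a k) => h1; case: (leP b k) => h2 h3 h4; apply/andP; split; lra.
have lip2 (a b : R) : `|Num.max (- k) a - Num.max (- k) b| <= `|a - b|.
  have := ler_norm (a - b); have := ler_norm (b - a); rewrite distrC ler_norml.
  by case: (leP (- k) a) => h1; case: (leP (- k) b) => h2 h3 h4; apply/andP; split; lra.
exact: le_trans (lip2 _ _) (lip1 _ _).
Qed.

Lemma trunc_dist k u : 0 < k -> `|u - trunc k u| <= u ^+ 2 / k.
Proof.
move=> k0; rewrite /trunc; have q0 : 0 <= u ^+ 2 / k by rewrite divr_ge0 ?sqr_ge0// ltW.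
have q1 : `|u| - k <= u ^+ 2 / k.
  by rewrite ler_pdivlMr// -(real_normK (num_real u)); have := sqr_ge0 (`|u| - k); nra.
have := ler_norm u; have := ler_norm (- u); rewrite normrN ler_norml => ? ?.
case: (leP u k) => h1; first case: (leP (- k) u) => h2; last case: (leP (- k) k) => h2;
  apply/andP; split; lra.
Qed.

Lemma measurable_trunc k (g : E -> R) : measurable_fun setT g ->
  measurable_fun setT (fun x => trunc k (g x)).
Proof. by move=> mg; apply: measurable_maxr => //; exact: measurable_minr. Qed.

(* Truncate at a large height: below it the duality bound with the test function
   [a * min |g_n - g| k] applies for every slope [a], above it the second moment. *)
Lemma cvg_Rintegral_entropy (Q_ : nat -> probability E R) Q M C (N : E -> R) K
    (g_ : nat -> E -> R) (g : E -> R) c :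
  (forall n, entropy_dual C (Q_ n) M) ->
  (forall A, measurable A -> fine (Q_ n A) @[n --> \oo] --> fine (Q A)) ->
  measurable_fun setT N -> (forall x, 0 <= N x) ->
  (forall n, \int[Q_ n]_x (N x ^+ 2)%:E <= K%:E)%E ->
  (\int[Q]_x (N x ^+ 2)%:E <= K%:E)%E ->
  (forall n, measurable_fun setT (g_ n)) -> measurable_fun setT g ->
  (forall x, g_ n x @[n --> \oo] --> g x) ->
  (forall n x, `|g_ n x| <= c * (1 + N x)) ->
  \int[Q_ n]_x g_ n x @[n --> \oo] --> \int[Q]_x g x.
Proof.
move=> Q_D QQ mN N0 Q_N QN mg_ mg g_g g_c.
(* The growth bound at any one point gives the sign; a point exists because [M] has mass 1. *)
have c0 : 0 <= c.
  have [[x _]|nE] := pselect (exists x : E, True); last first.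
    have := probability_setT M; rewrite (_ : setT = set0) ?measure0.
      by move=> /eqP; rewrite eq_sym onee_eq0.
    by apply/seteqP; split => // x _; apply: nE; exists x.
  have := le_trans (normr_ge0 _) (g_c 0%N x).
  by rewrite pmulr_lge0// ltr_pwDl.
have g_c' x : `|g x| <= c * (1 + N x).
  by apply: (cvgr_to_le (cvg_norm (g_g x))); apply: nearW => n.
have C0 : 0 <= C.
  have := Q_D 0%N (cst 0) (measurable_cst _); rewrite /= expR0 !Rintegral_cstT subrK; apply.
  by exists 0 => x; rewrite normr0.
have mN2 : measurable_fun setT (fun x => N x ^+ 2) by exact: measurable_funX.
(* A function bounded by c (1 + N) has a square at most 2 c^2 (1 + N^2), so [D] bounds its second
   moment, and truncation at height k costs at most D / k by [trunc_dist]. *)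
pose D := 2 * c ^+ 2 * (1 + K).
have trunc_err (P : probability E R) (f : E -> R) (k : R) : 0 < k -> measurable_fun setT f ->
    (forall x, `|f x| <= c * (1 + N x)) -> (\int[P]_x (N x ^+ 2)%:E <= K%:E)%E ->
    `|\int[P]_x f x - \int[P]_x trunc k (f x)| <= D / k.
  move=> k0 mf fc PK.
  have Ni : P.-integrable setT (EFin \o (fun x => N x ^+ 2)).
    apply: finite_ge0_integrable => //; first by move=> x; rewrite sqr_ge0.
    exact: le_lt_trans PK (ltry _).
  have NK : \int[P]_x (N x ^+ 2) <= K by rewrite -lee_fin EFin_Rintegral.
  have bi : P.-integrable setT (EFin \o (fun x => 2 * c ^+ 2 * (1 + N x ^+ 2))).
    exact: (integrableZl measurableT _ (integrableD measurableT (cst_integrable P 1) Ni)).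
  have sq x : f x ^+ 2 <= 2 * c ^+ 2 * (1 + N x ^+ 2).
    rewrite -real_normK ?num_real//.
    have : `|f x| ^+ 2 <= (c * (1 + N x)) ^+ 2.
      by rewrite ler_sqr ?nnegrE ?normr_ge0//; exact: le_trans (fc x).
    move=> /le_trans; apply; have := sqr_ge0 (c * (1 - N x)); nra.
  have bk : P.-integrable setT (EFin \o (fun x => k^-1 * (2 * c ^+ 2 * (1 + N x ^+ 2)))).
    exact: (integrableZl measurableT _ bi).
  have dk x : `|f x - trunc k (f x)| <= k^-1 * (2 * c ^+ 2 * (1 + N x ^+ 2)).
    by apply: (le_trans (trunc_dist _ k0)); rewrite mulrC ler_pM2l ?invr_gt0.
  have mt := measurable_trunc k mf.
  have ti : P.-integrable setT (EFin \o (fun x => trunc k (f x))).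
    by apply: (bounded_integrable P mt (K := k)) => x; exact/trunc_bound/ltW.
  have fi : P.-integrable setT (EFin \o f).
    have di := dominated_integrable measurableT (measurable_funB mf mt) (fun x _ => dk x) bk.
    have := integrableD measurableT di ti; apply: eq_integrable => // x _ /=.
    by rewrite -EFinD subrK.
  rewrite -RintegralB//; apply: le_trans (normr_RintegralT (measurable_funB mf mt) bk dk) _.
  rewrite (RintegralZl _ measurableT bi).
  rewrite (RintegralZl _ measurableT (integrableD measurableT (cst_integrable P 1) Ni)).
  rewrite (RintegralD measurableT (cst_integrable P 1) Ni) Rintegral_cstT.
  rewrite mulrC ler_pM2r ?invr_gt0// /D ler_wpM2l ?lerD2l//.
  by rewrite mulr_ge0// sqr_ge0.
have D0 : 0 <= D.
  rewrite /D !mulr_ge0// ?sqr_ge0// addr_ge0//.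
  by rewrite -lee_fin (le_trans _ QN)// integral_ge0// => x _; rewrite lee_fin sqr_ge0.
apply/cvgrPdist_le => /= e e0.
pose k := (D + 1) * 8 / e; have k0 : 0 < k by rewrite divr_gt0// mulr_gt0// ltr_wpDl.
have Dk : D / k <= e / 8.
  rewrite ler_pdivrMr// /k mulrA (mulrC (e / 8)) -!mulrA mulrA.
  rewrite (_ : (D + 1) * 8 * _ = D + 1) ?lerDl//; first by field; rewrite gt_eqF.
pose a := (C + 1) * 8 / e; have a0 : 0 < a by rewrite divr_gt0// mulr_gt0// ltr_wpDl.
have Ca : C / a <= e / 8.
  rewrite ler_pdivrMr// /a.
  rewrite (_ : e / 8 * _ = C + 1) ?lerDl//; first by field; rewrite gt_eqF.
have cb := setwise_cvg_bounded QQ (measurable_trunc k mg) (fun x => trunc_bound _ (ltW k0)).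
have mdn n : measurable_fun setT (fun x => `|trunc k (g_ n x) - trunc k (g x)|).
  by apply: measurableT_comp => //; apply: measurable_funB; exact: measurable_trunc.
have dk n x : `|trunc k (g_ n x) - trunc k (g x)| <= k + k.
  by rewrite (le_trans (ler_normB _ _))// lerD// trunc_bound// ltW.
have me n : measurable_fun setT (fun x => expR (a * `|trunc k (g_ n x) - trunc k (g x)|)).
  by apply: measurableT_comp => //; exact: measurable_funM.
(* Under the fixed measure [M] the truncated differences tend to 0 boundedly, so dominated
   convergence applies to their exponentials. *)
have cM : \int[M]_x expR (a * `|trunc k (g_ n x) - trunc k (g x)|) @[n --> \oo] --> (1 : R).
  rewrite -[X in _ --> X](Rintegral_cstT M).
  apply: (dominated_cvg_Rintegral (g := cst (expR (a * (k + k))))) => //.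
  - move=> x _; have t0 : a * `|trunc k (g_ n x) - trunc k (g x)| @[n --> \oo] --> a * 0.
      apply: cvgMr.
      apply: (@squeeze_cvgr _ _ _ _ (cst 0) (fun n => `|g_ n x - g x|)).
      + by apply: nearW => n; rewrite normr_ge0 trunc_lip.
      + exact: cvg_cst.
      + rewrite -(normr0 R); apply: cvg_norm; rewrite -(subrr (g x)).
        by apply: cvgB; [exact: g_g|exact: cvg_cst].
    rewrite mulr0 in t0.
    by rewrite -expR0; apply: continuous_cvg => //; exact: continuous_expR.
  - exact: cst_integrable.
  - by move=> n x _; rewrite ger0_norm ?expR_ge0// ler_expR ler_pM2l.
have ub n : `|\int[Q_ n]_x trunc k (g_ n x) - \int[Q_ n]_x trunc k (g x)| <=
    (C - 1 + \int[M]_x expR (a * `|trunc k (g_ n x) - trunc k (g x)|)) / a.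
  have ti (f : E -> R) : measurable_fun setT f ->
      (Q_ n).-integrable setT (EFin \o (fun x => trunc k (f x))).
    move=> mf; apply: (bounded_integrable _ (measurable_trunc k mf) (K := k)) => x.
    exact/trunc_bound/ltW.
  have di : (Q_ n).-integrable setT (EFin \o (fun x => `|trunc k (g_ n x) - trunc k (g x)|)).
    by apply: (bounded_integrable _ (mdn n) (K := k + k)) => x; rewrite normr_id.
  rewrite -RintegralB//; [|exact: ti..].
  have := normr_RintegralT (measurable_funB (measurable_trunc k (mg_ n)) (measurable_trunc k mg)) di (fun x => lexx _).
  move=> /le_trans; apply; rewrite ler_pdivlMr// mulrC -(RintegralZl _ measurableT di).
  apply: Q_D; first exact: measurable_funM.
  by exists (a * (k + k)) => x; rewrite normrM normr_id (ger0_norm (ltW a0)) ler_pM2l.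
have e4 : 0 < e / 4 by rewrite divr_gt0.
have ea8 : 0 < a * (e / 8) by rewrite mulr_gt0// divr_gt0.
move/cvgrPdist_le : cb => /(_ _ e4); apply: filterS2; last first.
  by move/cvgrPdist_le : cM => /(_ _ ea8); exact: id.
move=> n h1 h2.
have t1 := trunc_err _ _ k k0 mg g_c' QN.
have t2 := trunc_err _ _ k k0 (mg_ n) (g_c n) (Q_N n).
have t3 : (C - 1 + \int[M]_x expR (a * `|trunc k (g_ n x) - trunc k (g x)|)) / a <= e / 4.
  move: h1; rewrite ler_norml => /andP[h1 _].
  move: Ca; rewrite !ler_pdivrMr// => Ca.
  have -> : e / 4 * a = e / 8 * a + a * (e / 8) by field.
  by lra.
have := le_trans (ub n) t3; move: t1 t2 h2 Dk.
set x1 := \int[Q]_x g x; set x2 := \int[Q]_x trunc k (g x).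
set x3 := \int[Q_ n]_x g_ n x; set x4 := \int[Q_ n]_x trunc k (g_ n x).
set x5 := \int[Q_ n]_x trunc k (g x).
by rewrite !ler_norml => /andP[? ?] /andP[? ?] /andP[? ?] ? /andP[? ?];
  apply/andP; split; lra.
Qed.

End SetwiseIntegral.

(** * Path space with an exponentially weighted distance *)

Section Paths.
Context {R : realType} {T : R} {d : nat}.
Hypothesis T0 : 0 < T.
Implicit Types (w v : Omega R T d) (f : R -> 'rV[R]_d).

Definition clamp (t : R) : R := Num.max 0 (Num.min t T).

Lemma clamp_in t : clamp t \in (`[0, T]%classic : set R).
Proof.
rewrite inE/= in_itv/= /clamp le_max lexx/= ge_max (ltW T0)/=.
by rewrite ge_min lexx orbT.
Qed.

Lemma clamp_id t : 0 <= t <= T -> clamp t = t.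
Proof. by move=> /andP[t0 tT]; rewrite /clamp (min_l tT) max_r. Qed.

Lemma clamp_itv t : 0 <= clamp t <= T.
Proof. by have := clamp_in t; rewrite inE/= in_itv. Qed.

Lemma clampK t : clamp (clamp t) = clamp t.
Proof. by rewrite clamp_id// clamp_itv. Qed.

Lemma clamp_lip s t : `|clamp s - clamp t| <= `|s - t|.
Proof.
have lip1 (a b : R) : `|Num.min a T - Num.min b T| <= `|a - b|.
  have := ler_norm (a - b); have := ler_norm (b - a); rewrite distrC ler_norml.
  by case: (leP a T) => h1; case: (leP b T) => h2 h3 h4; apply/andP; split; lra.
have lip2 (a b : R) : `|Num.max 0 a - Num.max 0 b| <= `|a - b|.
  have := ler_norm (a - b); have := ler_norm (b - a); rewrite distrC ler_norml.
  by case: (leP 0 a) => h1; case: (leP 0 b) => h2 h3 h4; apply/andP; split; lra.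
exact: le_trans (lip2 _ _) (lip1 _ _).
Qed.

Definition to_itv (t : R) : set_type (`[0, T]%classic : set R) :=
  exist (fun x => x \in (`[0, T]%classic : set R)) (clamp t) (clamp_in t).

Lemma to_itv_continuous : continuous to_itv.
Proof.
apply: continuous_comp_initial => t.
apply/cvgrPdist_lt => e e0; near=> s.
apply: le_lt_trans (clamp_lip t s) _.
near: s; have := @nbhsx_ballx _ R t e e0.
by apply: filterS => s; rewrite /ball/=.
Unshelve. all: by end_near. Qed.

(* A path read at all real times, constant outside [0, T]. *)
Fact ev_key : unit. Proof. exact: tt. Qed.
Definition ev : Omega R T d -> R -> 'rV[R]_d := locked_with ev_key (fun w t => X (clamp t) w).

Lemma evE w t : ev w t = X (clamp t) w.
Proof. by rewrite [ev]unlock. Qed.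

Lemma XE w t : 0 <= t <= T -> X t w = ev w t.
Proof. by move=> tT; rewrite evE clamp_id. Qed.

Lemma ev_to_itv w t : ev w t = (w : cpath T d) (to_itv t).
Proof.
rewrite evE /X; case: insubP => [s _ sE|]; last by rewrite clamp_in.
by congr ((w : cpath T d) _); exact/val_inj.
Qed.

Lemma ev_clamp w t : ev w (clamp t) = ev w t.
Proof. by rewrite !evE clampK. Qed.

Lemma ev_continuous w : continuous (ev w).
Proof.
rewrite (_ : ev w = (w : cpath T d) \o to_itv); last exact/funext/ev_to_itv.
move=> t; apply: (@continuous_comp _ _ _ to_itv (w : cpath T d)).
  exact: to_itv_continuous.
exact: cts_fun.
Qed.

Lemma path_ext w v : (forall t, 0 <= t <= T -> ev w t = ev v t) -> w = v.
Proof.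
move=> wv; have wv' : forall s, (w : cpath T d) s = (v : cpath T d) s.
  move=> s; have sI : 0 <= val s <= T by have := svalP s; rewrite inE/= in_itv.
  have := wv _ sI; rewrite !ev_to_itv; suff -> : to_itv (val s) = s by [].
  by apply/val_inj => /=; rewrite clamp_id.
by apply/continuousEP; exact: wv'.
Qed.

Definition restrict_itv f (s : set_type (`[0, T]%classic : set R)) : 'rV[R]_d := f (val s).

Lemma restrict_itv_continuous f : continuous f -> continuous (restrict_itv f).
Proof.
move=> cf s; apply: (@continuous_comp _ _ _ (@set_val _ _) f); last exact: cf.
exact: initial_continuous.
Qed.

(** Total in [f], with the zero path as default, so that formulas need not carry proofs of
    continuity. *)
Definition mkpath f : Omega R T d :=
  if pselect (continuous f) is left cf then
    (mkcts (restrict_itv_continuous cf) : continuousType _ _) : cpath T d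
  else point.

Lemma ev_mkpath f t : continuous f -> ev (mkpath f) t = f (clamp t).
Proof. by move=> cf; rewrite ev_to_itv /mkpath; case: pselect. Qed.

Lemma mkpath_ev w : mkpath (ev w) = w.
Proof.
apply: path_ext => t tT; rewrite ev_mkpath ?ev_clamp//.
exact: ev_continuous.
Qed.

Lemma ev_point t : ev (point : Omega R T d) t = 0.
Proof. by rewrite evE /X; case: insubP. Qed.

Lemma nbhs_path (w : cpath T d) (e : R) : 0 < e ->
  nbhs w [set v : cpath T d | forall t, `|ev w t - ev v t| < e].
Proof.
move=> e0.
pose toU (v : cpath T d) : {uniform set_type (`[0, T]%classic : set R) -> 'rV[R]_d} := v.
have Us : nbhs (toU w) [set h | forall s, `|toU w s - h s| < e].
  apply/uniform_nbhs; exists [set p | ball p.1 e p.2].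
  split; first exact: (entourage_ball _ (PosNum e0)).
  by move=> h /= hP s; have := hP s I; rewrite -ball_normE.
have H := @initial_continuous _ _ toU w _ Us.
apply: (@filterS _ (nbhs w) _ (toU @^-1` [set h | forall s, `|toU w s - h s| < e])) H.
by move=> v /= H t; rewrite !ev_to_itv; exact: H.
Qed.

Lemma open_path (U : set (cpath T d)) (w : cpath T d) : open U -> U w ->
  exists2 e : R, 0 < e & forall v : cpath T d, (forall t, 0 <= t <= T -> `|ev w t - ev v t| <= e) -> U v.
Proof.
move=> oU Uw; have := open_nbhs_nbhs (conj oU Uw).
move=> [V [[W oW WV] Vw VU]].
have := open_nbhs_nbhs (conj oW _ : open_nbhs (w : {uniform set_type (`[0, T]%classic : set R) -> 'rV[R]_d}) W).
rewrite -WV in Vw => /(_ Vw) /uniform_nbhs[E [entE EW]].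
move: entE; rewrite -entourage_ballE => -[e /= e0 eE].
exists (e / 2); first by rewrite divr_gt0.
move=> v wv; apply: VU; rewrite -WV; apply: EW => s _; apply: eE => /=.
rewrite -ball_normE /ball_/=.
have sI : 0 <= val s <= T by have := svalP s; rewrite inE/= in_itv.
have := wv _ sI; rewrite !ev_to_itv.
have -> : to_itv (val s) = s by apply/val_inj => /=; rewrite clamp_id.
move=> /le_lt_trans; apply; by rewrite ltr_pdivrMr// ltr_pMr// ltr1n.
Qed.

Definition wdset (lam : R) w v : set R :=
  [set expR (- (lam * t)) * `|ev w t - ev v t| | t in `[0, T]%classic].

(** Bielecki's weighted uniform distance. It is equivalent to the uniform one, and a large [lam]
    makes the Picard map contractive on all of [0, T] at once. *)
Definition wd (lam : R) w v : R := sup (wdset lam w v).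

Variable lam : R.
Hypothesis lam0 : 0 <= lam.

Lemma path_bounded w v : exists K, forall t, `|ev w t - ev v t| <= K.
Proof.
have cf : continuous (fun t => `|ev w t - ev v t|).
  move=> t; apply: (@cvg_norm _ _ _ (nbhs t) _ (fun t => ev w t - ev v t)).
  by apply: cvgB; exact: ev_continuous.
have [c _ cP] := EVT_max (ltW T0) (continuous_subspaceT cf).
exists (`|ev w c - ev v c|) => t; rewrite -(ev_clamp w t) -(ev_clamp v t).
by apply: cP; rewrite in_itv/= clamp_itv.
Qed.

Lemma wdset_has_sup w v : has_sup (wdset lam w v).
Proof.
split.
  exists (expR (- (lam * 0)) * `|ev w 0 - ev v 0|), 0 => //=.
  by rewrite in_itv/= lexx ltW.
have [K KP] := path_bounded w v; exists K => _ [t /= tI <-].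
move: tI; rewrite in_itv/= => /andP[t0 _].
rewrite (le_trans _ (KP t))// ler_piMl// -(@expR0 R) ler_expR oppr_le0.
by rewrite mulr_ge0.
Qed.

Lemma wd_ub w v t : 0 <= t <= T -> `|ev w t - ev v t| <= expR (lam * t) * wd lam w v.
Proof.
move=> tT; rewrite mulrC -ler_pdivrMr ?expR_gt0// mulrC -expRN.
by apply: ub_le_sup; [case: (wdset_has_sup w v)|exists t].
Qed.

Lemma wd_le w v c : (forall t, 0 <= t <= T -> `|ev w t - ev v t| <= expR (lam * t) * c) ->
  wd lam w v <= c.
Proof.
move=> H; apply: ge_sup; first by case: (wdset_has_sup w v).
move=> _ [t tT <-]; rewrite expRN mulrC ler_pdivrMr ?expR_gt0// mulrC.
exact: H.
Qed.

Lemma wd_ge0 w v : 0 <= wd lam w v.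
Proof.
have := @wd_ub w v 0; rewrite lexx/= ltW// => /(_ isT) /(le_trans (normr_ge0 _)).
by rewrite mulr0 expR0 mul1r.
Qed.

Lemma wd_sym w v : wd lam w v = wd lam v w.
Proof.
by apply/eqP; rewrite eq_le; apply/andP; split; apply: wd_le => t tT;
  rewrite distrC wd_ub.
Qed.

Lemma wd_triangle w v u : wd lam w u <= wd lam w v + wd lam v u.
Proof.
apply: wd_le => t tT; rewrite mulrDr -(subrKA (ev v t)).
by rewrite (le_trans (ler_normD _ _))// lerD// wd_ub.
Qed.

Lemma wdxx w : wd lam w w = 0.
Proof.
apply/eqP; rewrite eq_le wd_ge0 andbT; apply: wd_le => t _.
by rewrite subrr normr0 mulr0.
Qed.

Lemma wd_eq0 w v : wd lam w v = 0 -> w = v.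
Proof.
move=> wv; apply: path_ext => t tT; apply/eqP; rewrite -subr_eq0 -normr_le0.
by have := wd_ub w v tT; rewrite wv mulr0.
Qed.

(** The weight is at most 1, so a Lipschitz function for [wd] is continuous for the uniform
    topology, hence Borel. The sign of [K] is left free; |K| + 1 is used inside. *)
Lemma wd_lip_measurable (f : Omega R T d -> R) K :
  (forall w v, `|f w - f v| <= K * wd lam w v) -> measurable_fun setT f.
Proof.
move=> fK; pose K' := `|K| + 1; have K'0 : 0 < K' by rewrite ltr_wpDl.
apply: (measurability _ (RGenOpens.measurableE R)).
move=> _ [_ [x [y ->]] <-]; rewrite setTI; apply: sub_sigma_algebra.
rewrite openE => w /= fw.
have := @interval_open R (BRight x) (BLeft y) isT isT; rewrite openE => /(_ _ fw) /=.
move=> /nbhs_ballP[e /= e0 eU].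
have eK : 0 < e / K' by rewrite divr_gt0.
have eK2 : 0 < e / K' / 2 by rewrite divr_gt0.
apply: filterS (nbhs_path w eK2) => v /= wv; apply: eU.
rewrite -ball_normE /ball_/= (le_lt_trans (fK _ _))//.
have wdle : wd lam w v <= e / K' / 2.
  apply: wd_le => t /andP[t0 tT]; rewrite (le_trans (ltW (wv t)))// ler_peMl ?(ltW eK2)//.
  by rewrite -(@expR0 R) ler_expR mulr_ge0.
have K1 : K * wd lam w v <= K' * wd lam w v.
  by apply: ler_wpM2r; [exact: wd_ge0|rewrite (le_trans (ler_norm _))// lerDl].
apply: (le_lt_trans K1); apply: (@le_lt_trans _ _ (K' * (e / K' / 2))).
  by rewrite ler_pM2l.
rewrite (_ : K' * _ = e / 2); last by field; rewrite gt_eqF.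
by rewrite ltr_pdivrMr// ltr_pMr// ltr1n.
Qed.

Lemma measurable_wd v : measurable_fun setT (fun w : Omega R T d => wd lam w v).
Proof.
apply: (@wd_lip_measurable _ 1) => w u; rewrite mul1r ler_norml.
have := wd_triangle w u v; have := wd_triangle u w v; rewrite (wd_sym u w) => h1 h2.
by apply/andP; split; lra.
Qed.

Lemma measurable_norm_ev t : measurable_fun setT (fun w : Omega R T d => `|ev w t|).
Proof.
apply: (@wd_lip_measurable _ (expR (lam * clamp t))) => w v.
apply: (le_trans (ler_dist_dist _ _)).
by rewrite -(ev_clamp w t) -(ev_clamp v t); apply: wd_ub; apply: clamp_itv.
Qed.

End Paths.
Arguments clamp {R} T t.

(** * Coordinates and the sup norm *)

Section RowNorm.
Context {R : realType} {d : nat}.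
Implicit Types x : 'rV[R]_d.

Lemma rV_coord_le x i : `|x 0 i| <= `|x|.
Proof.
rewrite [leRHS]mx_normrE; apply: (@le_bigmax _ _ _ 0 (fun i : 'I_1 * 'I_d => `|x i.1 i.2|) (0, i)).
Qed.

Lemma rV_norm_le x c : 0 <= c -> (forall i, `|x 0 i| <= c) -> `|x| <= c.
Proof.
move=> c0 xc; rewrite [leLHS]mx_normrE; apply: bigmax_le => // -[i j] _ /=.
by rewrite ord1.
Qed.

End RowNorm.

(** * Dyadic times *)

Section Dyadic.
Context {R : realType} {T : R} {d : nat}.
Hypothesis T0 : 0 < T.
Implicit Types (w v : Omega R T d).

Definition dy (m i : nat) : R := T * i%:R / 2 ^+ m.

Lemma exp2_gt0 m : 0 < (2 ^+ m : R). Proof. exact: exprn_gt0. Qed.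

Lemma dyS m i : dy m i.+1 = dy m i + T / 2 ^+ m.
Proof. by rewrite /dy -natr1; field; rewrite gt_eqF ?exp2_gt0//. Qed.

Lemma dy_ge0 m i : 0 <= dy m i.
Proof. by rewrite /dy divr_ge0 ?mulr_ge0 ?(ltW T0) ?(ltW (exp2_gt0 m)). Qed.

Lemma dy_le m i j : (i <= j)%N -> dy m i <= dy m j.
Proof.
move=> ij; rewrite /dy ler_pM2r ?invr_gt0 ?exp2_gt0// ler_pM2l// ler_nat//.
Qed.

Lemma dyT m : dy m (2 ^ m) = T.
Proof. by rewrite /dy natrX mulfK// gt_eqF ?exp2_gt0//. Qed.

Lemma dy_itv m i : (i <= 2 ^ m)%N -> 0 <= dy m i <= T.
Proof. by move=> im; rewrite dy_ge0 -(dyT m) dy_le. Qed.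

Lemma dy_refine m k i : dy m i = dy (m + k) (i * 2 ^ k).
Proof.
rewrite /dy natrM natrX exprD; field; rewrite !gt_eqF ?exp2_gt0//.
Qed.

Lemma dy_cover m s : 0 <= s <= T -> exists2 i, (i < 2 ^ m)%N & dy m i <= s <= dy m i.+1.
Proof.
(* The right end T belongs to the last cell; any other s lies in the cell numbered by the integer
   part of 2^m s / T. *)
move=> /andP[s0 sT]; have [->|sT'] := eqVneq s T.
  exists (2 ^ m).-1; first by rewrite prednK// expn_gt0.
  by rewrite prednK ?expn_gt0// dyT lexx andbT -[leRHS](dyT m) dy_le// leq_pred.
have {}sT : s < T by rewrite lt_neqAle sT'.
pose u := s * 2 ^+ m / T.
have u0 : 0 <= u by rewrite divr_ge0 ?mulr_ge0 ?(ltW T0) ?(ltW (exp2_gt0 m)).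
have su : s = T * u / 2 ^+ m by rewrite /u; field; rewrite !gt_eqF ?exp2_gt0//.
exists (Num.truncn u).
  rewrite -(ltr_nat R); apply: le_lt_trans (_ : u < _); first by rewrite truncn_le.
  rewrite natrX /u ltr_pdivrMr// mulrC ltr_pM2l ?exp2_gt0//.
have c0 : 0 < (2 ^+ m)^-1 :> R by rewrite invr_gt0 exp2_gt0.
rewrite su /dy; apply/andP; split.
  by rewrite ler_pM2r// ler_pM2l// truncn_le.
by rewrite ler_pM2r// ler_pM2l// ltW// truncnS_gt.
Qed.

Lemma dyadic_small e : 0 < e -> exists m, forall n, (m <= n)%N -> T / 2 ^+ n < e.
Proof.
move=> e0; have eT : 0 < e / T by rewrite divr_gt0.
have [m _ mP] := near_infty_natSinv_expn_lt (PosNum eT).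
exists m => n mn; have := mP n mn; rewrite /= div1r => H.
by rewrite -ltr_pdivlMl// mulrC.
Qed.

(** Uniform continuity on the compact interval, with the modulus expressed by a dyadic mesh. *)
Lemma path_modulus w e : 0 < e ->
  exists2 m, True & forall n s t, (m <= n)%N -> `|s - t| <= T / 2 ^+ n -> `|ev w s - ev w t| <= e.
Proof.
move=> e0; have := @segment_compact R 0 T; rewrite compact_near_coveringP => cpt.
pose P (del s : R) := forall t, `|s - t| < del -> `|ev w s - ev w t| <= e.
have H : \forall del \near 0^'+, `[0, T]%classic `<=` P del.
  apply: cpt => x _.
  have e2 : 0 < e / 2 by rewrite divr_gt0.
  have /cvgrPdist_lt/(_ _ e2) := @ev_continuous R T d T0 w x.
  move=> /nbhs_ballP[r /= r0 rP].
  have r2 : 0 < r / 2 by rewrite divr_gt0.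
  exists (ball x (r / 2), [set del : R | 0 < del < r / 2]) => /=.
    split; first exact: nbhsx_ballx.
    by near=> del => /=; apply/andP; split; near: del; [exact: nbhs_right_gt|exact: nbhs_right_lt].
  move=> [s del] [] /= xs /andP[del0 delr] t st.
  have xs' : `|x - s| < r / 2 by [].
  have h1 : `|ev w x - ev w s| < e / 2.
    by apply: rP; rewrite /ball/= (lt_trans xs')// ltr_pdivrMr// ltr_pMr// ltr1n.
  have h2 : `|ev w x - ev w t| < e / 2.
    apply: rP; rewrite /ball/= -(subrKA s) (le_lt_trans (ler_normD _ _))//.
    by rewrite (splitr r) ltrD// (lt_trans st).
  rewrite -(subrKA (ev w x)) (le_trans (ler_normD _ _))// (splitr e) lerD//.
    by rewrite distrC ltW.
  exact: ltW.
have [del /= [del0 delP]] : exists del : R, 0 < del /\ `[0, T]%classic `<=` P del.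
  near (0 : R)^'+ => del; exists del; split; last by near: del.
  by near: del; exact: nbhs_right_gt.
have [m mP] := dyadic_small del0.
exists m => // n s t mn st; rewrite -(ev_clamp T0 w s) -(ev_clamp T0 w t).
apply: delP.
  by rewrite /= in_itv/= clamp_itv.
apply: le_lt_trans (mP _ mn); exact: le_trans (clamp_lip s t) st.
Unshelve. all: by end_near. Qed.

Lemma dyadic_dense w v e : (forall l j, (j <= 2 ^ l)%N -> `|ev w (dy l j) - ev v (dy l j)| <= e) ->
  forall t, 0 <= t <= T -> `|ev w t - ev v t| <= e.
Proof.
move=> H t tT; apply/ler_addgt0Pr => a a0; have a2 : 0 < a / 2 by rewrite divr_gt0.
have [m1 _ m1P] := path_modulus w a2; have [m2 _ m2P] := path_modulus v a2.
have [i im /andP[h1 h2]] := dy_cover (maxn m1 m2) tT.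
set m := maxn m1 m2 in im h1 h2.
have di : `|t - dy m i| <= T / 2 ^+ m.
  by rewrite ger0_norm ?subr_ge0// lerBlDl -dyS.
have a1 := m1P m _ _ (leq_maxl _ _) di; have a3 := m2P m _ _ (leq_maxr _ _) di.
rewrite -(subrKA (ev w (dy m i))) (le_trans (ler_normD _ _))//.
have := ler_normD (ev w (dy m i) - ev v (dy m i)) (ev v (dy m i) - ev v t).
rewrite subrKA; have := H m i (ltnW im).
rewrite distrC in a3; move=> ? ?; lra.
Qed.

End Dyadic.
Arguments dy {R} T m i.

(** * Countably many dyadic cylinders generate the Borel sets *)

Section Cylinders.
Context {R : realType} {T : R} {d : nat}.
Hypothesis T0 : 0 < T.
Implicit Types (w v : Omega R T d).

Definition cyl_index : Type := (nat * nat * 'I_d * rat * rat)%type.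

Definition in_cyl (p : nat * nat * 'I_d * rat * rat) w : bool :=
  let: (m, i, c, a, b) := p in ratr a <= ev w (dy T m i) 0 c <= ratr b.

(** Finite conjunctions of closed rational constraints at dyadic times: a countable family stable
    under intersection, as [setwise_compact] requires. *)
Definition cylinder (s : seq (nat * nat * 'I_d * rat * rat)) : set (Omega R T d) :=
  [set w | all (fun p => in_cyl p w) s].

Definition cylinder_seq (n : nat) : set (Omega R T d) := cylinder (odflt [::] (unpickle n)).

Lemma cylinder_seqP s : range cylinder_seq (cylinder s).
Proof. by exists (pickle s) => //; rewrite /cylinder_seq pickleK. Qed.

Lemma cylinder_setI : setI_closed (range cylinder_seq).
Proof.
move=> _ _ [m _ <-] [n _ <-]; rewrite /cylinder_seq.
set s := odflt _ _; set t := odflt _ _.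
rewrite (_ : _ `&` _ = cylinder (s ++ t)); first exact: cylinder_seqP.
apply/seteqP; split => w /=; rewrite /cylinder/= all_cat.
  by move=> [-> ->].
by move=> /andP[].
Qed.

Lemma measurable_evc t c : measurable_fun setT (fun w : Omega R T d => ev w t 0 c).
Proof.
under eq_fun do rewrite evE.
exact: (measurableT_comp (measurable_coord c) (measurable_X (clamp T t))).
Qed.

(** Stated for any sigma-algebra [G] on any set, because it is used both for measurable maps into
    path space and for the sigma-algebra of one dyadic grid. *)
Lemma preimage_cylinder (E : Type) (f : E -> Omega R T d) (G : set (set E)) :
  sigma_algebra setT G ->
  forall s, (forall p, p \in s -> G [set e | in_cyl p (f e)]) -> G (f @^-1` cylinder s).
Proof.
move=> [G0 GC GU]; elim => [|p s IH] Gs.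
  rewrite (_ : _ @^-1` _ = setT `\` set0); first exact: GC.
  by rewrite setD0; apply/seteqP; split.
have Gp := Gs p (mem_head _ _).
have {}IH : G (f @^-1` cylinder s) by apply: IH => q qs; apply: Gs; rewrite inE qs orbT.
pose F := bigcup2 (setT `\` [set e | in_cyl p (f e)]) (setT `\` (f @^-1` cylinder s)).
rewrite (_ : _ @^-1` _ = setT `\` \bigcup_n F n).
  apply: (GC _); apply: (GU _) => -[|[|n]] /=; [exact: GC|exact: GC|exact: G0].
rewrite /F bigcup2E setTD setCU !setTD !setCK.
by apply/seteqP; split => e /= => [/andP[]//|[h1 h2]]; apply/andP.
Qed.

Lemma measurable_cylinder s : measurable (cylinder s).
Proof.
apply: (@preimage_cylinder _ id measurable); first exact: sigma_algebra_measurable.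
move=> [[[[m i] c] a] b] _; have := @measurable_evc (dy T m i) c measurableT `[ratr a, ratr b]%classic (measurable_itv _).
by rewrite setTI; congr measurable; apply/seteqP; split => w /=; rewrite in_itv.
Qed.

(* The paths staying 1/(k+1)-close to the step function with values q on the m-th dyadic
   grid; only dyadic times are tested, which makes it a countable intersection of cylinders. *)
Let cell (p : nat * nat * seq 'rV[rat]_d) : set (Omega R T d) :=
  [set w | forall l j i c, (i < 2 ^ p.1.1)%N -> (j <= 2 ^ l)%N ->
    dy T p.1.1 i <= dy T l j <= dy T p.1.1 i.+1 ->
    in_cyl (l, j, c, nth 0 p.2 i 0 c - p.1.2.+1%:R^-1, nth 0 p.2 i 0 c + p.1.2.+1%:R^-1) w].

Let cell_gen p : <<s range cylinder_seq >> (cell p).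
Proof.
have SA : sigma_algebra setT <<s range cylinder_seq >> by exact: smallest_sigma_algebra.
pose C (y : nat * nat * nat * 'I_d) : set (Omega R T d) :=
  let: (l, j, i, c) := y in
  if (i < 2 ^ p.1.1)%N && (j <= 2 ^ l)%N && (dy T p.1.1 i <= dy T l j <= dy T p.1.1 i.+1) then
    cylinder [:: (l, j, c, nth 0 p.2 i 0 c - p.1.2.+1%:R^-1, nth 0 p.2 i 0 c + p.1.2.+1%:R^-1)]
  else cylinder [::].
have gC y : <<s range cylinder_seq >> (C y).
  apply: sub_sigma_algebra; move: y => [[[l j] i] c] /=.
  by case: ifP => _; exact: cylinder_seqP.
have -> : cell p = setT `\` \bigcup_n (setT `\` (if @unpickle (nat * nat * nat * 'I_d)%type n is Some y then C y else setT)).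
  rewrite setTD setC_bigcup; under eq_bigcapr do rewrite setTD setCK.
  apply/seteqP; split => w.
    move=> cw n _; case: unpickle => // -[[[l j] i] c] /=.
    case: ifP => // /andP[/andP[h1 h2] h3]; rewrite /cylinder/= andbT.
    exact: cw.
  move=> H l j i c h1 h2 h3; have := H (pickle (l, j, i, c)) I.
  by rewrite pickleK /= h1 h2 h3/= /cylinder/= andbT.
have [G0 GC GU] := SA.
apply: (GC _); apply: (GU _) => n; apply: (GC _); case: unpickle => [y|]; first exact: gC.
by have := GC _ G0; rewrite setD0.
Qed.

(** An open set is the union of the cells it contains, and there are countably many cells: a path of
    the set lies in a cell around a rational step function close to it. *)
Lemma measurable_sub_cylinder : measurable `<=` <<s range cylinder_seq >>.
Proof.
apply: smallest_sub; first exact: smallest_sigma_algebra.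
move=> U oU.
have [G0 GC GU] := @smallest_sigma_algebra _ setT (range cylinder_seq).
have -> : U = \bigcup_n (if @unpickle (nat * nat * seq 'rV[rat]_d)%type n is Some p then
    (if `[< cell p `<=` U >] then cell p else set0) else set0).
  apply/seteqP; split => [w Uw|w [n _]]; last first.
    by case: unpickle => // p; case: asboolP => // + cw; apply.
  have [e e0 eU] := open_path T0 oU Uw.
  have e2 : 0 < e / 2 by rewrite divr_gt0.
  (* With h = 1/(k+1) < e/2, oscillation h/2 on the grid and rational values within h/2, the path
     [w] is within h of the step function. Any other path of the cell is then within 2h < e of
     [w]. *)
  have [k _ /(_ k (leqnn k)) kP] := near_infty_natSinv_lt (PosNum e2).
  pose h : R := k.+1%:R^-1; have h0 : 0 < h by rewrite invr_gt0.
  have h2 : 0 < h / 2 by rewrite divr_gt0.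
  have [m _ mP] := path_modulus T0 w h2.
  have /choice[q qP] : forall i, exists q : 'rV[rat]_d, forall c,
      `|ratr (q 0 c) - ev w (dy T m i) 0 c| < h / 2.
    move=> i; have /choice[f fP] : forall c, exists r : rat, `|ratr r - ev w (dy T m i) 0 c| < h / 2.
      move=> c; set x := ev w (dy T m i) 0 c.
      have /rat_in_itvoo[r] : x - h / 2 < x + h / 2 by lra.
      by rewrite in_itv/= -ltr_distl => ?; exists r.
    by exists (\row_c f c) => c; rewrite mxE.
  pose p : nat * nat * seq 'rV[rat]_d := (m, k, mkseq q (2 ^ m)).
  have ratrE (x : rat) : ratr (x - k.+1%:R^-1) = ratr x - h :> R.
    by rewrite rmorphB/= fmorphV/= ratr_nat.
  have ratrE' (x : rat) : ratr (x + k.+1%:R^-1) = ratr x + h :> R.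
    by rewrite rmorphD/= fmorphV/= ratr_nat.
  exists (pickle p) => //; rewrite pickleK.
  have cw : cell p w.
    move=> l j i c /= im jl /andP[h3 h4]; rewrite nth_mkseq// ratrE ratrE'.
    have st : `|dy T m i - dy T l j| <= T / 2 ^+ m.
      by rewrite distrC ger0_norm ?subr_ge0// lerBlDl -dyS.
    have := le_trans (rV_coord_le _ c) (mP m _ _ (leqnn m) st).
    have := qP i c; rewrite !mxE ltr_norml ler_norml => /andP[? ?] /andP[? ?].
    by apply/andP; split; lra.
  rewrite asboolT// => v cv; apply: eU; apply: (dyadic_dense T0) => l j jl.
  have [i im ij] := dy_cover T0 m (dy_itv T0 jl).
  apply: (rV_norm_le (ltW e0)) => c.
  have /= := cw l j i c im jl ij; have /= := cv l j i c im jl ij.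
  rewrite nth_mkseq// ratrE ratrE' !mxE => /andP[? ?] /andP[? ?].
  move: kP; rewrite /= -/h => kP.
  by rewrite ler_norml; apply/andP; split; lra.
apply: (GU _) => n; case: unpickle => [p|]; last exact: G0.
by case: asboolP => _; [exact: cell_gen|exact: G0].
Qed.

(** As cylinders generate the Borel sets, a map into path space is measurable once its coordinates
    at each time are. *)
Lemma measurable_path dsp (E : measurableType dsp) (f : E -> Omega R T d) :
  (forall t c, 0 <= t <= T -> measurable_fun setT (fun e => ev (f e) t 0 c)) ->
  measurable_fun setT f.
Proof.
move=> mf.
have mE : @measurable _ (Omega R T d) = <<s range cylinder_seq >>.
  apply/seteqP; split; first exact: measurable_sub_cylinder.
  apply: smallest_sub; first exact: sigma_algebra_measurable.
  by move=> _ [n _ <-]; exact: measurable_cylinder.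
apply: (measurability _ mE) => _ [_ [n _ <-] <-]; rewrite setTI.
apply: preimage_cylinder; first exact: sigma_algebra_measurable.
move=> [[[[m i] c] a] b] _; have tT := clamp_itv T0 (dy T m i : R).
have := mf _ c tT measurableT `[ratr a, ratr b]%classic (measurable_itv _).
rewrite setTI; congr measurable; apply/seteqP; split => e /=; rewrite in_itv/= ev_clamp//.
Qed.

End Cylinders.

(** * Laws are determined by the initial position and the dyadic increments *)

Section LawUnique.
Context {R : realType} {T : R} {d : nat}.
Hypothesis T0 : 0 < T.
Implicit Types (w v : Omega R T d).

Definition increment_rect (m : nat) (A : set (Rd R d)) (B : 'I_(2 ^ m) -> 'I_d -> set R) :
    set (Omega R T d) :=
  [set w | A (X 0 w) /\ forall i j, B i j ((ev w (dy T m i.+1) - ev w (dy T m i)) 0 j)].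

Lemma measurable_increment_rect m (A : set (Rd R d)) (B : 'I_(2 ^ m) -> 'I_d -> set R) :
  measurable A -> (forall i j, measurable (B i j)) -> measurable (increment_rect A B).
Proof.
move=> mA mB.
rewrite (_ : increment_rect A B = X 0 @^-1` A `&`
  \bigcap_(p in [set: 'I_(2 ^ m) * 'I_d]) [set w | B p.1 p.2 ((ev w (dy T m p.1.+1) - ev w (dy T m p.1)) 0 p.2)]); last first.
  apply/seteqP; split => w /=.
    by move=> [a b]; split => // -[i j] _; exact: b.
  by move=> [a b]; split => // i j; exact: (b (i, j)).
apply: measurableI.
  by rewrite -[X in measurable X]setTI; exact: measurable_X.
apply: fin_bigcap_measurable => // -[i j] _ /=.
have mf : measurable_fun setT (fun w : Omega R T d => (ev w (dy T m i.+1) - ev w (dy T m i)) 0 j).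
  under eq_fun do rewrite !mxE.
  by apply: measurable_funB; exact: measurable_evc.
by have := mf measurableT _ (mB i j); rewrite setTI.
Qed.

Let rects (m : nat) : set (set (Omega R T d)) :=
  [set S | exists A B, [/\ measurable A, forall i j, measurable (B i j) & S = @increment_rect m A B]].

Let rects_setT m : rects m setT.
Proof.
exists setT, (fun _ _ => setT); split => //.
by apply/seteqP; split => w.
Qed.

Let rects_setI m : setI_closed (rects m).
Proof.
move=> _ _ [A [B [mA mB ->]]] [A' [B' [mA' mB' ->]]].
exists (A `&` A'), (fun i j => B i j `&` B' i j); split.
- exact: measurableI.
- by move=> i j; exact: measurableI.
- apply/seteqP; split => w /=.
    by move=> [[a b] [a' b']]; split => // i j; split.
  by move=> [[a a'] b]; split; split => // i j; case: (b i j).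
Qed.

Let measurable_rects m : rects m `<=` measurable.
Proof. by move=> _ [A [B [mA mB ->]]]; exact: measurable_increment_rect. Qed.

Let measurable_dy m i c :
  measurable_fun [set: g_sigma_algebraType (rects m)] (fun w => ev w (dy T m i) 0 c).
Proof.
have H0 : measurable_fun [set: g_sigma_algebraType (rects m)] (fun w => ev w (dy T m 0) 0 c).
  move=> _ V mV; rewrite setTI; apply: sub_sigma_algebra.
  exists ((fun x : Rd R d => (x : 'rV[R]_d) 0 c) @^-1` V), (fun _ _ => setT); split => //.
    by rewrite -[X in measurable X]setTI; exact: measurable_coord.
  have E w : ev w (dy T m 0) = X 0 w by rewrite XE ?lexx ?ltW// /dy mulr0 mul0r.
  by apply/seteqP; split => w /=; rewrite E; [move=> ?; split|case].
have H k : (k <= 2 ^ m)%N ->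
    measurable_fun [set: g_sigma_algebraType (rects m)] (fun w => ev w (dy T m k) 0 c).
  elim: k => // k IH km.
  rewrite (_ : (fun w => _) = (fun w : Omega R T d => ev w (dy T m k) 0 c) \+
     (fun w => (ev w (dy T m k.+1) - ev w (dy T m k)) 0 c)); last first.
    by apply/funext => w /=; rewrite !mxE; ring.
  apply: measurable_funD; first by exact: (IH (ltnW km)).
  move=> _ V mV; rewrite setTI; apply: sub_sigma_algebra.
  exists setT, (fun i j => if (i == Ordinal km) && (j == c) then V else setT); split => //.
    by move=> i1 j1; case: ifP.
  apply/seteqP; split => w /=.
    by move=> h; split => // i1 j1; case: ifP => // /andP[/eqP-> /eqP->].
  by move=> [_ /(_ (Ordinal km) c)]; rewrite !eqxx.
(* Beyond index 2^m the dyadic time exceeds T, where [ev] keeps its value at T. *)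
have [im|im] := leqP i (2 ^ m); first exact: H.
rewrite (_ : (fun w => _) = (fun w => ev w (dy T m (2 ^ m)) 0 c)); first exact: H.
apply/funext => w; rewrite -(ev_clamp T0) (_ : clamp _ _ = dy T m (2 ^ m))//.
have := dy_le T0 m (ltnW im); rewrite dyT => h.
by rewrite /clamp min_r// max_r ?dyT// ltW.
Qed.

(** The rectangles of level m form a pi-system, and positions on the grid are sums of increments, so
    both laws agree on the sigma-algebra of the grid. A cylinder involves finitely many dyadic
    times, all of them on the grid of the finest level that occurs; cylinders are in turn a
    generating pi-system. *)
Lemma law_unique (P P' : probability (Omega R T d) R) :
  (forall m (A : set (Rd R d)) (B : 'I_(2 ^ m) -> 'I_d -> set R), measurable A ->
     (forall i j, measurable (B i j)) ->
     P (increment_rect A B) = P' (increment_rect A B)) ->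
  forall S, measurable S -> P S = P' S.
Proof.
move=> PP' S mS.
have agree m (S' : set (Omega R T d)) : <<s rects m >> S' -> P S' = P' S'.
  apply: (@g_sigma_algebra_measure_unique _ _ _ (rects m) (@measurable_rects m) (fun=> setT)) => //.
  - by rewrite bigcup_const//; exists 0%N.
  - by move=> _ [A [B [mA mB ->]]]; exact: PP'.
  - by move=> k; apply: (le_lt_trans (probability_le1 P measurableT)); rewrite ltry.
apply: (measure_unique (range (@cylinder_seq R T d)) (fun=> setT)) => //.
- apply/seteqP; split; first exact: measurable_sub_cylinder.
  apply: smallest_sub; first exact: sigma_algebra_measurable.
  by move=> _ [n _ <-]; exact: measurable_cylinder.
- exact: cylinder_setI.
- by move=> _; rewrite (_ : setT = @cylinder R T d [::]); [exact: cylinder_seqP|apply/seteqP; split].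
- by rewrite bigcup_const//; exists 0%N.
- move=> _ [n _ <-]; rewrite /cylinder_seq; set s := odflt _ _.
  apply: (agree (\max_(p <- s) p.1.1.1.1)); set m := \max_(p <- s) _.
  apply: (@preimage_cylinder R T d _ id); first exact: smallest_sigma_algebra.
  move=> p ps; have : (p.1.1.1.1 <= m)%N by rewrite /m; exact: leq_bigmax_seq.
  move: p ps => [[[[m' i] c] a] b] _ /= mm.
  rewrite (@dy_refine R T m' (m - m') i) subnKC//.
  have := @measurable_dy m (i * 2 ^ (m - m')) c measurableT `[ratr a, ratr b]%classic (measurable_itv _).
  by rewrite setTI; congr (<<s _ >> _); apply/seteqP; split => w /=; rewrite in_itv.
- by move=> k; apply: (le_lt_trans (probability_le1 P measurableT)); rewrite ltry.
Qed.

End LawUnique.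

(** * Gaussian integrals *)

Section Gaussian.
Context {R : realType}.

(** The change of variables formula uses a Radon-Nikodym derivative; it equals [normal_pdf] almost
    everywhere since both have the same integral over each measurable set. *)
Lemma ge0_integral_normal_prob (m s : R) (g : R -> \bar R) : measurable_fun setT g ->
  (forall x, 0 <= g x)%E ->
  (\int[normal_prob m s]_x g x = \int[lebesgue_measure]_x (g x * (normal_pdf m s x)%:E))%E.
Proof.
move=> mg g0; have dom := normal_prob_dominates m s.
rewrite -(Radon_Nikodym_SigmaFinite.change_of_variables dom)//.
have mpdf : measurable_fun setT (fun x => (normal_pdf m s x)%:E).
  by apply/measurable_EFinP; exact: measurable_normal_pdf.
have mf : measurable_fun setT (Radon_Nikodym_SigmaFinite.f (normal_prob m s) (@lebesgue_measure R)).
  by apply: measurable_int; exact: Radon_Nikodym_SigmaFinite.f_integrable.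
apply: ae_eq_integral => //.
- exact: emeasurable_funM.
- exact: emeasurable_funM.
apply: ae_eqe_mul2l; apply: integral_ae_eq => //.
- exact: Radon_Nikodym_SigmaFinite.f_integrable.
- by move=> A _ mA; rewrite -Radon_Nikodym_SigmaFinite.f_integral.
Qed.

(* [exp (x^2 / (4 s^2))] times the density of N(0, s^2) is [sqrt 2] times that of N(0, 2 s^2). *)
Lemma gaussian_square_exp (s : R) : 0 < s ->
  (\int[normal_prob 0 s]_x (expR (x ^+ 2 / (4 * s ^+ 2)))%:E <= 2%:E)%E.
Proof.
move=> s0; have s0' : s != 0 by rewrite gt_eqF.
rewrite ge0_integral_normal_prob; last 2 first.
- by apply/measurable_EFinP; apply: measurableT_comp => //; exact: measurable_funM.
- by move=> x; rewrite lee_fin expR_ge0.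
pose r2 := Num.sqrt 2 : R; have r20 : 0 < r2 by rewrite sqrtr_gt0.
have r2sq : r2 ^+ 2 = 2 by rewrite sqr_sqrtr.
pose t := r2 * s; have t0 : 0 < t by rewrite mulr_gt0.
have t0' : t != 0 by rewrite gt_eqF.
have E x : expR (x ^+ 2 / (4 * s ^+ 2)) * normal_pdf 0 s x = r2 * normal_pdf 0 t x.
  rewrite !normal_pdfE// /normal_fun !subr0.
  have -> : normal_peak t = r2^-1 * normal_peak s.
    rewrite /normal_peak -invfM; congr (_^-1).
    rewrite /t exprMn r2sq -mulrA -mulrnAr sqrtrM//.
  rewrite [RHS]mulrA (mulrA r2) mulfV ?gt_eqF// mul1r mulrCA; congr (_ * _).
  rewrite -expRD /t exprMn r2sq; congr expR.
  rewrite !mulr2n; have sq0 : 0 < s ^+ 2 by rewrite exprn_gt0.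
  by field; rewrite s0' !gt_eqF ?addr_gt0 ?mulr_gt0//.
under eq_integral do rewrite -EFinM E EFinM.
rewrite integralZl//; last exact: integrable_normal_pdf.
rewrite integral_normal_pdf mule1 lee_fin.
rewrite -ler_sqr ?nnegrE ?(ltW r20)// r2sq; lra.
Qed.

(* [normal_prob] lives on [measurableTypeR R], whose display differs from that of [R]. *)
Lemma ge0_integral_normal_law dsp (E : measurableType dsp) (M : probability E R) (F : E -> R) s
    (f : R -> \bar R) : measurable_fun setT F ->
  (forall V : set R, measurable V -> M (F @^-1` V) = normal_prob 0 s V) ->
  measurable_fun setT f -> (forall x, 0 <= f x)%E ->
  (\int[normal_prob 0 s]_x f x = \int[M]_x f (F x))%E.
Proof.
move=> mF H mf f0.
have law : @has_law _ _ E (measurableTypeR R) R F M (normal_prob 0 s).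
  by move=> A mA; rewrite H.
exact: (@ge0_integral_law _ _ E (measurableTypeR R) R F mF M (normal_prob 0 s) f law mf f0).
Qed.

End Gaussian.

(** * Second moments of paths by chaining *)

Section Chaining.
Context {R : realType} {T : R} {d : nat}.
Hypothesis T0 : 0 < T.
Implicit Types (w v : Omega R T d).

Definition increment (m i : nat) (c : 'I_d) w : R :=
  (ev w (dy T m i.+1) - ev w (dy T m i)) 0 c.

Lemma measurable_increment m i c : measurable_fun setT (increment m i c).
Proof.
rewrite /increment; under eq_fun do rewrite !mxE.
by apply: measurable_funB; exact: measurable_evc.
Qed.

(** 1 / (4 s^2) for the variance s^2 = T / 2^j of an increment of level j: the exponent allowed by
    [gaussian_square_exp]. *)
Let a (j : nat) : R := 2 ^+ j / (4 * T).

Let a0 j : 0 < a j.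
Proof. by rewrite /a divr_gt0 ?mulr_gt0// exp2_gt0. Qed.

Let lse (j : nat) w : R :=
  \sum_(p : 'I_(2 ^ j) * 'I_d) expR (a j * increment j p.1 p.2 w ^+ 2).

(* Log-sum-exp: a measurable majorant of the largest squared increment of level j. *)
Let g (j : nat) w : R := (a j)^-1 * ln (lse j w).

Let lse_ge j w (i : 'I_(2 ^ j)) (c : 'I_d) : expR (a j * increment j i c w ^+ 2) <= lse j w.
Proof.
rewrite /lse (bigD1 (i, c))//= lerDl sumr_ge0// => p _; exact: expR_ge0.
Qed.

Let g_ge j w i c : (i < 2 ^ j)%N -> increment j i c w ^+ 2 <= g j w.
Proof.
move=> ij; rewrite /g mulrC ler_pdivlMr// mulrC -[leLHS]expRK ler_ln ?posrE ?expR_gt0//.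
  exact: (lse_ge w (Ordinal ij) c).
exact: lt_le_trans (expR_gt0 _) (lse_ge w (Ordinal ij) c).
Qed.

Let measurable_lse j : measurable_fun setT (lse j).
Proof.
apply: measurable_sum => p; apply: measurableT_comp => //.
by apply: measurable_funM => //; apply: measurable_funX; exact: measurable_increment.
Qed.

Let measurable_g j : measurable_fun setT (g j).
Proof.
apply: measurable_funM => //; apply: (measurableT_comp (@measurable_ln _)).
exact: measurable_lse.
Qed.

Let incr_bound w m i : (0 < d)%N -> (i < 2 ^ m)%N ->
  `|ev w (dy T m i.+1) - ev w (dy T m i)| <= Num.sqrt (g m w).
Proof.
move=> d0 im; apply: rV_norm_le; first exact: sqrtr_ge0.
move=> c; rewrite -sqrtr_sqr ler_wsqrtr//.
exact: g_ge.
Qed.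

(** A grid point of level m+1 is a grid point of level m or lies one increment of level m+1 after
    one, so each level contributes at most one increment. *)
Let chain_bound w m i : (0 < d)%N -> (i <= 2 ^ m)%N ->
  `|ev w (dy T m i) - ev w 0| <= \sum_(j < m.+1) Num.sqrt (g j w).
Proof.
move=> d0; elim: m i => [|m IH] i im.
  rewrite big_ord_recr big_ord0/= add0r; case: i im => [|[|//]] _.
    by rewrite /dy mulr0 mul0r subrr normr0 sqrtr_ge0.
  by have := @incr_bound w 0 0 d0 isT; rewrite {2}/dy mulr0 mul0r.
have IH' k : (k <= 2 ^ m)%N -> `|ev w (dy T m.+1 k.*2) - ev w 0| <= \sum_(j < m.+1) Num.sqrt (g j w).
  by move=> /IH; rewrite (@dy_refine R T m 1) addn1 expn1 muln2.
rewrite big_ord_recr/=; have iE := odd_double_half i.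
have i2 : (i./2 <= 2 ^ m)%N by rewrite -leq_double -!mul2n -expnS (leq_trans _ im)// mul2n -[leqRHS]iE leq_addl.
move: (odd i) (i./2) iE i2 im => b k <- k2; have := IH' k k2.
case: b => /=; last by rewrite add0n => h _; rewrite (le_trans h)// lerDl sqrtr_ge0.
rewrite add1n => h1 km.
have h2 : `|ev w (dy T m.+1 k.*2.+1) - ev w (dy T m.+1 k.*2)| <= Num.sqrt (g m.+1 w).
  exact: incr_bound.
have := ler_normD (ev w (dy T m.+1 k.*2.+1) - ev w (dy T m.+1 k.*2)) (ev w (dy T m.+1 k.*2) - ev w 0).
rewrite subrKA => h3; apply: (le_trans h3); rewrite [leLHS]addrC.
exact: lerD h1 h2.
Qed.

(** Cauchy-Schwarz with weights (3/4)^j, whose partial sums [S n] stay below 4. *)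
Lemma sum_sqr_geometric (b : nat -> R) m :
  (\sum_(j < m) b j) ^+ 2 <= 4 * \sum_(j < m) (4 / 3) ^+ j * b j ^+ 2.
Proof.
pose S n : R := 4 * (1 - (3 / 4) ^+ n).
have SS n : S n.+1 = S n + (3 / 4) ^+ n by rewrite /S exprS; field.
have q0 n : 0 < (3 / 4 : R) ^+ n by rewrite exprn_gt0.
have H n : (\sum_(j < n) b j) ^+ 2 <= S n * \sum_(j < n) (4 / 3) ^+ j * b j ^+ 2 /\
    0 <= \sum_(j < n) (4 / 3) ^+ j * b j ^+ 2 /\ (n = 0%N \/ 0 < S n).
  elim: n => [|n [IH1 [IH2 IH3]]].
    by rewrite !big_ord0 expr0n/= mulr0; split=> //; split => //; left.
  rewrite !big_ord_recr/= SS.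
  set A := \sum_(j < n) b j in IH1 *; set Y := \sum_(j < n) _ in IH1 IH2 *.
  set s := (3 / 4) ^+ n; have s0 : 0 < s := q0 n.
  have -> : (4 / 3) ^+ n = s^-1 by rewrite /s -exprVn invf_div.
  split; last split.
  - have [n0|Sn] := IH3.
      have A0 : A = 0 by rewrite /A n0 big_ord0.
      have Y0 : Y = 0 by rewrite /Y n0 big_ord0.
      have S0 : S n = 0 by rewrite /S n0 expr0 subrr mulr0.
      by rewrite A0 Y0 S0 !add0r mulrA mulfV ?gt_eqF// mul1r.
    have -> : (S n + s) * (Y + s^-1 * b n ^+ 2) =
       S n * Y + s * Y + S n * s^-1 * b n ^+ 2 + b n ^+ 2 by field; rewrite gt_eqF.
    have h1 : s * (A ^+ 2 / S n) <= s * Y by rewrite ler_pM2l// ler_pdivrMr// mulrC.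
    (* This square, expanded in [h3], absorbs the cross term 2 A b_n. *)
    have h2 : 0 <= (s * A - S n * b n) ^+ 2 / (s * S n) by rewrite divr_ge0 ?sqr_ge0// mulr_ge0// ltW.
    have h3 : (s * A - S n * b n) ^+ 2 / (s * S n) = s * (A ^+ 2 / S n) + S n * s^-1 * b n ^+ 2 - 2 * A * b n.
      by field; rewrite !gt_eqF.
    have -> : (A + b n) ^+ 2 = A ^+ 2 + 2 * A * b n + b n ^+ 2 by ring.
    lra.
  - by rewrite addr_ge0// mulr_ge0 ?sqr_ge0// invr_ge0 ltW.
  - right; have [n0|Sn] := IH3; last by rewrite addr_gt0.
    by rewrite /S n0 expr0 subrr mulr0 add0r.
have [h1 [h2 _]] := H m; apply: (le_trans h1); apply: ler_wpM2r => //.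
by rewrite /S; have := q0 m; lra.
Qed.

(** The series of (2/3)^j and of j (2/3)^j sum to 3 and 6; the induction carries the exact
    remainder. *)
Lemma sum_arith_geometric (c : R) m : 0 <= c ->
  \sum_(j < m) (2 / 3) ^+ j * (c + j%:R) <= 3 * c + 6.
Proof.
move=> c0; have -> : \sum_(j < m) (2 / 3) ^+ j * (c + j%:R) =
    (3 * c + 6) - (2 / 3) ^+ m * (3 * c + 3 * m%:R + 6).
  elim: m => [|m IH]; first by rewrite big_ord0 expr0 mulr0 addr0 mul1r subrr.
  by rewrite big_ord_recr/= IH exprS -natr1; field.
rewrite lerBlDr lerDl mulr_ge0 ?exprn_ge0// ?divr_ge0//.
by have : (0:R) <= m%:R by []; lra.
Qed.

Variables (M : probability (Omega R T d) R).
Hypothesis Hinc : forall m i c (V : set R), (i < 2 ^ m)%N -> measurable V ->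
  M (increment m i c @^-1` V) = normal_prob 0 (Num.sqrt (T / 2 ^+ m)) V.

Let lse_int j : (\int[M]_w (lse j w)%:E <= (2 ^+ j * (2 * d%:R))%:E)%E.
Proof.
rewrite /lse; under eq_integral do rewrite -sumEFin.
rewrite ge0_integral_sum//; last first.
  move=> p; apply/measurable_EFinP; apply: measurableT_comp => //.
  by apply: measurable_funM => //; apply: measurable_funX; exact: measurable_increment.
have -> : (2 ^+ j * (2 * d%:R))%:E = (\sum_(p : 'I_(2 ^ j) * 'I_d) 2%:E)%E :> \bar R.
  rewrite sumEFin sumr_const card_prod !card_ord; congr (_%:E).
  by rewrite -[RHS]mulr_natl natrM natrX; ring.
apply: lee_sum => -[i c] _ /=.
have Tj : 0 < T / 2 ^+ j by rewrite divr_gt0 ?exp2_gt0.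
have s0 : 0 < Num.sqrt (T / 2 ^+ j) by rewrite sqrtr_gt0.
apply: le_trans (gaussian_square_exp s0).
rewrite (ge0_integral_normal_law (measurable_increment j i c) (fun V => @Hinc j i c V (ltn_ord i))); last 2 first.
- by apply/measurable_EFinP; apply: measurableT_comp => //; apply: measurable_funM.
- by move=> x; rewrite lee_fin expR_ge0.
apply: ge0_le_integral => //.
- apply/measurable_EFinP; apply: measurableT_comp => //.
  by apply: measurable_funM => //; apply: measurable_funX; exact: measurable_increment.
- apply/measurable_EFinP; apply: measurableT_comp => //.
  by apply: measurable_funM => //; apply: measurable_funX; exact: measurable_increment.
move=> w _; rewrite lee_fin ler_expR sqr_sqrtr ?(ltW Tj)//.
rewrite (_ : _ / _ = a j * increment j i c w ^+ 2)// /a.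
by field; rewrite !gt_eqF ?exp2_gt0.
Qed.

(** There are 2^j d increments of level j, each with exponential moment at most 2 under [M].
    [entropy_dual_integral] with shift j bounds the mean of a_j g_j by c0 + j, so the mean of g_j by
    4 T 2^-j (c0 + j). This stays summable with the weights (4/3)^j of [sum_sqr_geometric], and
    chaining turns the sum into a bound on sup_t |w_t - w_0|^2. [K] is uniform in [Q]. *)
Lemma second_moment_bound (lam C K1 : R) : (0 < d)%N -> 0 <= lam ->
  exists K, forall Q : probability (Omega R T d) R, entropy_dual C Q M ->
    (\int[Q]_w (`|ev w 0| ^+ 2)%:E <= K1%:E)%E ->
    (\int[Q]_w (wd lam w point ^+ 2)%:E <= K%:E)%E.
Proof.
move=> d0 lam0; pose c0 : R := `|C| + 2 * d%:R; pose K0 := 4 * T * (3 * c0 + 6).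
have c00 : 0 <= c0 by rewrite addr_ge0// mulr_ge0.
exists (2 * K1 + 8 * K0) => Q QM QK1.
have g0 j w : 0 <= g j w.
  apply: le_trans (_ : increment j 0 (Ordinal d0) w ^+ 2 <= _); first exact: sqr_ge0.
  by apply: g_ge; rewrite expn_gt0.
have Qg j : (\int[Q]_w (g j w)%:E <= (4 * T / 2 ^+ j * (c0 + j%:R))%:E)%E.
  have lse_gt0 w : 0 < lse j w.
    have i0 : (0 < 2 ^ j)%N by rewrite expn_gt0.
    exact: lt_le_trans (expR_gt0 _) (lse_ge w (Ordinal i0) (Ordinal d0)).
  have E w : expR (a j * g j w) = lse j w.
    by rewrite /g mulrA mulfV ?gt_eqF// mul1r lnK ?posrE.
  have mag : measurable_fun setT (fun w => a j * g j w) by exact: measurable_funM.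
  have ag0 w : 0 <= a j * g j w by rewrite mulr_ge0// ltW.
  have := @entropy_dual_integral _ _ _ C Q M (fun w => a j * g j w) (2 ^+ j * (2 * d%:R)) j%:R QM mag ag0.
  under eq_integral do rewrite E.
  move=> /(_ (lse_int j)) H.
  have -> : (\int[Q]_w (g j w)%:E = (a j)^-1%:E * \int[Q]_w (a j * g j w)%:E)%E.
    rewrite -ge0_integral_scale//; last by rewrite invr_ge0 ltW.
    by apply: eq_integral => w _; rewrite mulrA mulVf ?gt_eqF// mul1r.
  apply: (@le_trans _ _ ((a j)^-1%:E * (C - 1 + j%:R + expR (- j%:R) * (2 ^+ j * (2 * d%:R)))%:E)%E).
    by apply: lee_wpmul2l => //; rewrite lee_fin invr_ge0 ltW.
  rewrite -EFinM lee_fin /a invf_div ler_pM2l ?divr_gt0 ?mulr_gt0// ?exp2_gt0//.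
  (* The shift j pays for the 2^j increments because e >= 2. *)
  have e2 : expR (- j%:R) * 2 ^+ j <= (1:R).
    rewrite expRN mulrC ler_pdivrMr ?expR_gt0// mul1r -[j%:R]mulr1 expRM_natl.
    by apply: lerXn2r; rewrite ?nnegrE ?expR_ge0//; have := expR_ge1Dx (1:R); lra.
  have : expR (- j%:R) * (2 ^+ j * (2 * d%:R)) <= 2 * d%:R :> R.
    by rewrite mulrA ler_piMl// mulr_ge0.
  by rewrite /c0; have := ler_norm C; lra.
pose Y m w := \sum_(j < m) (4 / 3) ^+ j * g j w.
have t0 j (w : Omega R T d) : 0 <= (4 / 3) ^+ j * g j w by rewrite mulr_ge0// exprn_ge0// divr_ge0.
have mY m : measurable_fun setT (Y m).
  by apply: measurable_sum => j; exact: measurable_funM.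
have ndY w i j : (i <= j)%N -> Y i w <= Y j w.
  move: i j; apply/nondecreasing_seqP => n.
  by rewrite /Y big_ord_recr/= lerDl t0.
have Y0 m w : 0 <= Y m w by apply: sumr_ge0 => j _; exact: t0.
have QY m : (\int[Q]_w (Y m w)%:E <= K0%:E)%E.
  rewrite /Y; under eq_integral do rewrite -sumEFin.
  rewrite ge0_integral_sum//; last 2 first.
  - by move=> j; apply/measurable_EFinP; exact: measurable_funM.
  - by move=> j w _; rewrite lee_fin.
  apply: (@le_trans _ _ (\sum_(j < m) (4 * T * ((2 / 3) ^+ j * (c0 + j%:R)))%:E)%E); last first.
    rewrite sumEFin -mulr_sumr lee_fin ler_pM2l ?mulr_gt0//.
    exact: sum_arith_geometric.
  apply: lee_sum => j _.
  have q0 : 0 <= (4 / 3 : R) ^+ j by rewrite exprn_ge0// divr_ge0.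
  rewrite (ge0_integral_scale Q (measurable_g j) (g0 j) q0).
  apply: (@le_trans _ _ (((4 / 3) ^+ j)%:E * (4 * T / 2 ^+ j * (c0 + j%:R))%:E)%E).
    by apply: lee_wpmul2l => //; rewrite lee_fin exprn_ge0// divr_ge0.
  rewrite -EFinM lee_fin le_eqVlt; apply/orP; left; apply/eqP.
  have -> : (4 / 3 : R) ^+ j = 2 ^+ j * (2 / 3) ^+ j.
    by rewrite -exprMn; congr (_ ^+ _); field.
  by field; rewrite gt_eqF ?exp2_gt0.
pose Z w := limn (fun m => (Y m w)%:E).
have cvgY w : (Y m w)%:E @[m --> \oo] --> Z w.
  by apply: ereal_nondecreasing_is_cvgn => i j ij; rewrite lee_fin ndY.
have YZ m w : ((Y m w)%:E <= Z w)%E.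
  apply: (lime_ge (cvgP _ (cvgY w))); near=> n; rewrite lee_fin ndY//.
  by near: n; exact: nbhs_infty_ge.
have Z0 w : (0 <= Z w)%E by apply: le_trans (YZ 0%N w); rewrite lee_fin.
have mZ : measurable_fun setT Z.
  by apply: (emeasurable_fun_cvg (fun m w => (Y m w)%:E)) => // m; exact/measurable_EFinP.
have QZ : (\int[Q]_w Z w <= K0%:E)%E.
  rewrite monotone_convergence//.
  - apply: lime_le; last exact: nearW.
    apply: ereal_nondecreasing_is_cvgn => i j ij; apply: ge0_le_integral => //.
    + by move=> w _; rewrite lee_fin.
    + exact/measurable_EFinP.
    + exact/measurable_EFinP.
    + by move=> w _; rewrite lee_fin ndY.
  - by move=> m; exact/measurable_EFinP.
  - by move=> m w _; rewrite lee_fin.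
  - by move=> w _ i j ij; rewrite lee_fin ndY.
have key w : ((wd lam w point ^+ 2)%:E <= (2 * `|ev w 0| ^+ 2)%:E + 8%:E * Z w)%E.
  have := Z0 w; case: (Z w) (fun m => YZ m w) => [y|_ _|//]; last first.
    by rewrite gt0_muley ?lte_fin// addey// leey.
  move=> Yy; rewrite lee_fin => y0.
  rewrite -EFinM -EFinD lee_fin.
  have cst_c : continuous (fun _ : R => ev w 0) by move=> ?; exact: cvg_cst.
  have B t : 0 <= t <= T -> `|ev w t - ev w 0| <= 2 * Num.sqrt y.
    (* Comparing [w] with the constant path at its starting point brings the bound into the form of
       [dyadic_dense]. *)
    move=> tT; have <- : ev (mkpath (T := T) (fun=> ev w 0)) t = ev w 0.
      by rewrite ev_mkpath.
    apply: (dyadic_dense T0) => // l i il; rewrite ev_mkpath//.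
    apply: (le_trans (chain_bound w d0 il)).
    have s0 : 0 <= \sum_(j < l.+1) Num.sqrt (g j w) by apply: sumr_ge0 => j _; exact: sqrtr_ge0.
    rewrite -ler_sqr ?nnegrE ?mulr_ge0 ?sqrtr_ge0//.
    apply: (le_trans (sum_sqr_geometric (fun j => Num.sqrt (g j w)) l.+1)).
    rewrite exprMn sqr_sqrtr// (_ : 2 ^+ 2 = 4); last by rewrite expr2; ring.
    rewrite ler_pM2l//; under eq_bigr do rewrite sqr_sqrtr//.
    by have := Yy l.+1; rewrite lee_fin.
  have N : wd lam w point <= `|ev w 0| + 2 * Num.sqrt y.
    apply: wd_le => // t tT.
    have -> : ev (point : Omega R T d) t = 0 by rewrite ev_point.
    rewrite subr0 -(subrK (ev w 0) (ev w t)) (le_trans (ler_normD _ _))// addrC.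
    apply: le_trans (lerD (lexx _) (B t tT)) _.
    rewrite ler_peMl// ?addr_ge0 ?mulr_ge0 ?sqrtr_ge0//.
    by rewrite -(@expR0 R) ler_expR mulr_ge0//; case/andP : tT.
  have := wd_ge0 T0 lam0 w point => wd0.
  have : wd lam w point ^+ 2 <= (`|ev w 0| + 2 * Num.sqrt y) ^+ 2.
    by rewrite ler_sqr ?nnegrE//; exact: le_trans N.
  move=> /le_trans; apply.
  have : 4 * Num.sqrt y ^+ 2 = 4 * y by rewrite sqr_sqrtr.
  have := sqr_ge0 (`|ev w 0| - 2 * Num.sqrt y).
  by nra.
have mev : measurable_fun setT (fun w : Omega R T d => `|ev w 0|).
  apply: (@wd_lip_measurable _ _ _ T0 lam lam0 _ 1) => w v; rewrite mul1r.
  apply: (le_trans (ler_dist_dist _ _)).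
  by have := @wd_ub _ _ _ T0 lam lam0 w v 0; rewrite mulr0 expR0 mul1r; apply; rewrite lexx ltW.
have mwd : measurable_fun setT (fun w : Omega R T d => wd lam w point).
  exact: measurable_wd.
apply: (@le_trans _ _ (\int[Q]_w ((2 * `|ev w 0| ^+ 2)%:E + 8%:E * Z w))%E).
  apply: ge0_le_integral => //.
  - by move=> w _; rewrite lee_fin sqr_ge0.
  - by apply/measurable_EFinP; exact: measurable_funX.
  - apply: emeasurable_funD.
      by apply/measurable_EFinP; apply: measurable_funM => //; exact: measurable_funX.
    exact: emeasurable_funM.
have mev2 : measurable_fun setT (fun w : Omega R T d => `|ev w 0| ^+ 2) by exact: measurable_funX.
have i1 : (\int[Q]_w (2 * `|ev w 0| ^+ 2)%:E <= (2 * K1)%:E)%E.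
  by rewrite ge0_integral_scale// EFinM lee_wpmul2l// lee_fin.
have i2 : (\int[Q]_w (8%:E * Z w) <= (8 * K0)%:E)%E.
  by rewrite ge0_integralZl// EFinM lee_wpmul2l// lee_fin.
rewrite EFinD; apply: le_trans (leeD i1 i2).
have m1 : measurable_fun setT (fun w : Omega R T d => (2 * `|ev w 0| ^+ 2)%:E).
  by apply/measurable_EFinP; exact: measurable_funM.
have m2 : measurable_fun setT (fun w => 8%:E * Z w)%E by exact: emeasurable_funM.
have p2 w : (0 <= 8%:E * Z w)%E by rewrite mule_ge0// lee_fin.
by rewrite ge0_integralD.
Unshelve. all: by end_near. Qed.

End Chaining.

(** * Integration in time *)

Section TimeIntegral.
Context {R : realType} {T : R}.
Hypothesis T0 : 0 < T.
Implicit Types (h g : R -> R).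
Notation mu := (@lebesgue_measure R).

(** Clamping the upper end makes the primitive a continuous function on the whole line, fit for
    [mkpath]. *)
Definition tint h (t : R) : R := \int[mu]_(s in `[0, clamp T t]) h s.

Lemma itv_integrable h t : continuous h -> mu.-integrable `[0, t] (EFin \o h).
Proof.
move=> ch; apply: continuous_compact_integrable; first exact: segment_compact.
exact: continuous_subspaceT.
Qed.

Lemma tint_continuous h : continuous h -> continuous (tint h).
Proof.
move=> ch; have := parameterized_integral_continuous (ltW T0) (itv_integrable T ch).
move=> /subspace_sigL_continuousP cI.
rewrite (_ : tint h = sigL `[0, T]%classic (fun x => \int[mu]_(s in `[0, x]) h s) \o to_itv T0).
  by move=> t; apply: continuous_comp; [exact: to_itv_continuous|exact: cI].
exact/funext.
Qed.

Lemma tint_le h g t : continuous h -> continuous g ->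
  (forall s, 0 <= s <= clamp T t -> `|h s| <= g s) -> `|tint h t| <= tint g t.
Proof.
move=> ch cg hg; rewrite /tint.
have hi := itv_integrable (clamp T t) ch; have gi := itv_integrable (clamp T t) cg.
apply: (le_trans (le_normr_Rintegral _ hi)) => //.
have ni := integrable_norm hi.
by apply: le_Rintegral => // s /=; rewrite in_itv/=; exact: hg.
Qed.

Lemma tintB h g t : continuous h -> continuous g ->
  tint h t - tint g t = tint (fun s => h s - g s) t.
Proof.
by move=> ch cg; rewrite /tint RintegralB//; exact: itv_integrable.
Qed.

Lemma tintZ (c : R) h t : continuous h -> tint (fun s => c * h s) t = c * tint h t.
Proof. by move=> ch; rewrite /tint RintegralZl//; exact: itv_integrable. Qed.

Lemma tintD h g t : continuous h -> continuous g ->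
  tint (fun s => h s + g s) t = tint h t + tint g t.
Proof.
by move=> ch cg; rewrite /tint RintegralD//; exact: itv_integrable.
Qed.

Lemma tint_cst (c t : R) : tint (fun=> c) t = c * clamp T t.
Proof.
rewrite /tint Rintegral_cst//= lebesgue_measure_itv/= lte_fin.
have /andP[c0 _] := clamp_itv T0 t.
case: ltP => [_|c0']; first by rewrite sube0.
have -> : clamp T t = 0 by apply/eqP; rewrite eq_le c0'.
by rewrite /= !mulr0.
Qed.

Lemma expR_lin_continuous (lam : R) : continuous (fun s => expR (lam * s)).
Proof.
move=> s; apply: (@continuous_comp _ _ _ (fun s => lam * s) expR).
  exact: mulrl_continuous.
exact: continuous_expR.
Qed.

(** The gain 1/lam from integrating the weight is the source of every contraction below. *)
Lemma tint_expR (lam t : R) : 0 < lam -> tint (fun s => expR (lam * s)) t <= expR (lam * clamp T t) / lam.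
Proof.
move=> l0; rewrite /tint; set u := clamp T t.
have /andP[u0 _] := clamp_itv T0 t; rewrite -/u in u0.
have [u0'|u0'] := eqVneq u 0.
  by rewrite u0' set_itv1 Rintegral_set1 divr_ge0 ?expR_ge0// ltW.
have up : 0 < u by rewrite lt_neqAle eq_sym u0'.
have dF (x : R) : is_derive x 1 (fun s => expR (lam * s) / lam) (expR (lam * x)).
  have -> : (fun s => expR (lam * s) / lam) = lam^-1 *: (expR \o ( *%R lam)).
    by apply/funext => s /=; rewrite mulrC.
  apply: is_derive_eq.
  by rewrite /=/GRing.scale/= mulr1 mulrCA mulVf ?mulr1// gt_eqF.
rewrite /Rintegral (@continuous_FTC2 _ _ (fun s => expR (lam * s) / lam) 0 u up).
- by rewrite -EFinB /= gerBl divr_ge0 ?expR_ge0// ltW.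
- by apply: continuous_subspaceT; exact: expR_lin_continuous.
- have cF : continuous (fun s => expR (lam * s) / lam).
    by move=> x; apply: cvgMl; exact: expR_lin_continuous.
  split; first by move=> x _; case: (dF x).
    by apply: cvg_at_right_filter; exact: cF.
  by apply: cvg_at_left_filter; exact: cF.
- by move=> x _; rewrite derive1E; exact: derive_val.
Qed.

Lemma clamp_continuous : continuous (@clamp R T).
Proof.
move=> t; apply/cvgrPdist_lt => e e0; near=> s.
apply: le_lt_trans (clamp_lip t s) _.
near: s; have := @nbhsx_ballx _ R t e e0.
by apply: filterS => s; rewrite /ball/=.
Unshelve. all: by end_near. Qed.

End TimeIntegral.

(** * Completeness of path space *)

Section PathComplete.
Context {R : realType} {T : R} {d : nat}.
Hypothesis T0 : 0 < T.
Implicit Types (w v : Omega R T d).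

(** Successive distances telescope to 2c / 2^k. The explicit rate is kept because it is later
    integrated over paths. *)
Lemma path_complete (lam c : R) (p : nat -> Omega R T d) : 0 <= lam -> 0 <= c ->
  (forall k, wd lam (p k.+1) (p k) <= c / 2 ^+ k) ->
  exists z, forall k, wd lam (p k) z <= 2 * c / 2 ^+ k.
Proof.
move=> lam0 c0 pc.
have p2 k : 0 < (2 ^+ k : R) by exact: exp2_gt0.
have pq k m : wd lam (p (k + m)%N) (p k) <= 2 * c / 2 ^+ k - 2 * c / 2 ^+ (k + m).
  elim: m => [|m IH]; first by rewrite addn0 wdxx// subrr.
  rewrite addnS (le_trans (wd_triangle T0 lam0 _ (p (k + m)%N) _))//.
  have := pc (k + m)%N.
  have -> : 2 * c / 2 ^+ (k + m).+1 = 2 * c / 2 ^+ (k + m) - c / 2 ^+ (k + m).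
    by rewrite exprS; field; rewrite gt_eqF.
  by lra.
have pq' k m : wd lam (p (k + m)%N) (p k) <= 2 * c / 2 ^+ k.
  by rewrite (le_trans (pq k m))// gerBl divr_ge0// ?mulr_ge0// ltW.
have lim0 : 2 * c / 2 ^+ k @[k --> \oo] --> (0 : R).
  rewrite -(mulr0 (2 * c)); apply: cvgMr.
  under eq_fun do rewrite -exprVn.
  by apply: cvg_expr; rewrite ger0_norm ?invr_ge0// invf_lt1// ltr1n.
pose eT := expR (lam * T); have eT0 : 0 < eT by exact: expR_gt0.
have evb w v t : `|ev w t - ev v t| <= eT * wd lam w v.
  rewrite -(ev_clamp T0 w) -(ev_clamp T0 v).
  have ct := clamp_itv T0 t; apply: (le_trans (wd_ub T0 lam0 w v ct)).
  rewrite ler_wpM2r ?wd_ge0// ler_expR ler_wpM2l//; by case/andP : ct.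
have lime : eT * (2 * c / 2 ^+ k) @[k --> \oo] --> (0 : R).
  by rewrite -(mulr0 eT); apply: cvgMr.
have cvgp t : cvgn (fun k => ev (p k) t).
  apply/cauchy_cvgP/cauchy_exP => e e0.
  have e2 : 0 < e / 2 by rewrite divr_gt0.
  have [K _ KP] : \forall k \near \oo, eT * (2 * c / 2 ^+ k) < e.
    have := lime => /cvgrPdist_lt/(_ _ e0); apply: filterS => k.
    by rewrite sub0r normrN; apply: le_lt_trans; exact: ler_norm.
  exists (ev (p K) t); exists K => // n /= Kn.
  rewrite -ball_normE /ball_/= distrC -(subnKC Kn).
  apply: le_lt_trans (KP K (leqnn K)); apply: (le_trans (evb _ _ _)).
  by rewrite ler_pM2l.
pose f t := lim (ev (p k) t @[k --> \oo]).
have fb k t : `|ev (p k) t - f t| <= eT * (2 * c / 2 ^+ k).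
  have : `|ev (p k) t - ev (p n) t| @[n --> \oo] --> `|ev (p k) t - f t|.
    by apply: cvg_norm; apply: cvgB; [exact: cvg_cst|exact: cvgp].
  move=> /cvgr_to_le; apply; near=> n.
  have kn : (k <= n)%N by near: n; exact: nbhs_infty_ge.
  rewrite -(subnKC kn) distrC; apply: (le_trans (evb _ _ _)).
  by rewrite ler_pM2l.
have cf : continuous f.
  move=> t; apply/cvgrPdist_le => e e0.
  have e3 : 0 < e / 3 by rewrite divr_gt0.
  have [K _ KP] : \forall k \near \oo, eT * (2 * c / 2 ^+ k) < e / 3.
    have := lime => /cvgrPdist_lt/(_ _ e3); apply: filterS => k.
    by rewrite sub0r normrN; apply: le_lt_trans; exact: ler_norm.
  have := KP K (leqnn K) => {}KP.
  have /cvgrPdist_le/(_ _ e3) := @ev_continuous R T d T0 (p K) t.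
  apply: filterS => s h.
  have h1 := fb K t; have h2 := fb K s.
  have -> : f t - f s = (f t - ev (p K) t) + ((ev (p K) t - ev (p K) s) + (ev (p K) s - f s)).
    by rewrite !addrA subrK subrK.
  rewrite distrC in h1.
  have := ler_normD (f t - ev (p K) t) ((ev (p K) t - ev (p K) s) + (ev (p K) s - f s)).
  have := ler_normD (ev (p K) t - ev (p K) s) (ev (p K) s - f s).
  by lra.
have evf t : 0 <= t <= T -> ev (mkpath (T := T) f) t = f t.
  by move=> tT; rewrite ev_mkpath// clamp_id.
exists (mkpath f) => k; apply: wd_le => // t tT; rewrite evf//.
have : `|ev (p k) t - ev (p n) t| @[n --> \oo] --> `|ev (p k) t - f t|.
  by apply: cvg_norm; apply: cvgB; [exact: cvg_cst|exact: cvgp].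
move=> /cvgr_to_le; apply; near=> n.
have kn : (k <= n)%N by near: n; exact: nbhs_infty_ge.
rewrite -(subnKC kn) distrC; apply: (le_trans (wd_ub T0 lam0 _ _ tT)).
by rewrite ler_pM2l ?expR_gt0.
Unshelve. all: by end_near. Qed.

End PathComplete.

(** Reduces continuity to sequences, for which dominated convergence is available. *)
Lemma seq_continuous_at {R : realType} (f : R -> R) (t : R) :
  (forall u : nat -> R, u n @[n --> \oo] --> t -> f (u n) @[n --> \oo] --> f t) ->
  f x @[x --> t] --> f t.
Proof.
move=> H; apply/cvgrPdist_lt => e e0; apply: contrapT => nH.
have /choice[u uP] : forall n : nat, exists s, `|t - s| < n.+1%:R^-1 /\ e <= `|f t - f s|.
  move=> n; apply: contrapT => nE; apply: nH.
  have n0 : 0 < (n.+1%:R^-1 : R) by rewrite invr_gt0.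
  apply: filterS (nbhsx_ballx t _ n0) => s ts; rewrite ltNge; apply/negP => es.
  by apply: nE; exists s.
have ut : u n @[n --> \oo] --> t.
  apply/cvgrPdist_lt => a a0.
  apply: filterS (near_infty_natSinv_lt (PosNum a0)) => n /=.
  by apply: lt_trans; have [] := uP n.
have /cvgrPdist_lt/(_ _ e0)[n _ /(_ n (leqnn n))] := H u ut.
by rewrite ltNge (uP n).2.
Qed.

(** * The mean-field drift and its flow *)

Section Drift.
Context {R : realType} {T : R} {d : nat}.
Hypothesis T0 : 0 < T.
Variables (G : 'I_d -> 'rV[R]_d -> R) (L : R).
Hypothesis L0 : 0 < L.
Hypothesis GL : forall i x y, `|G i x - G i y| <= L * `|x - y|.
Implicit Types (w v y : Omega R T d) (Q : probability (Omega R T d) R)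
  (F : Omega R T d -> Omega R T d).

Variable lam : R.
Hypothesis lamE : lam = 8 * L.
Notation eT := (expR (lam * T)).

Let lam0 : 0 < lam. Proof. by rewrite lamE mulr_gt0. Qed.
Let lam_ge0 : 0 <= lam. Proof. exact: ltW lam0. Qed.

(** All transformations of paths used here are of this kind: the Lipschitz bound alone gives
    measurability and preserves first moments. *)
Definition lipmap (K : R) F := 0 <= K /\ forall w v, wd lam (F w) (F v) <= K * wd lam w v.

Definition first_moment Q := Q.-integrable setT (EFin \o (fun e => wd lam e point)).

Lemma ev_wd w v t : `|ev w t - ev v t| <= eT * wd lam w v.
Proof.
rewrite -(ev_clamp T0 w) -(ev_clamp T0 v).
have ct := clamp_itv T0 t; apply: (le_trans (wd_ub T0 lam_ge0 w v ct)).
rewrite ler_wpM2r ?wd_ge0// ler_expR ler_wpM2l//; by case/andP : ct.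
Qed.

Lemma ev_wd0 w t : `|ev w t| <= eT * wd lam w point.
Proof. by have := ev_wd w point t; rewrite ev_point subr0. Qed.

Lemma lipmap_id : lipmap 1 id.
Proof. by split => // w v; rewrite mul1r. Qed.

Lemma lipmap_bound K F w : lipmap K F ->
  wd lam (F w) point <= wd lam (F point) point + K * wd lam w point.
Proof.
move=> [K0 FK]; apply: (le_trans (wd_triangle T0 lam_ge0 _ (F point) _)).
by rewrite addrC lerD2l.
Qed.

Lemma lipmap_measurable K F : lipmap K F -> measurable_fun setT F.
Proof.
move=> [K0 FK]; apply: (measurable_path T0) => t c tT.
apply: (@wd_lip_measurable _ _ _ T0 _ lam_ge0 _ (eT * K)) => w v.
have := rV_coord_le (ev (F w) t - ev (F v) t) c; rewrite !mxE => /le_trans; apply.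
apply: (le_trans (ev_wd _ _ _)); rewrite -[leRHS]mulrA ler_pM2l ?expR_gt0//.
Qed.

Lemma wd2_lip K F K' F' w v : lipmap K F -> lipmap K' F' ->
  `|wd lam (F w) (F' w) - wd lam (F v) (F' v)| <= (K + K') * wd lam w v.
Proof.
move=> [_ FK] [_ FK'].
have h1 := FK w v; have h2 := FK' w v.
have h3 := wd_triangle T0 lam_ge0 (F w) (F v) (F' w).
have h4 := wd_triangle T0 lam_ge0 (F v) (F' v) (F' w).
have h5 := wd_triangle T0 lam_ge0 (F v) (F w) (F' v).
have h6 := wd_triangle T0 lam_ge0 (F w) (F' w) (F' v).
rewrite (wd_sym T0 lam_ge0 (F v) (F w)) in h5.
rewrite (wd_sym T0 lam_ge0 (F' v) (F' w)) in h4.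
move: h1 h2 h3 h4 h5 h6; rewrite (mulrDl K K').
move: (K * wd lam w v) (K' * wd lam w v) (wd lam (F w) (F v)) (wd lam (F' w) (F' v)) => a b c1 c2.
move: (wd lam (F w) (F' w)) (wd lam (F v) (F' v)) (wd lam (F v) (F' w)) (wd lam (F w) (F' v)) => c3 c4 c5 c6.
move=> h1 h2 h3 h4 h5 h6; have e := lerD h1 h2.
have e1 := le_trans h3 (lerD (lexx c1) h4); have e2 := le_trans h5 (lerD (lexx c1) h6).
move: e e1 e2 {h1 h2 h3 h4 h5 h6} => e e1 e2; rewrite ler_norml; apply/andP; split; lra.
Qed.

Lemma lip_integrable Q (f : Omega R T d -> R) K : first_moment Q ->
  (forall w v, `|f w - f v| <= K * wd lam w v) ->
  measurable_fun setT f /\ Q.-integrable setT (EFin \o f).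
Proof.
move=> fmQ fK; have mf := wd_lip_measurable T0 lam_ge0 fK; split => //.
have gi : Q.-integrable setT (EFin \o (fun e => `|f point| + K * wd lam e point)).
  exact: (integrableD measurableT (cst_integrable Q _) (integrableZl measurableT _ fmQ)).
apply: (dominated_integrable measurableT mf _ gi) => e _.
have := fK e point; have := ler_normD (f e - f point) (f point); rewrite subrK; lra.
Qed.

Lemma wd2_integrable Q K F K' F' : first_moment Q -> lipmap K F -> lipmap K' F' ->
  Q.-integrable setT (EFin \o (fun e => wd lam (F e) (F' e))).
Proof.
move=> fmQ FK FK'; have [_] := @lip_integrable Q (fun e => wd lam (F e) (F' e)) (K + K') fmQ
  (fun w v => wd2_lip w v FK FK'); exact.
Qed.

Fact drift_key : unit. Proof. exact: tt. Qed.
(** Component i of grad W convolved with the law of [F] under [Q] at time s, evaluated at w_s.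
    Keeping [Q] and [F] apart lets the unknown law of a mean-field solution vary as the image of a
    fixed [Q]; the interaction of the problem is the case [F = id]. *)
Definition drift : probability (Omega R T d) R -> (Omega R T d -> Omega R T d) ->
    Omega R T d -> 'I_d -> R -> R :=
  locked_with drift_key (fun Q F w i s => \int[Q]_e G i (ev w s - ev (F e) s)).

Lemma driftE Q F w i : drift Q F w i = (fun s => \int[Q]_e G i (ev w s - ev (F e) s)).
Proof. by rewrite [drift]unlock. Qed.

Let g0 : R := \sum_i `|G i 0|.

Lemma G_bound i x : `|G i x| <= g0 + L * `|x|.
Proof.
have h1 := GL i x 0; rewrite subr0 in h1.
have h2 : `|G i 0| <= g0 by rewrite /g0 (bigD1 i)//= lerDl sumr_ge0.
have := ler_normD (G i x - G i 0) (G i 0); rewrite subrK; lra.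
Qed.

(** A majorant of the integrand of [drift], uniform in time, from the linear growth of [G]. *)
Definition drift_dom K F (c : R) (e : Omega R T d) : R :=
  g0 + L * (c + eT * (wd lam (F point) point + K * wd lam e point)).

Lemma drift_dom_ge K F x s e c i : lipmap K F -> `|x| <= c ->
  `|G i (x - ev (F e) s)| <= drift_dom K F c e.
Proof.
move=> FK xc; apply: (le_trans (G_bound _ _)); rewrite lerD2l ler_pM2l//.
apply: (le_trans (ler_normB _ _)); apply: lerD => //.
by rewrite (le_trans (ev_wd0 _ _))// ler_pM2l ?expR_gt0// lipmap_bound.
Qed.

Lemma drift_dom_integrable Q K F c : first_moment Q ->
  Q.-integrable setT (EFin \o drift_dom K F c).
Proof.
move=> fmQ; suff H w v : `|drift_dom K F c w - drift_dom K F c v| <= L * (eT * `|K|) * wd lam w v.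
  by have [] := lip_integrable fmQ H.
rewrite /drift_dom.
have -> : g0 + L * (c + eT * (wd lam (F point) point + K * wd lam w point)) -
  (g0 + L * (c + eT * (wd lam (F point) point + K * wd lam v point))) =
  L * (eT * K) * (wd lam w point - wd lam v point) by ring.
rewrite !normrM (ger0_norm (ltW L0)) (ger0_norm (expR_ge0 _)).
rewrite ler_wpM2l ?mulr_ge0 ?expR_ge0 ?(ltW L0)//.
have := wd2_lip w v lipmap_id (_ : lipmap 0 (fun=> point)); rewrite addr0 mul1r; apply.
by split => // ? ?; rewrite mul0r wdxx.
Qed.

Lemma G_measurable K F i x s : lipmap K F ->
  measurable_fun setT (fun e => G i (x - ev (F e) s)).
Proof.
move=> [K0 FK]; apply: (@wd_lip_measurable _ _ _ T0 _ lam_ge0 _ (L * (eT * K))) => w v.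
apply: (le_trans (GL _ _ _)).
rewrite (_ : x - ev (F w) s - (x - ev (F v) s) = ev (F v) s - ev (F w) s); last first.
  by rewrite opprB addrC subrKA.
rewrite -[leRHS]mulrA ler_pM2l// distrC (le_trans (ev_wd _ _ _))// -[leRHS]mulrA.
by rewrite ler_pM2l ?expR_gt0.
Qed.

Lemma G_integrable Q K F i x s : first_moment Q -> lipmap K F ->
  Q.-integrable setT (EFin \o (fun e => G i (x - ev (F e) s))).
Proof.
move=> fmQ FK.
apply: (dominated_integrable measurableT (G_measurable i x s FK) _ (drift_dom_integrable K F `|x| fmQ)).
by move=> e _; exact: drift_dom_ge.
Qed.

Lemma drift_bound Q K F w i s : first_moment Q -> lipmap K F ->
  `|drift Q F w i s| <= \int[Q]_e drift_dom K F (eT * wd lam w point) e.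
Proof.
move=> fmQ FK; rewrite driftE; apply: normr_RintegralT.
- exact: (G_measurable _ _ _ FK).
- exact: drift_dom_integrable.
- by move=> e; apply: drift_dom_ge => //; exact: ev_wd0.
Qed.

Lemma drift_continuous Q K F w i : first_moment Q -> lipmap K F -> continuous (drift Q F w i).
Proof.
move=> fmQ FK; rewrite driftE => t; apply: seq_continuous_at => u ut.
apply: (dominated_cvg_Rintegral (g := drift_dom K F (eT * wd lam w point))) => //.
- by move=> n; exact: (G_measurable _ _ _ FK).
- move=> e _; have cx : continuous (fun s => ev w s - ev (F e) s).
    by move=> s; apply: cvgB; exact: ev_continuous.
  have cu : (ev w (u n) - ev (F e) (u n)) @[n --> \oo] --> ev w t - ev (F e) t.
    exact: (continuous_cvg _ (cx t) ut).
  apply/cvgrPdist_le => a a0; have aL : 0 < a / L by rewrite divr_gt0.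
  move/cvgrPdist_le : cu => /(_ _ aL); apply: filterS => n.
  by rewrite ler_pdivlMr// mulrC; apply: le_trans.
- exact: drift_dom_integrable.
- by move=> n e _; apply: drift_dom_ge => //; exact: ev_wd0.
Qed.

(** [G] is Lipschitz, and the weight in [wd] returns the factor exp(lam s). *)
Lemma drift_compare Q K F K' F' w w' i s : first_moment Q -> lipmap K F -> lipmap K' F' ->
  0 <= s <= T -> `|drift Q F w i s - drift Q F' w' i s| <=
  L * (wd lam w w' + \int[Q]_e wd lam (F e) (F' e)) * expR (lam * s).
Proof.
move=> fmQ FK FK' sT; rewrite !driftE -RintegralB//; [|exact: (G_integrable _ _ _ fmQ FK)|exact: (G_integrable _ _ _ fmQ FK')].
have i1 := wd2_integrable fmQ FK FK'.
have ii : Q.-integrable setT (EFin \o (fun e => L * expR (lam * s) * (wd lam w w' + wd lam (F e) (F' e)))).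
  exact: (integrableZl measurableT _ (integrableD measurableT (cst_integrable Q _) i1)).
have -> : L * (wd lam w w' + \int[Q]_e wd lam (F e) (F' e)) * expR (lam * s) =
    \int[Q]_e (L * expR (lam * s) * (wd lam w w' + wd lam (F e) (F' e))).
  rewrite (RintegralZl _ measurableT (integrableD measurableT (cst_integrable Q (wd lam w w')) i1)).
  rewrite (RintegralD measurableT (cst_integrable Q (wd lam w w')) i1) Rintegral_cstT.
  by rewrite mulrAC.
apply: normr_RintegralT => //.
  by apply: measurable_funB; [exact: (G_measurable _ _ _ FK)|exact: (G_measurable _ _ _ FK')].
move=> e; apply: (le_trans (GL _ _ _)); rewrite -mulrA ler_pM2l// mulrDr.
have := wd_ub T0 lam_ge0 w w' sT; have := wd_ub T0 lam_ge0 (F e) (F' e) sT.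
have := ler_normB (ev w s - ev w' s) (ev (F e) s - ev (F' e) s).
have -> : ev w s - ev w' s - (ev (F e) s - ev (F' e) s) = ev w s - ev (F e) s - (ev w' s - ev (F' e) s).
  by rewrite !opprB addrACA [RHS]addrACA (addrC (- ev w' s)).
lra.
Qed.

Lemma row_continuous (f : 'I_d -> R -> R) : (forall i, continuous (f i)) ->
  continuous (fun t => \row_i f i t : 'rV[R]_d).
Proof.
move=> cf t; apply/cvgrPdist_le => e e0.
have H i : \forall s \near t, `|f i t - f i s| <= e.
  by move/cvgrPdist_le : (cf i t) => /(_ _ e0).
apply: filterS (filter_forall _ H) => s Hs.
by apply: (rV_norm_le (ltW e0)) => i; rewrite !mxE.
Qed.

(* The path t |-> y_t + c int_0^t drift(s, w_s) ds *)
Fact flow_key : unit. Proof. exact: tt. Qed.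
Definition flow : R -> probability (Omega R T d) R -> (Omega R T d -> Omega R T d) ->
    Omega R T d -> Omega R T d -> Omega R T d :=
  locked_with flow_key (fun c Q F w y =>
    mkpath (fun t => ev y t + c *: \row_i tint (T := T) (drift Q F w i) t)).

Lemma ev_flow c Q K F w y t : first_moment Q -> lipmap K F -> 0 <= t <= T ->
  ev (flow c Q F w y) t = ev y t + c *: \row_i tint (T := T) (drift Q F w i) t.
Proof.
move=> fmQ FK tT; rewrite [flow]unlock ev_mkpath ?clamp_id// => s.
apply: cvgD; first exact: ev_continuous.
apply: cvgZr; apply: row_continuous => i; apply: (tint_continuous T0).
exact: drift_continuous FK.
Qed.

(** The integral of L D exp(lam s) up to t is at most (L / lam) D exp(lam t), and L / lam = 1/8. *)
Lemma tint_row_le (h h' : 'I_d -> R -> R) t D : (forall i, continuous (h i)) -> (forall i, continuous (h' i)) ->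
  0 <= D -> 0 <= t <= T ->
  (forall i s, 0 <= s <= T -> `|h i s - h' i s| <= L * D * expR (lam * s)) ->
  `|(\row_i tint (T := T) (h i) t : 'rV[R]_d) - \row_i tint (T := T) (h' i) t| <= D / 8 * expR (lam * t).
Proof.
move=> ch ch' D0 tT hh; apply: rV_norm_le; first by rewrite mulr_ge0 ?divr_ge0 ?expR_ge0.
move=> i; rewrite !mxE tintB//.
apply: le_trans (@tint_le _ T _ (fun s => L * D * expR (lam * s)) _ _ _ _) _.
- by move=> s; apply: cvgB; [exact: ch|exact: ch'].
- by move=> s; apply: cvgMr; exact: expR_lin_continuous.
- move=> s /andP[s0 sT]; apply: hh; rewrite s0 (le_trans sT)//.
  by have /andP[] := clamp_itv T0 t.
rewrite tintZ; last exact: expR_lin_continuous.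
apply: (@le_trans _ _ (L * D * (expR (lam * t) / lam))).
  rewrite ler_wpM2l ?mulr_ge0 ?(ltW L0)//.
  by have := tint_expR T0 t lam0; rewrite clamp_id.
by rewrite le_eqVlt; apply/orP; left; apply/eqP; rewrite lamE; field; rewrite gt_eqF.
Qed.

(** The contraction estimate: factor 1/8 both in the path and in the law, the latter through the
    coupling of [F] and [F'] under the same [Q]. *)
Lemma flow_lip c Q K F K' F' w w' y y' : first_moment Q -> lipmap K F -> lipmap K' F' ->
  wd lam (flow c Q F w y) (flow c Q F' w' y') <=
  wd lam y y' + `|c| * ((wd lam w w' + \int[Q]_e wd lam (F e) (F' e)) / 8).
Proof.
move=> fmQ FK FK'; apply: wd_le => // t tT.
rewrite (ev_flow c w y fmQ FK tT) (ev_flow c w' y' fmQ FK' tT).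
have E (a b u v : 'rV[R]_d) : a + c *: u - (b + c *: v) = (a - b) + c *: (u - v).
  by rewrite scalerBr opprD addrACA.
rewrite E.
apply: (le_trans (ler_normD _ _)); rewrite mulrDr; apply: lerD; first exact: wd_ub.
rewrite normrZ mulrCA ler_wpM2l// mulrC.
have D0 : 0 <= wd lam w w' + \int[Q]_e wd lam (F e) (F' e).
  by rewrite addr_ge0 ?wd_ge0// Rintegral_ge0// => e _; exact: wd_ge0.
apply: tint_row_le => //.
- by move=> i; exact: drift_continuous FK.
- by move=> i; exact: drift_continuous FK'.
- by move=> i s sT; exact: (drift_compare _ _ _ fmQ FK FK' sT).
Qed.

Lemma flow_unique Q K F y w w' : first_moment Q -> lipmap K F ->
  w = flow (-1) Q F w y -> w' = flow (-1) Q F w' y -> w = w'.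
Proof.
move=> fmQ FK ew ew'; apply: (wd_eq0 T0 lam_ge0).
have := flow_lip (-1) w w' y y fmQ FK FK; rewrite -ew -ew' wdxx//.
rewrite normrN normr1 mul1r add0r.
have -> : \int[Q]_e wd lam (F e) (F e) = 0.
  by under eq_Rintegral do rewrite wdxx//; rewrite Rintegral_cstT.
have := wd_ge0 T0 lam_ge0 w w' => w0 h; apply/eqP; rewrite eq_le w0 andbT; lra.
Qed.

(** [flow 1 Q F w w] is the noise of [w]: the driving path for which [w] solves the equation. *)
Lemma flow_cancel Q K F w : first_moment Q -> lipmap K F ->
  w = flow (-1) Q F w (flow 1 Q F w w).
Proof.
move=> fmQ FK; apply: path_ext => // t tT.
by rewrite !(ev_flow _ _ _ fmQ FK tT) scale1r scaleN1r addrK.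
Qed.

Lemma Rintegral_wdxx Q F : \int[Q]_e wd lam (F e) (F e) = 0.
Proof. by under eq_Rintegral do rewrite wdxx//; rewrite Rintegral_cstT. Qed.

Lemma le_geometric (a b c : R) : (forall k : nat, a <= b + c / 2 ^+ k) -> a <= b.
Proof.
move=> H; have lim0 : b + c / 2 ^+ k @[k --> \oo] --> b.
  rewrite -[X in _ --> X]addr0; apply: cvgD; first exact: cvg_cst.
  rewrite -(mulr0 c); apply: cvgMr.
  under eq_fun do rewrite -exprVn.
  by apply: cvg_expr; rewrite ger0_norm ?invr_ge0// invf_lt1// ltr1n.
by apply: (cvgr_to_ge lim0); exact: nearW.
Qed.

(** The Lipschitz constant is at most 1 + 2/8, so the bound 2 reproduces itself along Picard
    iterates. *)
Lemma flow_lipmap (c : R) Q K F K' F' : `|c| = 1 -> first_moment Q -> lipmap K F ->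
  0 <= K' <= 2 -> lipmap K' F' -> lipmap 2 (fun y => flow c Q F (F' y) y).
Proof.
move=> c1 fmQ FK /andP[K'0 K'2] [_ FK']; split => // y y'.
apply: (le_trans (flow_lip c _ _ _ _ fmQ FK FK)); rewrite Rintegral_wdxx addr0 c1 mul1r.
have h1 := FK' y y'; have h2 := wd_ge0 T0 lam_ge0 y y'.
have : K' * wd lam y y' <= 2 * wd lam y y' by rewrite ler_wpM2r.
move: h1 h2; move: (wd lam (F' y) (F' y')) (wd lam y y') => a b; lra.
Qed.

Lemma picard_step (a b x z p : R) : 0 < p -> 0 <= a -> 0 <= b -> x <= (a + b) / p ->
  z <= 2 * b / p -> (x + z) / 8 <= (a + b) / (2 * p).
Proof.
move=> p0 a0 b0; rewrite !ler_pdivlMr ?mulr_gt0// => h1 h2.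
have -> : (x + z) / 8 * (2 * p) = (x * p + z * p) / 4 by field.
lra.
Qed.

(** Picard iteration on maps of the driving path, the law being the image of [Q] under the current
    iterate. With d0(y) the first displacement and D0 its mean, the k-th step at y is at most (d0(y)
    + D0) / 2^k. Convergence therefore holds at every path y, and the limit is again Lipschitz. *)
Lemma mean_field_solution Q : first_moment Q ->
  exists Z, lipmap 2 Z /\ forall y, Z y = flow (-1) Q Z (Z y) y.
Proof.
move=> fmQ; pose Zs k := iter k (fun F y => flow (-1) Q F (F y) y) id.
have ZsS k y : Zs k.+1 y = flow (-1) Q (Zs k) (Zs k y) y by [].
have n1 : `|-1| = 1 :> R by rewrite normrN normr1.
have Zlip k : lipmap 2 (Zs k).
  elim: k => [|k IH].
    by split => // w v; rewrite ler_peMl ?wd_ge0// ler1n.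
  by apply: (flow_lipmap n1 fmQ IH _ IH); rewrite ler0n lexx.
have zi k := wd2_integrable fmQ (Zlip k.+1) (Zlip k).
pose d0 y := wd lam (Zs 1%N y) y; pose D0 := \int[Q]_e d0 e.
have d0i : Q.-integrable setT (EFin \o d0) := zi 0%N.
have d00 y : 0 <= d0 y by exact: wd_ge0.
have D00 : 0 <= D0 by apply: Rintegral_ge0 => e _; exact: d00.
have step k y : wd lam (Zs k.+1 y) (Zs k y) <= (d0 y + D0) / 2 ^+ k.
  elim: k y => [|k IH] y; first by rewrite expr0 divr1 lerDl.
  have p2 : 0 < (2 ^+ k : R) by exact: exp2_gt0.
  rewrite [in leLHS]ZsS [X in wd _ _ X]ZsS.
  apply: (le_trans (flow_lip (-1) _ _ _ _ fmQ (Zlip k.+1) (Zlip k))).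
  rewrite wdxx// add0r n1 mul1r.
  have I : \int[Q]_e wd lam (Zs k.+1 e) (Zs k e) <= 2 * D0 / 2 ^+ k.
    have di := integrableD measurableT d0i (cst_integrable Q D0).
    have -> : 2 * D0 / 2 ^+ k = \int[Q]_e ((2 ^+ k)^-1 * (d0 e + D0)).
      rewrite (RintegralZl _ measurableT di) (RintegralD measurableT d0i (cst_integrable Q D0)).
      by rewrite Rintegral_cstT -/D0 mulrC mulr_natl mulr2n.
    apply: le_RintegralT.
    - exact: zi.
    - exact: (integrableZl measurableT _ di).
    - by move=> e; rewrite mulrC; exact: IH.
  by rewrite exprS; apply: picard_step p2 (d00 y) D00 (IH y) I.
have /choice[Z ZP] : forall y, exists z, forall k, wd lam (Zs k y) z <= 2 * (d0 y + D0) / 2 ^+ k.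
  by move=> y; apply: (path_complete T0 lam_ge0 (addr_ge0 (d00 y) D00)) => k; exact: step.
have Zl : lipmap 2 Z.
  split => // y y'; apply: (@le_geometric _ _ (2 * (d0 y + D0) + 2 * (d0 y' + D0))) => k.
  have h1 := ZP y k; have h2 := ZP y' k; have h3 := (Zlip k).2 y y'.
  have h4 := wd_triangle T0 lam_ge0 (Z y) (Zs k y) (Z y').
  have h5 := wd_triangle T0 lam_ge0 (Zs k y) (Zs k y') (Z y').
  rewrite (wd_sym T0 lam_ge0 (Z y) (Zs k y)) in h4.
  rewrite [X in _ + X]mulrDl.
  by apply: (le_trans h4); rewrite (le_trans (lerD h1 h5))// addrCA lerD// lerD2l.
exists Z; split => // y; apply: (wd_eq0 T0 lam_ge0); apply/eqP; rewrite eq_le wd_ge0// andbT.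
pose E0 := \int[Q]_e (2 * (d0 e + D0)).
have di := integrableD measurableT d0i (cst_integrable Q D0).
have di2 := integrableZl measurableT 2 di.
(* The defect of [Z] at y is O(2^-k) for every k: [Z y] is near [Zs k.+1 y], a flow built from
   [Zs k], and that flow is near the one built from [Z]. *)
apply: (@le_geometric _ _ (2 * (d0 y + D0) + (2 * (d0 y + D0) + E0) / 8)) => k; rewrite add0r.
have p2 : 0 < (2 ^+ k : R) by exact: exp2_gt0.
have h1 := ZP y k.+1; have h2 := ZP y k.
have h3 : \int[Q]_e wd lam (Zs k e) (Z e) <= E0 / 2 ^+ k.
  rewrite mulrC /E0 -(RintegralZl _ measurableT di2); apply: le_RintegralT.
  - exact: (wd2_integrable fmQ (Zlip k) Zl).
  - exact: (integrableZl measurableT _ di2).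
  - by move=> e; rewrite mulrC; exact: ZP.
have h4 := flow_lip (-1) (Zs k y) (Z y) y y fmQ (Zlip k) Zl.
rewrite -ZsS wdxx// add0r n1 mul1r in h4.
have h5 := wd_triangle T0 lam_ge0 (Z y) (Zs k.+1 y) (flow (-1) Q Z (Z y) y).
rewrite (wd_sym T0 lam_ge0 (Z y) (Zs k.+1 y)) in h5.
have h6 : 2 * (d0 y + D0) / 2 ^+ k.+1 <= 2 * (d0 y + D0) / 2 ^+ k.
  apply: ler_wpM2l; first by rewrite mulr_ge0 ?addr_ge0.
  rewrite lef_pV2; [by rewrite exprS ler_peMl ?(ltW p2)// ler1n|exact: exp2_gt0|exact: exp2_gt0].
have split_sum (a b u : R) : (a + (a + b) / 8) * u = a * u + (a * u + b * u) / 8 by ring.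
rewrite split_sum.
move: h1 h2 h3 h4 h5 h6.
move: (2 * (d0 y + D0) / 2 ^+ k.+1) (2 * (d0 y + D0) / 2 ^+ k) (E0 / 2 ^+ k) => a b c.
move: (wd lam (Zs k.+1 y) (Z y)) (wd lam (Zs k y) (Z y)) (\int[Q]_e wd lam (Zs k e) (Z e)) => c1 c2 c3.
move: (wd lam (Zs k.+1 y) (flow (-1) Q Z (Z y) y)) (wd lam (Z y) (flow (-1) Q Z (Z y) y)) => c4 c5.
by move=> *; lra.
Qed.


Lemma lipmap_comp K F K' F' : lipmap K F -> lipmap K' F' -> lipmap (K * K') (F \o F').
Proof.
move=> [K0 FK] [K'0 FK']; split; first exact: mulr_ge0.
by move=> w v /=; rewrite (le_trans (FK _ _))// -mulrA ler_wpM2l.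
Qed.

Lemma lipmap_point : lipmap 0 (fun=> point).
Proof. by split => // w v; rewrite mul0r wdxx. Qed.

Lemma first_moment_law Q Q' K th : lipmap K th -> has_law th Q Q' -> first_moment Q ->
  first_moment Q'.
Proof.
move=> thK hl fmQ; have mth := lipmap_measurable thK.
apply: (integrable_law mth hl).
  exact: (lip_integrable fmQ (fun w v => wd2_lip w v lipmap_id lipmap_point)).1.
exact: (wd2_integrable fmQ thK lipmap_point).
Qed.

Lemma first_moment_sqr Q (K : R) : (\int[Q]_e (wd lam e point ^+ 2)%:E <= K%:E)%E ->
  first_moment Q /\ \int[Q]_e wd lam e point <= 1 + K.
Proof.
move=> h; have mN : measurable_fun setT (fun w : Omega R T d => wd lam w point).
  exact: measurable_wd.
have i2 : Q.-integrable setT (EFin \o (fun e => wd lam e point ^+ 2)).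
  apply: finite_ge0_integrable; last exact: (le_lt_trans h (ltry _)).
    exact: measurable_funX.
  by move=> e; exact: sqr_ge0.
have i3 : Q.-integrable setT (EFin \o (fun e => 1 + wd lam e point ^+ 2)).
  exact: (integrableD measurableT (cst_integrable Q 1) i2).
have le1 (e : Omega R T d) : wd lam e point <= 1 + wd lam e point ^+ 2.
  by move: (wd lam e point) => x; have := sqr_ge0 (x - 1); rewrite sqrrB1; have := sqr_ge0 x; lra.
have fm : first_moment Q.
  apply: (dominated_integrable measurableT mN _ i3) => e _.
  by rewrite ger0_norm ?wd_ge0.
have h4 := le_RintegralT fm i3 le1.
split => //; apply: (le_trans h4).
rewrite (RintegralD measurableT (cst_integrable Q 1) i2) Rintegral_cstT lerD2l.
rewrite -lee_fin EFin_Rintegral//.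
Qed.

Lemma drift_law Q Q' K F K' th w : lipmap K F -> lipmap K' th -> has_law th Q Q' ->
  drift Q' F w = drift Q (F \o th) w.
Proof.
move=> FK thK hl; apply/funext => i; rewrite !driftE; apply/funext => s.
exact: (Rintegral_law (lipmap_measurable thK) hl (G_measurable i (ev w s) s FK)).
Qed.

(** The interaction sees only the law of [F] under [Q'], which is the law of [F \o th] under [Q]. *)
Lemma flow_law c Q Q' K F K' th w y : lipmap K F -> lipmap K' th -> has_law th Q Q' ->
  flow c Q' F w y = flow c Q (F \o th) w y.
Proof. by move=> FK thK hl; rewrite [flow]unlock (drift_law _ FK thK hl). Qed.

Lemma tint_mono (h : R -> R) t : continuous h -> (forall s, 0 <= h s) ->
  tint (T := T) h t <= tint (T := T) h T.
Proof.
move=> ch h0; rewrite /tint [clamp T T]clamp_id; last by rewrite lexx ltW.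
have /andP[c0 cT] := clamp_itv T0 t.
rewrite -lee_fin !EFin_Rintegral//; try exact: itv_integrable.
apply: ge0_subset_integral => //=.
- by apply/measurable_EFinP; apply: measurable_funTS; exact: continuous_measurable_fun.
- by move=> x _; rewrite lee_fin.
- by apply: subset_itvl; rewrite bnd_simp.
Qed.

(** * Stability under setwise convergence of the noise laws *)

Section Stability.
Variables (M : probability (Omega R T d) R) (C K : R)
  (Q_ : nat -> probability (Omega R T d) R) (Q : probability (Omega R T d) R).
Hypothesis Q_C : forall n, entropy_dual C (Q_ n) M.
Hypothesis Q_Q : forall A, measurable A -> fine (Q_ n A) @[n --> \oo] --> fine (Q A).
Hypothesis Q_2 : forall n, (\int[Q_ n]_e (wd lam e point ^+ 2)%:E <= K%:E)%E.
Hypothesis Q2 : (\int[Q]_e (wd lam e point ^+ 2)%:E <= K%:E)%E.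

Let fm_ n := (first_moment_sqr (Q_2 n)).1.
Let fm := (first_moment_sqr Q2).1.

Lemma cvg_Rintegral_path (g_ : nat -> Omega R T d -> R) (g : Omega R T d -> R) (c : R) :
  (forall n, measurable_fun setT (g_ n)) -> measurable_fun setT g ->
  (forall e, g_ n e @[n --> \oo] --> g e) ->
  (forall n e, `|g_ n e| <= c * (1 + wd lam e point)) ->
  \int[Q_ n]_e g_ n e @[n --> \oo] --> \int[Q]_e g e.
Proof.
move=> mg_ mg gg gb; apply: (cvg_Rintegral_entropy Q_C Q_Q _ _ Q_2 Q2 mg_ mg gg gb).
- exact: measurable_wd.
- by move=> e; exact: wd_ge0.
Qed.

Let c0 F (c K' : R) : R := `|g0| + L * (`|c| + eT * (wd lam (F point) point + K')).

Let drift_dom_le K' F c e : lipmap K' F ->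
  drift_dom K' F c e <= c0 F c K' * (1 + wd lam e point).
Proof.
move=> [K'0 _]; rewrite /drift_dom /c0.
have L0' := ltW L0; have h0 := expR_ge0 (lam * T).
have h1 := wd_ge0 T0 lam_ge0 (F point) point; have h2 := wd_ge0 T0 lam_ge0 e point.
have h3 := ler_norm g0; have h4 := ler_norm c.
have h5 := normr_ge0 g0; have h6 := normr_ge0 c.
move: h0 h1 h2 h3 h4 h5 h6.
move: eT (wd lam (F point) point) (wd lam e point) g0 `|g0| `|c| => E a x g g' c' E0 a0 x0 gg cc g'0 c'0.
have e1 : 0 <= g' * x by rewrite mulr_ge0.
have e2 : 0 <= L * (c' * x) by rewrite !mulr_ge0.
have e3 : 0 <= L * (c' - c) by rewrite mulr_ge0// subr_ge0.
have e4 : 0 <= L * (E * (a * x)) by rewrite !mulr_ge0.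
have e5 : 0 <= L * (E * K') by rewrite !mulr_ge0.
rewrite -subr_ge0.
have -> : (g' + L * (c' + E * (a + K'))) * (1 + x) - (g + L * (c + E * (a + K' * x))) =
  (g' - g) + g' * x + L * (c' * x) + L * (c' - c) + L * (E * (a * x)) + L * (E * K') by ring.
have e0 : 0 <= g' - g by rewrite subr_ge0.
by rewrite 5?addr_ge0.
Qed.

Lemma drift_cvg K' F w i s : lipmap K' F ->
  drift (Q_ n) F w i s @[n --> \oo] --> drift Q F w i s.
Proof.
move=> FK; rewrite driftE; under eq_fun do rewrite driftE.
apply: (@cvg_Rintegral_path (fun=> fun e => G i (ev w s - ev (F e) s)) _
  (c0 F (eT * wd lam w point) K')).
- by move=> n; exact: (G_measurable _ _ _ FK).
- exact: (G_measurable _ _ _ FK).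
- by move=> e; exact: cvg_cst.
- move=> n e; apply: le_trans (drift_dom_le _ _ FK).
  by apply: drift_dom_ge => //; exact: ev_wd0.
Qed.

Lemma drift_uniform_bound K' F w n i s : lipmap K' F ->
  `|drift (Q_ n) F w i s| <= c0 F (eT * wd lam w point) K' * (1 + (1 + K)).
Proof.
move=> FK; apply: (le_trans (drift_bound _ _ _ (fm_ n) FK)).
have i1 := integrableD measurableT (cst_integrable (Q_ n) 1) (fm_ n).
apply: (le_trans (le_RintegralT _ (integrableZl measurableT (c0 F (eT * wd lam w point) K') i1) _)).
- exact: drift_dom_integrable.
- by move=> e; exact: drift_dom_le.
rewrite (RintegralZl _ measurableT i1) (RintegralD measurableT (cst_integrable (Q_ n) 1) (fm_ n)) Rintegral_cstT.
rewrite ler_wpM2l//; last by rewrite lerD2l (first_moment_sqr (Q_2 n)).2.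
rewrite /c0 addr_ge0// mulr_ge0 ?(ltW L0)// addr_ge0// mulr_ge0 ?expR_ge0// addr_ge0 ?wd_ge0//.
by case: FK.
Qed.

(** Drifts converge at each time and are bounded uniformly in n and s, so dominated convergence in
    time applies. *)
Lemma tint_drift_cvg K' F w i : lipmap K' F ->
  tint (T := T) (fun s => `|drift (Q_ n) F w i s - drift Q F w i s|) T @[n --> \oo] --> (0 : R).
Proof.
move=> FK; pose B := c0 F (eT * wd lam w point) K' * (1 + (1 + K)).
have cd n : continuous (fun s => drift (Q_ n) F w i s - drift Q F w i s).
  by move=> s; apply: cvgB; [exact: (drift_continuous (fm_ n) FK)|exact: (drift_continuous fm FK)].
rewrite /tint [clamp T T]clamp_id; last by rewrite lexx ltW.
have I0 : \int[@lebesgue_measure R]_(s in `[0, T]) (0 : R) = 0 by rewrite Rintegral_cst// mul0r.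
rewrite -[X in _ --> X]I0.
apply: (@dominated_cvg_Rintegral _ _ _ (@lebesgue_measure R) `[0, T] _ _ (fun=> B + B)) => //.
- move=> n; apply: measurable_funTS; apply: continuous_measurable_fun => s.
  by apply: cvg_norm; exact: cd.
- move=> s _; rewrite -(normr0 R); apply: cvg_norm.
  by rewrite -(subrr (drift Q F w i s)); apply: cvgB; [exact: (@drift_cvg _ _ w i s FK)|exact: cvg_cst].
- by apply: itv_integrable => s; exact: cvg_cst.
- move=> n s _; rewrite normr_id (le_trans (ler_normB _ _))// lerD//.
    exact: drift_uniform_bound.
  have dc : `|drift (Q_ m) F w i s| @[m --> \oo] --> `|drift Q F w i s|.
    by apply: cvg_norm; exact: (@drift_cvg _ _ w i s FK).
  by apply: (cvgr_to_le dc); apply: nearW => m; exact: drift_uniform_bound.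
Qed.

(** The distance is controlled by the integral over [0, T] of the absolute drift difference, so
    pointwise convergence of drifts gives uniform convergence of paths. *)
Lemma flow_cvg K' F w y : lipmap K' F ->
  wd lam (flow (-1) (Q_ n) F w y) (flow (-1) Q F w y) @[n --> \oo] --> (0 : R).
Proof.
move=> FK; apply/cvgrPdist_le => e e0.
have H i : \forall n \near \oo, tint (T := T) (fun s => `|drift (Q_ n) F w i s - drift Q F w i s|) T <= e.
  have /cvgrPdist_le/(_ e e0) := @tint_drift_cvg _ _ w i FK; apply: filterS => n.
  by rewrite sub0r normrN; exact/le_trans/ler_norm.
apply: filterS (filter_forall _ H) => n Hn.
rewrite sub0r normrN ger0_norm ?wd_ge0//; apply: wd_le => // t tT.
rewrite (ev_flow _ _ _ (fm_ n) FK tT) (ev_flow _ _ _ fm FK tT).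
rewrite opprD addrACA subrr add0r -scalerBr normrZ normrN normr1 mul1r.
apply: (@le_trans _ _ e); last first.
  rewrite ler_peMl ?(ltW e0)// -expR0 ler_expR mulr_ge0//; by case/andP : tT.
have cn i : continuous (drift (Q_ n) F w i) by exact: (drift_continuous (fm_ n) FK).
have cQ i : continuous (drift Q F w i) by exact: (drift_continuous fm FK).
have cd i : continuous (fun s => `|drift (Q_ n) F w i s - drift Q F w i s|).
  by move=> s; apply: cvg_norm; apply: cvgB; [exact: cn|exact: cQ].
apply: rV_norm_le => [|i]; first exact: ltW.
rewrite !mxE tintB; [|exact: cn|exact: cQ].
apply: le_trans (Hn i); apply: le_trans (tint_mono t (cd i) _) => //.
by apply: tint_le => // s; apply: cvgB; [exact: cn|exact: cQ].
Qed.

(** Let V_n be the integral in question and H_n(y) the defect of [Z] at y when Q_n replaces [Q] in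
    its equation. Under P_n a path solves the equation driven by its own noise, so contraction gives
    V_n <= (V_n + V_n) / 8 + int H_n dQ_n. The defects tend to 0 pointwise by [flow_cvg] and grow at
    most linearly, so their Q_n-integrals vanish. *)
Lemma stability (P_ : nat -> probability (Omega R T d) R) Z :
  (forall n, first_moment (P_ n)) ->
  (forall n, has_law (fun w => flow 1 (P_ n) id w w) (P_ n) (Q_ n)) ->
  lipmap 2 Z -> (forall y, Z y = flow (-1) Q Z (Z y) y) ->
  \int[P_ n]_w wd lam w (Z (flow 1 (P_ n) id w w)) @[n --> \oo] --> (0 : R).
Proof.
move=> fP PQ Z2 ZE; pose th n w := flow 1 (P_ n) id w w.
have th2 n : lipmap 2 (th n).
  by apply: (flow_lipmap (normr1 _) (fP n) lipmap_id _ lipmap_id); rewrite ler01 ler1n.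
have Zth n := lipmap_comp Z2 (th2 n).
pose H n y := wd lam (flow (-1) (Q_ n) Z (Z y) y) (Z y).
have n1 : `|-1| = 1 :> R by rewrite normrN normr1.
have fl2 n : lipmap 2 (fun y => flow (-1) (Q_ n) Z (Z y) y).
  by apply: (flow_lipmap n1 (fm_ n) Z2 _ Z2); rewrite lexx ler0n.
have Hlip n w v : `|H n w - H n v| <= (2 + 2) * wd lam w v.
  exact: (wd2_lip w v (fl2 n) Z2).
have mH n := wd_lip_measurable T0 lam_ge0 (Hlip n).
have H0 y : H n y @[n --> \oo] --> (0 : R).
  by rewrite /H {2}ZE; exact: (@flow_cvg _ _ (Z y) y Z2).
have [B BH] : exists B, forall n, `|H n point| <= B.
  have /cvg_seq_bounded/pinfty_ex_gt0[B B0 HB] : cvgn (fun n => H n point).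
    by apply/cvg_ex; exists 0; exact: H0.
  by exists B => n; exact: HB.
have IH : \int[Q_ n]_y H n y @[n --> \oo] --> (0 : R).
  rewrite -[X in _ --> X](Rintegral_cstT Q 0).
  apply: (@cvg_Rintegral_path _ _ (B + 4)) => // n e.
  have h1 := Hlip n e point; have h2 := BH n; have h3 := wd_ge0 T0 lam_ge0 e point.
  have B0 : 0 <= B by exact: le_trans (normr_ge0 _) h2.
  have := mulr_ge0 B0 h3.
  have := ler_normD (H n e - H n point) (H n point); rewrite subrK.
  move: h1 h2 h3 B0; move: `|H n e| `|H n point| `|H n e - H n point| (wd lam e point) => a b c x.
  move=> h1 h2 h3 B0 h4 h5.
  have -> : (B + 4) * (1 + x) = B + 4 + B * x + 4 * x by ring.
  lra.
pose V n := \int[P_ n]_w wd lam w (Z (th n w)).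
have Hint n : (P_ n).-integrable setT (EFin \o (fun w => H n (th n w))).
  have Hth w v : `|H n (th n w) - H n (th n v)| <= (2 + 2) * 2 * wd lam w v.
    rewrite (le_trans (Hlip _ _ _))// -[leRHS]mulrA ler_wpM2l//.
    exact: (th2 n).2.
  exact: (lip_integrable (fP n) Hth).2.
have Vi n := wd2_integrable (fP n) lipmap_id (Zth n).
have VH n : V n <= 2 * \int[Q_ n]_y H n y.
  rewrite (Rintegral_law (lipmap_measurable (th2 n)) (PQ n) (mH n)).
  have V0 : 0 <= V n by apply: Rintegral_ge0 => w _; exact: wd_ge0.
  have pw w : wd lam w (Z (th n w)) <= 8^-1 * (wd lam w (Z (th n w)) + V n) + H n (th n w).
    apply: (le_trans (wd_triangle T0 lam_ge0 _ (flow (-1) (Q_ n) Z (Z (th n w)) (th n w)) _)).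
    rewrite lerD2r (flow_law _ _ _ Z2 (th2 n) (PQ n)) {1}(flow_cancel w (fP n) lipmap_id).
    have := flow_lip (-1) w (Z (th n w)) (th n w) (th n w) (fP n) lipmap_id (Zth n).
    by rewrite n1 mul1r wdxx// add0r mulrC.
  have i1 := integrableD measurableT (Vi n) (cst_integrable (P_ n) (V n)).
  have i2 := integrableZl measurableT 8^-1 i1.
  have := le_RintegralT (Vi n) (integrableD measurableT i2 (Hint n)) pw.
  rewrite (RintegralD measurableT i2 (Hint n)) (RintegralZl _ measurableT i1).
  rewrite (RintegralD measurableT (Vi n) (cst_integrable (P_ n) (V n))) Rintegral_cstT -/(V n).
  move: V0 (\int[P_ n]_w H n (th n w)); move: (V n) => a a0 b; lra.
apply: (squeeze_cvgr (f := fun=> 0) (h := fun n => 2 * \int[Q_ n]_y H n y)).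
- by apply: nearW => n; rewrite VH andbT; apply: Rintegral_ge0 => w _; exact: wd_ge0.
- exact: cvg_cst.
- by rewrite -(mulr0 2); apply: cvgMr; exact: IH.
Qed.

End Stability.
End Drift.


(** * The law of an initial position plus Brownian motion *)

Section NoiseLaw.
Context {R : realType} {T : R} {d : nat}.
Hypothesis T0 : 0 < T.
Implicit Types (w v : Omega R T d) (M : probability (Omega R T d) R) (mu : probability (Rd R d) R).

(* The law of the sum of an initial position of law [mu] and of an independent
   Brownian motion. *)
Definition noise_law mu M : Prop :=
  forall m (A : set (Rd R d)) (B : 'I_(2 ^ m) -> 'I_d -> set R), measurable A ->
    (forall i j, measurable (B i j)) ->
    M (increment_rect A B) =
      (mu A * \prod_(i < 2 ^ m) \prod_(j < d) normal_prob 0 (Num.sqrt (T / 2 ^+ m)) (B i j))%E.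

Lemma noise_law_unique mu M M' : noise_law mu M -> noise_law mu M' ->
  forall S, measurable S -> M S = M' S.
Proof. by move=> MP M'P; apply: law_unique => // m A B mA mB; rewrite MP// M'P. Qed.

(** Put the whole line in every slot of the rectangle but one. *)
Lemma noise_law_increment mu M m i (c : 'I_d) (V : set R) : noise_law mu M -> (i < 2 ^ m)%N ->
  measurable V -> M (increment m i c @^-1` V) = normal_prob 0 (Num.sqrt (T / 2 ^+ m)) V.
Proof.
move=> MP im mV; pose B (k : 'I_(2 ^ m)) (j : 'I_d) := if (k == Ordinal im) && (j == c) then V else setT.
have mB k j : measurable (B k j) by rewrite /B; case: ifP.
have -> : increment m i c @^-1` V = @increment_rect R T d m setT B.
  apply/seteqP; split => w /=.
    by move=> h; split => // i1 j1; rewrite /B; case: ifP => // /andP[/eqP-> /eqP->].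
  by move=> [_ /(_ (Ordinal im) c)]; rewrite /B !eqxx.
rewrite MP// probability_setT mul1e (bigD1 (Ordinal im))//= (bigD1 c)//= /B !eqxx/=.
rewrite big1 ?mule1; last by move=> j /negPf ->; exact: probability_setT.
rewrite big1 ?mule1// => k /negPf ->; rewrite big1// => j _; exact: probability_setT.
Qed.

Fact translate_key : unit. Proof. exact: tt. Qed.
Definition translate : 'rV[R]_d -> Omega R T d -> Omega R T d :=
  locked_with translate_key (fun x w => mkpath (fun t => x + ev w t)).

Lemma ev_translate x w t : ev (translate x w) t = x + ev w t.
Proof.
rewrite [translate]unlock ev_mkpath ?ev_clamp// => s.
by apply: cvgD; [exact: cvg_cst|exact: ev_continuous].
Qed.

Lemma probability_ae_eq dsp (E : measurableType dsp) (Pr : probability E R) (S S' : set E) :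
  {ae Pr, forall e, S e <-> S' e} -> measurable S -> measurable S' -> Pr S = Pr S'.
Proof.
move=> [N [mN N0 SN]] mS mS'.
have half (U V : set E) : measurable U -> measurable V -> U `<=` V `|` N -> (Pr U <= Pr V)%E.
  move=> mU mV UV; apply: (@le_trans _ _ (Pr (V `|` N))).
    by apply: le_measure => //; rewrite inE//; exact: measurableU.
  by rewrite measureU0.
apply/eqP; rewrite eq_le; apply/andP; split; apply: half => // e Ue.
  by have [V|nV] := pselect (S' e); [left|right; apply: SN => -[/(_ Ue)]].
by have [V|nV] := pselect (S e); [left|right; apply: SN => -[_ /(_ Ue)]].
Qed.

Section Setup.
Variables (mu : probability (Rd R d) R) (dsp : measure_display) (E : measurableType dsp)
  (Pr : probability E R) (xi : {RV Pr >-> Rd R d}) (B : {RV Pr >-> Omega R T d}).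
Hypothesis xi_law : forall A, measurable A -> distribution Pr xi A = mu A.
Hypothesis BB : brownian_motion B.
Hypothesis xi_B : independent_RV xi B.

Let measurable_xi : measurable_fun setT (xi : E -> Rd R d) := measurable_funPT xi.
Let measurable_B : measurable_fun setT (B : E -> Omega R T d) := measurable_funPT B.

Lemma measurable_translate : measurable_fun setT (fun e => translate (xi e) (B e)).
Proof.
apply: (measurable_path T0) => t c tT.
under eq_fun do rewrite ev_translate mxE.
apply: measurable_funD; first exact: (measurableT_comp (measurable_coord c) measurable_xi).
exact: (measurableT_comp (measurable_evc t c) measurable_B).
Qed.

(** Almost surely B starts at 0, so xi + B starts at xi and has the increments of B; independence
    then factors the mass of a rectangle. *)
Lemma translate_noise_law : exists2 M, noise_law mu M & has_law (fun e => translate (xi e) (B e)) Pr M.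
Proof.
have [M ML] := has_law_distribution Pr measurable_translate; exists M => // m A C mA mC.
have mI := measurable_increment_rect mA mC.
have mIB := @measurable_increment_rect R T d m setT C measurableT mC.
rewrite ML//.
have -> : Pr ((fun e => translate (xi e) (B e)) @^-1` increment_rect A C) =
    Pr (xi @^-1` A `&` B @^-1` increment_rect setT C).
  apply: probability_ae_eq.
  - case: BB => B0 _; apply: filterS B0 => e B0 /=.
    have X0 w : X 0 w = ev w 0 by rewrite XE// lexx ltW.
    have E1 i j : (ev (translate (xi e) (B e)) (dy T m i.+1) - ev (translate (xi e) (B e)) (dy T m i)) 0 j =
      (ev (B e) (dy T m i.+1) - ev (B e) (dy T m i)) 0 j.
      by rewrite !ev_translate opprD addrACA subrr add0r.
    rewrite /increment_rect/= X0 ev_translate -X0 B0 addr0.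
    split.
      by move=> [a b]; split => //; split => // i j; rewrite -E1; exact: b.
    by move=> [a [_ b]]; split => // i j; rewrite E1; exact: b.
  - by rewrite -[X in measurable X]setTI; exact: measurable_translate.
  - by apply: measurableI; rewrite -[X in measurable X]setTI; [exact: measurable_xi|exact: measurable_B].
rewrite xi_B// -xi_law//; congr (_ * _)%E.
have [_ /(_ (2 ^ m)%N (fun i => dy T m i) C)] := BB.
rewrite dyT dy_ge0// lexx => /(_ isT isT) H.
have incr i : (i < 2 ^ m)%N -> dy T m i < dy T m i.+1.
  by move=> _; rewrite dyS ltrDl divr_gt0// exp2_gt0.
have E2 : B @^-1` increment_rect setT C = [set e | forall (i : 'I_(2 ^ m)) (j : 'I_d),
    C i j ((X (dy T m i.+1) (B e) - X (dy T m i) (B e)) 0 j)].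
  apply/seteqP; split => e /= h.
    move=> i j; rewrite !XE; [exact: h.2|exact/(dy_itv T0)/ltnW|exact: dy_itv].
  split => // i j; have := h i j; rewrite !XE//; [exact/(dy_itv T0)/ltnW|exact: dy_itv].
have var i : dy T m i.+1 - dy T m i = T / 2 ^+ m by rewrite dyS addrAC subrr add0r.
rewrite E2 (H incr mC); apply: eq_bigr => i _; apply: eq_bigr => j _.
by rewrite var.
Qed.

End Setup.
End NoiseLaw.


Lemma measurable_continuous_Rd {R : realType} {d : nat} (f : 'rV[R]_d -> R) :
  continuous f -> measurable_fun [set: Rd R d] (f : Rd R d -> R).
Proof.
move=> cf; apply: (measurability _ (RGenOpens.measurableE R)).
move=> _ [_ [x [y ->]] <-]; rewrite setTI; apply: sub_sigma_algebra.
apply: open_comp; last exact: interval_open.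
by move=> v _; exact: cf.
Qed.

Lemma lipschitz_continuous {R : realType} {V : normedModType R} (f : V -> R) (L : R) : 0 < L ->
  (forall x y, `|f x - f y| <= L * `|x - y|) -> continuous f.
Proof.
move=> L0 fL x; apply/cvgrPdist_le => e e0; have eL : 0 < e / L by rewrite divr_gt0.
apply: filterS (nbhsx_ballx x _ eL) => z; rewrite -ball_normE /ball_/= => xz.
by apply: (le_trans (fL _ _)); rewrite mulrC -ler_pdivlMr// ltW.
Qed.

(** * Strong solutions and the flow *)

Section Solution.
Context {R : realType} {T : R} {d : nat}.
Hypothesis T0 : 0 < T.
Variables (W : 'rV[R]_d -> R) (G : 'I_d -> 'rV[R]_d -> R) (L lam : R).
Hypothesis GE : forall i x, grad W x 0 i = G i x.
Hypothesis L0 : 0 < L.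
Hypothesis GL : forall i x y, `|G i x - G i y| <= L * `|x - y|.
Hypothesis lamE : lam = 8 * L.
Implicit Types (w v y : Omega R T d) (P Q : probability (Omega R T d) R).

Let lam_ge0 : 0 <= lam. Proof. by rewrite lamE mulr_ge0 ?(ltW L0). Qed.

Lemma interaction_drift P w i s : 0 <= s <= T ->
  interaction W P s (ev w s) 0 i = drift G P id w i s.
Proof.
move=> sT; rewrite /interaction mxE /marginal driftE.
have hl : has_law (X s) P (distribution P (X s)) by [].
have cf : continuous (fun y : 'rV[R]_d => G i (ev w s - y)).
  apply: (lipschitz_continuous L0) => y z; rewrite (le_trans (GL _ _ _))//.
  by rewrite opprB addrC subrKA distrC.
have := Rintegral_law (measurable_X s) hl (measurable_continuous_Rd cf).
under eq_Rintegral do rewrite -GE.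
move=> ->; by apply: eq_Rintegral => e _; rewrite XE.
Qed.

Section Flow.
Variables (mu : probability (Rd R d) R) (dsp : measure_display) (E : measurableType dsp)
  (Pr : probability E R) (xi : {RV Pr >-> Rd R d}) (B Z : {RV Pr >-> Omega R T d}).

Lemma solution_flow P : first_moment lam P -> strong_solution W P xi B Z ->
  {ae Pr, forall e, flow G 1 P id (Z e) (Z e) = translate (xi e) (B e)}.
Proof.
move=> fmP [_ ae]; apply: filterS ae => e [X0 eqZ].
apply: path_ext => // t tT.
rewrite (ev_flow T0 L0 GL lamE 1 _ _ fmP (lipmap_id lam) tT) scale1r (ev_translate T0).
set I := \row_i _; have [_] := eqZ t tT; rewrite X0 !XE// => ->.
set J := \row_i _; suff -> : I = J by rewrite addrAC subrK.
apply/rowP => i; rewrite !mxE /tint clamp_id//.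
apply: eq_Rintegral => s; rewrite inE/= in_itv/= => /andP[s0 st].
have sT : 0 <= s <= T by rewrite s0 (le_trans st)//; case/andP : tT.
by rewrite XE// interaction_drift.
Qed.

End Flow.

(** Solving the integral equation for the noise gives [translate (xi e) (B e)] almost surely. The
    image is thus a noise law, and [noise_law_unique] makes it independent of [P]. *)
Lemma solution_law_noise mu P Q : first_moment lam P -> solution_law W mu P Q ->
  exists2 M, noise_law mu M & has_law (fun w => flow G 1 P id w w) Q M.
Proof.
move=> fmP [dsp [E [Pr [xi [B [Z [xiL BB xiB sol QZ]]]]]]].
have [M MN ML] := translate_noise_law T0 xiL BB xiB; exists M => // S mS.
have F2 : lipmap lam 2 (fun w => flow G 1 P id w w).
  by apply: (flow_lipmap T0 L0 GL lamE (normr1 _) fmP (lipmap_id lam) _ (lipmap_id lam));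
    rewrite ler01 ler1n.
have mF := lipmap_measurable T0 L0 lamE F2.
have mFS : measurable ((fun w => flow G 1 P id w w) @^-1` S).
  by rewrite -[X in measurable X]setTI; exact: mF.
rewrite ML// QZ//; apply: probability_ae_eq.
- by apply: filterS (solution_flow fmP sol) => e /= ->.
- by rewrite -[X in measurable X]setTI; exact: measurable_translate.
- by rewrite -[X in measurable X]setTI; exact: (measurable_funPT Z).
Qed.

Fact stop_key : unit. Proof. exact: tt. Qed.
(** Serves adaptedness: a solution at time t depends on its driving path only through the path
    stopped at t. *)
Definition stop : R -> Omega R T d -> Omega R T d :=
  locked_with stop_key (fun t w => mkpath (fun s => ev w (Num.min s t))).

Lemma ev_stop t w s : ev (stop t w) s = ev w (Num.min (clamp T s) t).
Proof.
have cm : continuous (fun s : R => Num.min s t).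
  apply: (lipschitz_continuous ltr01) => u z; rewrite mul1r.
  rewrite ler_norml; have := ler_norm (u - z); have := ler_norm (z - u); rewrite distrC.
  by case: (leP u t) => h1; case: (leP z t) => h2 h3 h4; apply/andP; split; lra.
rewrite [stop]unlock ev_mkpath// => u.
by apply: (@continuous_comp _ _ _ (fun s : R => Num.min s t) (ev w)); [exact: cm|exact: ev_continuous].
Qed.

Lemma ev_stop_le t w s : 0 <= t <= T -> 0 <= s <= t -> ev (stop t w) s = ev w s.
Proof.
move=> /andP[t0 tT] /andP[s0 st]; rewrite ev_stop clamp_id ?s0 ?(le_trans st)//.
by rewrite min_l.
Qed.

Lemma drift_stop P v t u : 0 <= t <= T -> 0 <= u <= t ->
  \row_i tint (T := T) (drift G P id v i) u =
  \row_i tint (T := T) (drift G P id (stop t v) i) u :> 'rV[R]_d.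
Proof.
move=> tT /andP[u0 ut]; have uT : 0 <= u <= T by rewrite u0 (le_trans ut)//; case/andP : tT.
apply: eq_mx => _ i; rewrite /tint (clamp_id uT).
apply: eq_Rintegral => r; rewrite inE/= in_itv/= => /andP[r0 ru].
by rewrite !driftE ev_stop_le// r0 (le_trans ru).
Qed.

Lemma flow_stop P v y t u : first_moment lam P -> 0 <= t <= T -> 0 <= u <= t ->
  v = flow G (-1) P id v y ->
  ev v u = ev y u - \row_i tint (T := T) (drift G P id (stop t v) i) u.
Proof.
move=> fmP tT ut vE; have uT : 0 <= u <= T.
  by case/andP : ut => -> /le_trans; apply; case/andP : tT.
apply: etrans (congr1 (fun w => ev w u) vE) _.
apply: etrans (ev_flow T0 L0 GL lamE _ _ _ fmP (lipmap_id lam) uT) _.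
by rewrite scaleN1r; congr (_ - _); exact: drift_stop.
Qed.

(** Up to time t both solutions have the same driving path and a drift that looks only at the past,
    so the contraction estimate forces the stopped solutions to coincide. *)
Lemma solution_stop P Z t y : first_moment lam P -> (forall y, Z y = flow G (-1) P id (Z y) y) ->
  0 <= t <= T -> ev (Z y) t = ev (Z (stop t y)) t.
Proof.
move=> fmP ZE tT; have [t0 tT'] := andP tT.
have idl := lipmap_id (R := R) (T := T) (d := d) lam.
suff H : stop t (Z y) = stop t (Z (stop t y)).
  have tt : 0 <= t <= t by rewrite t0 lexx.
  by rewrite -(ev_stop_le (Z y) tT tt) H (ev_stop_le _ tT tt).
set w := Z y; set w' := Z (stop t y); apply: (wd_eq0 T0 lam_ge0).
set D := wd lam _ _; have D0 : 0 <= D by exact: wd_ge0.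
suff : D <= D / 8 by lra.
apply: wd_le => // s sT; rewrite !ev_stop (clamp_id sT).
set u := Num.min s t.
have uT : 0 <= u <= T.
  by rewrite /u le_min ge_min t0 tT' orbT; case/andP : sT => -> _.
have ut : u <= t by rewrite ge_min lexx orbT.
have ut' : 0 <= u <= t by rewrite ut andbT; case/andP : uT.
have us : u <= s by rewrite ge_min lexx.
have evw := flow_stop fmP tT ut' (ZE y); rewrite -/w in evw.
have evw' := flow_stop fmP tT ut' (ZE (stop t y)); rewrite -/w' (ev_stop_le _ tT ut') in evw'.
rewrite evw evw' opprB addrC subrKA distrC.
have cd v i : continuous (drift G P id v i) := drift_continuous T0 L0 GL lamE fmP idl.
rewrite mulrC (le_trans (tint_row_le T0 L0 lamE (cd _) (cd _) D0 uT _))//.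
  move=> i r rT; apply: (le_trans (drift_compare T0 L0 GL lamE _ _ _ fmP idl idl rT)).
  by rewrite (Rintegral_wdxx T0 L0 lamE) addr0.
by rewrite ler_wpM2l ?divr_ge0// ler_expR ler_wpM2l.
Qed.

(** The probability space, xi and B of one known solution are reused: [Z] applied to xi + B solves
    the equation for the other law. *)
Lemma solution_exists mu P Q P' Z : first_moment lam P' -> lipmap lam 2 Z ->
  (forall y, Z y = flow G (-1) P' id (Z y) y) ->
  solution_law W mu P Q -> exists Q', solution_law W mu P' Q'.
Proof.
move=> fmP' Z2 ZE [dsp [E [Pr [xi [B [_ [xiL BB xiB _ _]]]]]]].
have idl := lipmap_id (R := R) (T := T) (d := d) lam.
have mZ := lipmap_measurable T0 L0 lamE Z2.
have mS := @measurable_translate R T d T0 _ _ Pr xi B.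
have mZS : measurable_fun setT (fun e => Z (translate (xi e) (B e))) := measurableT_comp mZ mS.
pose Z' : {RV Pr >-> Omega R T d} := HB.pack (fun e => Z (translate (xi e) (B e)))
  (isMeasurableFun.Build _ _ _ _ _ mZS).
exists (distribution Pr Z'); exists dsp, E, Pr, xi, B, Z'; split => //; split.
  move=> t A tT mA.
  exists ((fun e => X t (Z' e)) @^-1` A); last first.
    by rewrite setYK; exact: negligible_set0.
  (* [E] with the sigma-algebra generated by xi and B up to time t. The stopped path is measurable
     for it, and by [solution_stop] that path determines the solution at t; no null set has to be
     discarded. *)
  pose Eu := g_sigma_algebraType (events_upto xi B t).
  have ms : measurable_fun [set: Eu]
      (fun e => stop t (translate (xi e) (B e)) : Omega R T d).
    apply: (measurable_path T0) => s c sT.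
    under eq_fun do rewrite ev_stop (ev_translate T0) mxE.
    have uT : 0 <= Num.min (clamp T s) t <= t.
      rewrite ge_min lexx orbT andbT le_min; case/andP : tT => -> _.
      by case/andP : (clamp_itv T0 s) => ->.
    have uT' : 0 <= Num.min (clamp T s) t <= T.
      by case/andP : uT => -> /le_trans; apply; case/andP : tT.
    have mxi : measurable_fun [set: Eu] (xi : E -> Rd R d).
      by move=> _ C mC; rewrite setTI; apply: sub_sigma_algebra; left; exists C.
    have mB : measurable_fun [set: Eu] (fun e => X (Num.min (clamp T s) t) (B e)).
      move=> _ C mC; rewrite setTI; apply: sub_sigma_algebra; right.
      by exists (Num.min (clamp T s) t), C.
    apply: measurable_funD; first exact: (measurableT_comp (measurable_coord c) mxi).
    under eq_fun do rewrite -(XE _ uT').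
    exact: (measurableT_comp (measurable_coord c) mB).
  have := measurableT_comp (measurable_X t) (measurableT_comp mZ ms).
  move=> /(_ measurableT _ mA); rewrite setTI.
  congr (<<s _ >> _); apply/seteqP; split => e /=; rewrite !XE//= -(solution_stop _ fmP' ZE tT)//.
case: BB => B0 _; apply: filterS B0 => e B0 /=.
have X0 w : X 0 w = ev w 0 by rewrite XE// lexx ltW.
have T00 : 0 <= (0 : R) <= T by rewrite lexx ltW.
have Z0 : X 0 (Z (translate (xi e) (B e))) = xi e.
  rewrite X0 ZE (ev_flow T0 L0 GL lamE _ _ _ fmP' idl T00) (ev_translate T0) -X0 B0 addr0.
  rewrite (_ : \row_i _ = 0) ?scaler0 ?addr0//; apply/rowP => i; rewrite !mxE /tint clamp_id//.
  by rewrite set_itv1 Rintegral_set1.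
split => // t tT; split.
  move=> i; have dc : continuous (drift G P' id (Z (translate (xi e) (B e))) i).
    exact: (drift_continuous T0 L0 GL lamE fmP' idl).
  have := itv_integrable t dc; apply: eq_integrable => // s.
  rewrite inE/= in_itv/= => /andP[s0 st].
  have sT : 0 <= s <= T by rewrite s0 (le_trans st)//; case/andP : tT.
  by rewrite XE// interaction_drift.
rewrite Z0 !XE// ZE (ev_flow T0 L0 GL lamE _ _ _ fmP' idl tT) (ev_translate T0) scaleN1r -ZE.
rewrite addrAC; congr (_ - _ + _); apply/rowP => i; rewrite !mxE /tint clamp_id//.
apply: eq_Rintegral => s; rewrite inE/= in_itv/= => /andP[s0 st].
have sT : 0 <= s <= T by rewrite s0 (le_trans st)//; case/andP : tT.
by rewrite XE// interaction_drift.
Qed.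

End Solution.


(** * Calculus: a bounded Hessian gives a Lipschitz gradient *)

Section MeanValue.
Context {R : realType}.
Implicit Types (g : R -> R).

Lemma mean_value g (dg : R -> R) (a : R) : (forall s : R, is_derive s 1 g (dg s)) ->
  exists2 s, `|s| <= `|a| & g a - g 0 = a * dg s.
Proof.
move=> gd; have cg : continuous g.
  move=> s; apply/differentiable_continuous/derivable1_diffP.
  by case: (gd s).
have [a0|a0|->] := ltgtP a 0.
- have [c] := MVT a0 (fun x _ => gd x) (continuous_subspaceT cg).
  rewrite in_itv/= => /andP[ac c0] E; exists c.
    by rewrite !ler0_norm ?(ltW c0) ?(ltW a0)// lerN2 ltW.
  by rewrite -opprB E sub0r mulrN opprK mulrC.
- have [c] := MVT a0 (fun x _ => gd x) (continuous_subspaceT cg).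
  rewrite in_itv/= => /andP[c0 ca] E; exists c.
    by rewrite !gtr0_norm// ltW.
  by rewrite E subr0 mulrC.
- by exists 0 => //; rewrite subrr mul0r.
Qed.

End MeanValue.

Section Lines.
Context {R : realType} {d : nat}.
Implicit Types (f : 'rV[R]_d -> R) (x y u v : 'rV[R]_d).

Lemma is_derive_line f y v (s : R) : derivable f (y + s *: v) v ->
  is_derive s 1 (fun s => f (y + s *: v)) ('D_v f (y + s *: v)).
Proof.
pose g1 := fun h : R => h^-1 *: ((f \o shift (y + s *: v)) (h *: v) - f (y + s *: v)).
pose g2 := fun h : R => h^-1 *: (((fun s => f (y + s *: v)) \o shift s) (h *: (1 : R)) - f (y + s *: v)).
have E : g1 = g2.
  by apply/funext => h; rewrite /g1 /g2/= [_%:A]mulr1 scalerDl addrCA.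
by move=> fd; split; [rewrite /derivable -/g2 -E|rewrite /derive -/g2 -E].
Qed.

(** Coordinates are changed one at a time, with the mean value theorem on each. The induction is on
    a bound k for the nonzero coordinates of [u], each costing e / (d + 1) times |u|. *)
Lemma classC1_taylor f y (e : R) : classC1 f -> 0 < e ->
  exists2 c : R, 0 < c & forall u, `|u| < c ->
    `|f (y + u) - f y - \sum_i u 0 i * partial i f y| <= e * `|u|.
Proof.
move=> f1 e0; pose e' := e / d.+1%:R; have e'0 : 0 < e' by rewrite divr_gt0.
have [c c0 cP] : exists2 c : R, 0 < c & forall i z, `|z| < c -> `|partial i f (y + z) - partial i f y| <= e'.
  have H i : \forall z \near y, `|partial i f y - partial i f z| <= e'.
    by have /cvgrPdist_le/(_ _ e'0) := (f1 i).2 y.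
  have H2 : nbhs (y : 'rV[R]_d) [set z : 'rV[R]_d | forall i, `|partial i f y - partial i f z| <= e'].
    exact: (@filter_forall _ _ _ _ (nbhs_filter y)).
  have /nbhs_ballP[c /= c0 cP] := H2; exists c => // i z zc.
  rewrite distrC; apply: cP; rewrite -ball_normE /ball_/= opprD addrA subrr sub0r normrN//.
exists c => // u uc.
suff H k : forall u, `|u| < c -> (forall i : 'I_d, (k <= i)%N -> u 0 i = 0) ->
    `|f (y + u) - f y - \sum_i u 0 i * partial i f y| <= k%:R * e' * `|u|.
  apply: (le_trans (H d u uc _)); first by move=> i; rewrite leqNgt ltn_ord.
  rewrite ler_wpM2r// /e' mulrC mulrAC ler_pdivrMr// ler_wpM2l ?(ltW e0)// ler_nat//.
elim: k {u uc} => [|k IH] u uc u0.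
  have -> : u = 0 by apply/rowP => i; rewrite mxE u0.
  by rewrite addr0 subrr sub0r normrN normr0 mulr0 big1 ?normr0// => i _; rewrite mxE mul0r.
have [kd|dk] := ltnP k d; last first.
  apply: (le_trans (IH u uc _)); first by move=> i ki; have := ltn_ord i; rewrite ltnNge (leq_trans dk).
  by rewrite ler_wpM2r// ler_wpM2r ?(ltW e'0)// ler_nat.
pose K := Ordinal kd; pose u' : 'rV[R]_d := \row_i (if i == K then 0 else u 0 i).
have uE : u = u' + u 0 K *: delta_mx 0 K.
  apply/rowP => i; rewrite !mxE eqxx/=; have [->|iK] := eqVneq i K; first by rewrite mulr1 add0r.
  by rewrite mulr0 addr0.
have u'u s : `|s| <= `|u 0 K| -> `|u' + s *: delta_mx 0 K| <= `|u|.
  move=> su; apply: rV_norm_le => // i; rewrite !mxE eqxx/=.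
  case: eqVneq => [_|iK]; first by rewrite mulr1 add0r (le_trans su)// rV_coord_le.
  by rewrite mulr0 addr0 rV_coord_le.
have u'u0 : `|u'| <= `|u| by have := u'u 0; rewrite normr0 scale0r addr0; apply.
have [s su sE] := @mean_value R (fun s => f (y + u' + s *: delta_mx 0 K)) _ (u 0 K)
  (fun s => is_derive_line ((f1 K).1 (y + u' + s *: delta_mx 0 K))).
have h1 := IH u' (le_lt_trans u'u0 uc) _.
have {}h1 : `|f (y + u') - f y - \sum_i u' 0 i * partial i f y| <= k%:R * e' * `|u|.
  apply: (le_trans (h1 _)).
    move=> i ki; rewrite mxE; case: eqVneq => // iK; apply: u0; rewrite ltn_neqAle ki andbT.
    by apply: contra_neq iK => iK; apply/val_inj.
  by rewrite ler_wpM2l// mulr_ge0 ?(ltW e'0).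
have h2 : `|u 0 K * (partial K f (y + u' + s *: delta_mx 0 K) - partial K f y)| <= e' * `|u|.
  rewrite normrM mulrC; apply: ler_pM => //; last exact: rV_coord_le.
  by rewrite -addrA; apply: cP; apply: le_lt_trans uc; exact: u'u.
have sumE : \sum_i u 0 i * partial i f y = \sum_i u' 0 i * partial i f y + u 0 K * partial K f y.
  rewrite (bigD1 K)//= [in RHS](bigD1 K)//= mxE eqxx mul0r add0r addrC; congr (_ + _).
  by apply: eq_bigr => i iK; rewrite mxE (negPf iK).
rewrite scale0r addr0 -addrA -uE in sE.
have -> : f (y + u) - f y - \sum_i u 0 i * partial i f y =
   (f (y + u') - f y - \sum_i u' 0 i * partial i f y) +
   u 0 K * (partial K f (y + u' + s *: delta_mx 0 K) - partial K f y).
  by rewrite sumE mulrBr -sE; ring.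
rewrite (le_trans (ler_normD _ _))// -natr1 !mulrDl mul1r; exact: lerD.
Qed.

Lemma classC1_derive f y v : classC1 f ->
  derivable f y v /\ 'D_v f y = \sum_i v 0 i * partial i f y.
Proof.
move=> f1; set S := \sum_i _.
have H : (fun h : R => h^-1 *: ((f \o shift y) (h *: v) - f y)) @ 0^' --> S.
  apply/cvgrPdist_le => e e0; have e1 : 0 < e / (`|v| + 1) by rewrite divr_gt0// ltr_wpDl.
  have [c c0 cP] := classC1_taylor y f1 e1.
  have cv : 0 < c / (`|v| + 1) by rewrite divr_gt0// ltr_wpDl.
  have v1 : 0 < `|v| + 1 by rewrite ltr_wpDl.
  exists (c / (`|v| + 1)) => //= h /=; rewrite sub0r normrN => hc h0.
  have hv : `|h *: v| < c.
    rewrite normrZ; rewrite ltr_pdivlMr// in hc; apply: le_lt_trans hc.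
    by rewrite ler_wpM2l// lerDl.
  have := cP _ hv; rewrite (addrC y).
  have -> : \sum_i (h *: v) 0 i * partial i f y = h * S.
    by rewrite /S mulr_sumr; apply: eq_bigr => i _; rewrite mxE mulrA.
  have -> : S - h^-1 *: (f (h *: v + y) - f y) = - (h^-1 * (f (h *: v + y) - f y - h * S)).
    by rewrite [_ *: _]/(_ * _) mulrBr mulrA mulVf// mul1r opprB.
  rewrite normrN normrM normfV normrZ mulrCA => le1.
  rewrite mulrC ler_pdivrMr ?normr_gt0//; apply: (le_trans le1).
  rewrite mulrC ler_wpM2r// mulrAC ler_pdivrMr// ler_wpM2l ?(ltW e0)// lerDl//.
by split; [apply/cvg_ex; exists S|exact: cvg_lim].
Qed.

Lemma classC1_line f y v (s : R) : classC1 f ->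
  is_derive s 1 (fun s : R => f (y + s *: v)) (\sum_i v 0 i * partial i f (y + s *: v)).
Proof.
by move=> f1; have [df <-] := classC1_derive (y + s *: v) v f1; exact: is_derive_line.
Qed.

End Lines.

Section GradientLipschitz.
Context {R : realType} {d : nat}.
Variables (W : 'rV[R]_d -> R) (K : R).
Hypothesis W2 : classC2 W.
Hypothesis hessK : forall z (v : 'rV[R]_d), `|(v *m hessian W z *m v^T) 0 0| <= K * `|v| ^+ 2.

Let lin (x v : 'rV[R]_d) : R := \sum_i v 0 i * partial i W x.

(** The mean value theorem twice along the segment from x to x + v. *)
Lemma second_order x v : `|W (x + v) - W x - lin x v| <= K * `|v| ^+ 2.
Proof.
have [W1 pW] := W2.
have [s1 s1le E1] := mean_value 1 (fun s => classC1_line x v s W1).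
have d2 (s : R) : is_derive s 1 (fun s : R => lin (x + s *: v) v) ((v *m hessian W (x + s *: v) *m v^T) 0 0).
  have dj j : is_derive s 1 (fun s : R => v 0 j * partial j W (x + s *: v))
      (v 0 j * \sum_i v 0 i * partial i (partial j W) (x + s *: v)).
    by have := is_deriveZ (v 0 j) (classC1_line x v s (pW j)).
  have -> : (fun s : R => lin (x + s *: v) v) = \sum_j (fun s : R => v 0 j * partial j W (x + s *: v)).
    by apply/funext => r; rewrite fct_sumE.
  have -> : (v *m hessian W (x + s *: v) *m v^T) 0 0 =
      \sum_j (v 0 j * \sum_i v 0 i * partial i (partial j W) (x + s *: v)).
    rewrite mxE; apply: eq_bigr => j _; rewrite !mxE mulrC; congr (_ * _).
    by apply: eq_bigr => i _; rewrite mxE.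
  exact: is_derive_sum.
have [s2 s2le E2] := mean_value s1 d2.
rewrite scale1r scale0r addr0 mul1r in E1; rewrite scale0r addr0 in E2.
rewrite E1 -/(lin _ _) E2 normrM; apply: le_trans (hessK (x + s2 *: v) v).
by rewrite ler_piMl//; move: s1le; rewrite normr1.
Qed.

(** With v = x - y and e = |v| times the i-th unit vector, compare the expansions at y + v along e,
    at y along v + e and at y along v. The values of [W] cancel, leaving |v| times the difference of
    partial derivatives, bounded by K (1 + 4 + 1) |v|^2. Only the quadratic form of the Hessian
    enters. *)
Lemma partial_lipschitz i x y : `|partial i W x - partial i W y| <= (6 * K + 1) * `|x - y|.
Proof.
pose v := x - y; have -> : x = y + v by rewrite addrC subrK.
rewrite addrAC subrr add0r; have [->|v0] := eqVneq v 0.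
  by rewrite addr0 subrr !normr0 mulr0.
have n0 : 0 < `|v| by rewrite normr_gt0.
have K0 : 0 <= K.
  by have := le_trans (normr_ge0 _) (hessK y v); rewrite pmulr_lge0// exprn_gt0.
pose s := `|v|; pose e : 'rV[R]_d := s *: delta_mx 0 i.
have ne : `|e| <= s.
  rewrite normrZ normr_id ler_piMr//; apply: rV_norm_le => // j; rewrite !mxE eqxx/=.
  by case: (_ == _); rewrite ?normr1 ?normr0.
have line z : lin z e = s * partial i W z.
  rewrite /lin (bigD1 i)//= !mxE !eqxx mulr1 big1 ?addr0// => j ji.
  by rewrite !mxE eqxx (negPf ji) mulr0 mul0r.
have h1 := second_order (y + v) e; have h2 := second_order y (v + e); have h3 := second_order y v.
have linD : lin y (v + e) = lin y v + lin y e.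
  by rewrite /lin -big_split/=; apply: eq_bigr => j _; rewrite mxE mulrDl.
have b1 : K * `|e| ^+ 2 <= K * s ^+ 2 by rewrite ler_wpM2l// ler_sqr ?nnegrE ?normr_ge0.
have b2 : K * `|v + e| ^+ 2 <= K * (4 * s ^+ 2).
  apply: ler_wpM2l => //; have -> : 4 * s ^+ 2 = (s + s) ^+ 2 by ring.
  have s0 : 0 <= s by exact: normr_ge0.
  rewrite ler_sqr ?nnegrE ?normr_ge0 ?addr_ge0//.
  by rewrite (le_trans (ler_normD _ _))// lerD2l.
rewrite -/s; rewrite linD !line in h2; rewrite line in h1; rewrite addrA in h2.
have : `|s * partial i W (y + v) - s * partial i W y| <= 6 * K * s ^+ 2.
  rewrite -/s in h3.
  have {}h1 := le_trans h1 b1; have {}h2 := le_trans h2 b2; clear b1 b2.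
  move: h1 h2 h3; rewrite !ler_norml.
  move: (W (y + v + e)) (W (y + v)) (W y) (lin y v) (s * partial i W (y + v)) (s * partial i W y) => w1 w2 w3 l a b.
  move=> /andP[a1 a2] /andP[b1 b2] /andP[c1 c2].
  rewrite -[6 * K * _]mulrA; move: (s ^+ 2) a1 a2 b1 b2 c1 c2 => q.
  rewrite (mulrCA K 4); move: (K * q) => q' *; apply/andP; split; lra.
rewrite -mulrBr normrM normr_id expr2 mulrA -/s (mulrC s) ler_pM2r// => /le_trans; apply.
by rewrite ler_wpM2r ?(ltW n0)// lerDl.
Qed.

End GradientLipschitz.


(** * Euclidean norm against sup norm *)

Section EuclideanNorm.
Context {R : realType} {d : nat}.
Implicit Types (x v : 'rV[R]_d) (W : 'rV[R]_d -> R).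

Lemma enorm_ge0 x : 0 <= enorm x. Proof. exact: sqrtr_ge0. Qed.

Lemma enorm_sqr x : enorm x ^+ 2 = \sum_i x 0 i ^+ 2.
Proof. by rewrite sqr_sqrtr// sumr_ge0// => i _; exact: sqr_ge0. Qed.

Lemma norm_le_enorm x : `|x| <= enorm x.
Proof.
apply: rV_norm_le => [|i]; first exact: enorm_ge0.
rewrite -ler_sqr ?nnegrE ?enorm_ge0// enorm_sqr real_normK ?num_real//.
by rewrite (bigD1 i)//= lerDl sumr_ge0// => j _; exact: sqr_ge0.
Qed.

Lemma enorm_le_norm x : enorm x ^+ 2 <= d%:R * `|x| ^+ 2.
Proof.
rewrite enorm_sqr -[d in d%:R]card_ord mulr_natl -sumr_const; apply: ler_sum => i _.
by rewrite -real_normK ?num_real// ler_sqr ?nnegrE// rV_coord_le.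
Qed.

Lemma enorm_le x : enorm x <= (d%:R + 1) * `|x|.
Proof.
rewrite -ler_sqr ?nnegrE ?enorm_ge0 ?mulr_ge0 ?addr_ge0//.
apply: (le_trans (enorm_le_norm x)); rewrite exprMn ler_wpM2r ?sqr_ge0//.
have d0 : 0 <= d%:R :> R by [].
move: d0; move: (d%:R : R) => a a0; rewrite sqrrD1; have := sqr_ge0 a; lra.
Qed.

Lemma enormZ (c : R) x : 0 <= c -> enorm (c *: x) = c * enorm x.
Proof.
move=> c0; rewrite /enorm; under eq_bigr do rewrite mxE exprMn.
by rewrite -mulr_sumr sqrtrM ?sqr_ge0// sqrtr_sqr ger0_norm.
Qed.

Lemma hessian_bound W :
  (ereal_sup [set (`|(v *m hessian W z *m v^T) 0 0|%R)%:E
     | z in [set: 'rV[R]_d] & v in [set v | enorm v = 1%R]] < +oo)%E ->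
  exists K : R, forall z v, `|(v *m hessian W z *m v^T) 0 0| <= K * `|v| ^+ 2.
Proof.
set S := (X in ereal_sup X) => Soo.
have [K KP] : exists K : R, (ereal_sup S <= K%:E)%E.
  by move: Soo; case: (ereal_sup S) => [r| |]// _; [exists r|exists 0; rewrite leNye].
(* The quadratic form is homogeneous of degree 2, and the squared Euclidean norm is at most d times
   the squared sup norm. *)
exists (`|K| * d%:R) => z v.
have [->|v0] := eqVneq v 0; first by rewrite !mul0mx mxE normr0 !mulr_ge0 ?sqr_ge0.
have e0 : 0 < enorm v by rewrite (lt_le_trans _ (norm_le_enorm v))// normr_gt0.
have [n [u [n0 u1 ->]]] : exists n u, [/\ 0 <= n, enorm u = 1 & v = n *: u].
  exists (enorm v), ((enorm v)^-1 *: v); split; first exact: enorm_ge0.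
    by rewrite enormZ ?invr_ge0 ?enorm_ge0// mulVf// gt_eqF.
  by rewrite scalerA divff ?gt_eqF// scale1r.
rewrite linearZ/= -!scalemxAl -scalemxAr !mxE.
rewrite mulrA -expr2 normrM ger0_norm ?sqr_ge0//.
have uK : `|\sum_j (u *m hessian W z) 0 j * u^T j 0| <= K.
  rewrite -lee_fin; apply: le_trans KP; apply: ereal_sup_ubound.
  by exists z => //; exists u => //; rewrite mxE.
have nd : n ^+ 2 <= d%:R * `|n *: u| ^+ 2.
  by apply: (le_trans _ (enorm_le_norm _)); rewrite enormZ// u1 mulr1.
rewrite [leLHS]mulrC -[leRHS]mulrA; apply: ler_pM => //; first exact: sqr_ge0.
by rewrite (le_trans uK)// ler_norm.
Qed.

End EuclideanNorm.

(** No measurability is asked: the integral of a nonnegative function is a supremum over simple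
    functions below it. This is how [sup_norm] is compared. *)
Lemma ge0_le_integralT dsp (E : measurableType dsp) (R : realType)
    (mu : {measure set E -> \bar R}) (f g : E -> \bar R) :
  (forall x, 0 <= f x)%E -> (forall x, f x <= g x)%E ->
  (\int[mu]_x f x <= \int[mu]_x g x)%E.
Proof.
move=> f0 fg; rewrite !ge0_integralTE//; last by move=> x; exact: le_trans (f0 x) (fg x).
apply: le_ereal_sup => _ [h hf <-]; exists h => // x; exact: le_trans (hf x) (fg x).
Qed.

(** * The class P1 as a first moment of the weighted distance *)

Section Moments.
Context {R : realType} {T : R} {d : nat}.
Hypothesis T0 : 0 < T.
Variables (L lam : R).
Hypothesis L0 : 0 < L.
Hypothesis lamE : lam = 8 * L.
Implicit Types (w : Omega R T d) (P : probability (Omega R T d) R).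

Let lam_ge0 : 0 <= lam. Proof. by rewrite lamE mulr_ge0 ?(ltW L0). Qed.

Lemma wd_le_sup_norm w : ((wd lam w point)%:E <= sup_norm w)%E.
Proof.
have ub t : 0 <= t <= T -> ((`|ev w t|)%:E <= sup_norm w)%E.
  move=> tT; apply: (@le_trans _ _ (enorm (X t w))%:E).
    by rewrite lee_fin -XE// norm_le_enorm.
  by apply: ereal_sup_ubound; exists t => //=; rewrite in_itv.
have ub0 : (0 <= sup_norm w)%E.
  have T00 : 0 <= (0 : R) <= T by rewrite lexx ltW.
  by apply: le_trans (ub 0 T00); rewrite lee_fin.
move: ub ub0; case: (sup_norm w) => [r| |] ub // r0; last by rewrite leey.
rewrite lee_fin; apply: wd_le => // t tT; rewrite ev_point subr0.
rewrite -lee_fin (le_trans (ub t tT))// lee_fin ler_peMl//.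
by rewrite -[leLHS]expR0 ler_expR mulr_ge0//; case/andP : tT.
Qed.

Lemma sup_norm_le w : (sup_norm w <= ((d%:R + 1) * expR (lam * T) * wd lam w point)%:E)%E.
Proof.
apply: ge_ereal_sup => _ [t /= tT <-]; rewrite in_itv/= in tT.
rewrite lee_fin (le_trans (enorm_le _))// -mulrA ler_wpM2l ?addr_ge0// XE//.
exact: (ev_wd0 T0 L0 lamE).
Qed.

Lemma class_P1_first_moment P : class_P1 P <-> first_moment lam P.
Proof.
have wd0 w : 0 <= wd lam w point by exact: wd_ge0.
have mwd : measurable_fun setT (fun w : Omega R T d => wd lam w point) by exact: measurable_wd.
split => [P1|fm].
  apply: finite_ge0_integrable => //; apply: le_lt_trans P1.
  by apply: ge0_le_integralT => w; [rewrite lee_fin|exact: wd_le_sup_norm].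
apply: (@le_lt_trans _ _ (\int[P]_w ((d%:R + 1) * expR (lam * T) * wd lam w point)%:E)%E).
  apply: ge0_le_integralT => w; last exact: sup_norm_le.
  by apply: le_trans (wd_le_sup_norm w); rewrite lee_fin.
have c0 : 0 <= (d%:R + 1) * expR (lam * T) by rewrite mulr_ge0 ?expR_ge0 ?addr_ge0.
under eq_integral do rewrite EFinM.
rewrite ge0_integralZl_EFin//; first last.
- exact/measurable_EFinP.
- by move=> w _; rewrite lee_fin.
have /integrableP[_] := fm.
rewrite (eq_integral (fun w => (wd lam w point)%:E)); last by move=> w _ /=; rewrite ger0_norm.
by move=> fi; rewrite lte_mul_pinfty.
Qed.

End Moments.


(** * Lipschitz test functions determine a measure *)

Section Distance.
Context {R : realType} {d : nat}.
Variable U : set 'rV[R]_d.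
Hypothesis U_proper : exists y, ~ U y.
Implicit Types x y : 'rV[R]_d.

Let dset x : set R := [set `|x - y| | y in ~` U].
Definition dist_compl x : R := inf (dset x).

Let dset_inf x : has_inf (dset x).
Proof.
case: U_proper => y Uy; split; first by exists `|x - y|, y.
by exists 0 => _ [z _ <-].
Qed.

Lemma dist_compl_ge0 x : 0 <= dist_compl x.
Proof. by apply: lb_le_inf; [case: (dset_inf x)|move=> _ [z _ <-]]. Qed.

Lemma dist_compl_lip x y : `|dist_compl x - dist_compl y| <= `|x - y|.
Proof.
have half u v : dist_compl u - `|u - v| <= dist_compl v.
  apply: lb_le_inf; first by case: (dset_inf v).
  move=> _ [z Uz <-]; rewrite lerBlDr; apply: (@le_trans _ _ `|u - z|).
    by apply: ge_inf; [case: (dset_inf u)|exists z].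
  have := ler_normD (u - v) (v - z); rewrite subrKA.
  by rewrite [X in _ <= X -> _]addrC.
have h1 := half x y; have h2 := half y x; rewrite distrC in h2.
by rewrite ler_norml; move: h1 h2; move: (dist_compl x) (dist_compl y) `|x - y| => a b c *;
  apply/andP; split; lra.
Qed.

Lemma dist_compl_gt0 x : open U -> (0 < dist_compl x) <-> U x.
Proof.
move=> oU; split => [x0|Ux].
  apply: contrapT => nUx; move: x0; apply/negP; rewrite -leNgt.
  apply: ge_inf; first by case: (dset_inf x).
  by exists x => //; rewrite subrr normr0.
have /nbhs_ballP[e /= e0 eU] : nbhs (x : 'rV[R]_d) U by apply: open_nbhs_nbhs; split.
apply: (lt_le_trans e0); apply: lb_le_inf; first by case: (dset_inf x).
move=> _ [z nUz <-]; rewrite leNgt; apply/negP => xz; apply: nUz; apply: eU.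
by rewrite -ball_normE.
Qed.

End Distance.

Section LipschitzTest.
Context {R : realType} {d : nat}.
Implicit Types (mu nu : probability (Rd R d) R) (f : 'rV[R]_d -> R).

Let ramp (D : R) (k : nat) : R := Num.min 1 (k%:R * D).

Let ramp_itv D k : 0 <= D -> 0 <= ramp D k <= 1.
Proof. by move=> D0; rewrite /ramp le_min ler01 mulr_ge0//= ge_min lexx. Qed.

Let ramp_cvg D : 0 <= D -> ramp D k @[k --> \oo] --> (if 0 < D then 1 else 0 : R).
Proof.
move=> D0; case: ltP => [{}D0|D0'].
  apply: cvg_near_cst; have [n _ nP] := near_infty_natSinv_lt (PosNum D0).
  exists n.+1 => // k /= nk; rewrite /ramp min_l//.
  have := nP n (leqnn n); rewrite /= => nD.
  have : n.+1%:R * D <= k%:R * D by rewrite ler_wpM2r ?(ltW D0)// ler_nat.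
  apply: le_trans; rewrite mulrC -ler_pdivrMr// div1r; exact: ltW.
have -> : D = 0 by apply/eqP; rewrite eq_le D0 D0'.
by under eq_fun do rewrite /ramp mulr0 min_r//; exact: cvg_cst.
Qed.

Let ramp_lip D D' k : `|ramp D k - ramp D' k| <= k%:R * `|D - D'|.
Proof.
have -> : k%:R * `|D - D'| = `|k%:R * D - k%:R * D'| by rewrite -mulrBr normrM ger0_norm.
rewrite /ramp.
move: (k%:R * D) (k%:R * D') => a b; rewrite ler_norml.
have := ler_norm (a - b); have := ler_norm (b - a); rewrite distrC.
by case: (leP 1 a) => h1; case: (leP 1 b) => h2 h3 h4; apply/andP; split; lra.
Qed.

(** The indicator of an open set U is the limit of min (1, k dist(x, complement of U)), so the
    measures agree on open sets, a pi-system generating the Borel sets. *)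
Lemma measure_eq_lipschitz mu nu :
  (forall f (K : R), (forall x y, `|f x - f y| <= K * `|x - y|) -> (forall x, 0 <= f x <= 1) ->
     \int[mu]_x f x = \int[nu]_x f x) ->
  forall A, measurable A -> mu A = nu A.
Proof.
move=> fE; have opens U : open U -> mu U = nu U.
  move=> oU; have [UP|] := pselect (exists y, ~ U y); last first.
    move=> nU; have -> : U = setT.
      by apply/seteqP; split => // x _; apply: contrapT => Ux; apply: nU; exists x.
    by rewrite !probability_setT.
  pose f k (x : 'rV[R]_d) := ramp (dist_compl U x) k.
  have fl k x y : `|f k x - f k y| <= (k%:R + 1) * `|x - y|.
    apply: (le_trans (ramp_lip _ _ _)).
    apply: (@le_trans _ _ (k%:R * `|x - y|)); last by rewrite ler_wpM2r// lerDl.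
    by rewrite ler_wpM2l// dist_compl_lip.
  have f01 k x : 0 <= f k x <= 1 by apply: ramp_itv; exact: dist_compl_ge0.
  have k1 (k : nat) : 0 < k%:R + 1 :> R by rewrite ltr_wpDl.
  have mf k : measurable_fun [set: Rd R d] (f k : Rd R d -> R).
    by apply: measurable_continuous_Rd; apply: (lipschitz_continuous (k1 k)); exact: fl.
  have lim (m : probability (Rd R d) R) : \int[m]_x f k x @[k --> \oo] --> fine (m U).
    have mU : measurable (U : set (Rd R d)) by exact: sub_sigma_algebra.
    have -> : fine (m U) = \int[m]_x (\1_U x : R).
      by rewrite /Rintegral integral_indic// setIT.
    apply: (dominated_cvg_Rintegral (g := fun=> 1)) => //.
    - move=> x _; have := ramp_cvg (dist_compl_ge0 UP x).
      rewrite indicE; case: ltP => [D0|D0].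
        by have/(dist_compl_gt0 UP x oU) Ux := D0; rewrite mem_set.
      rewrite memNset// => /(dist_compl_gt0 UP x oU); by rewrite ltNge D0.
    - exact: cst_integrable.
    - by move=> k x _; have /andP[a b] := f01 k x; rewrite ger0_norm.
  have E : fine (mu U) = fine (nu U).
    have fmn : (fun k => \int[mu]_x f k x) = (fun k => \int[nu]_x f k x).
      by apply/funext => k; apply: fE (fl k) (f01 k).
    have := lim mu; rewrite fmn => lmu.
    exact: (cvg_unique _ lmu (lim nu)).
  have mU : measurable (U : set (Rd R d)) by exact: sub_sigma_algebra.
  by rewrite -[LHS]fineK ?fin_num_measure// E fineK ?fin_num_measure.
have oI : setI_closed (@open 'rV[R]_d) by move=> U V oU oV; exact: openI.
have oT (k : nat) : @open 'rV[R]_d setT by exact: openT.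
have cover : \bigcup_(k in [set: nat]) [set: Rd R d] = setT by rewrite bigcup_const//; exists 0%N.
have fin (k : nat) : (mu setT < +oo)%E.
  by apply: (le_lt_trans (probability_le1 mu measurableT)); rewrite ltry.
exact: (@measure_unique _ R (Rd R d) (@open 'rV[R]_d) (fun=> setT) erefl oI oT cover mu nu opens fin).
Qed.

End LipschitzTest.


(** * Admissible laws, and solutions from finite cost *)

Lemma measurable_origin {R : realType} {d : nat} : measurable ([set (0 : 'rV[R]_d)] : set (Rd R d)).
Proof.
rewrite (_ : [set (0 : 'rV[R]_d)] = \bigcap_(i in [set: 'I_d]) (fun v : Rd R d => (v : 'rV[R]_d) 0 i) @^-1` [set 0]).
  apply: fin_bigcap_measurable => // i _; rewrite -[X in measurable X]setTI.
  exact: measurable_coord.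
apply/seteqP; split => v /=; first by move=> -> i _; rewrite /= mxE.
by move=> v0; apply/rowP => i; rewrite mxE; exact: v0.
Qed.

(** The origin lies in the hyperplane where the first coordinate vanishes. In dimension 0 the
    measure is a unit mass at the origin. *)
Lemma lebesgueRd_origin {R : realType} {d : nat} : (0 < d)%N -> lebesgueRd R d [set (0 : 'rV[R]_d)] = 0%E.
Proof.
case: d => // d _ /=; rewrite /lebesgue_step /pushforward.
have m0 : measurable ([set 0] : set R) by exact: measurable_set1.
apply/eqP; rewrite eq_le measure_ge0 andbT.
apply: (@le_trans _ _ ((@lebesgue_measure R \x lebesgueRd R d)%E ([set 0] `*` setT))).
  apply: le_measure; rewrite ?inE.
  - by rewrite -[X in measurable X]setTI; apply: measurable_consR => //; exact: measurable_origin.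
  - exact: measurableX.
  - move=> [a v] /= /rowP/(_ ord0); rewrite /consR !mxE unlift_none/= => ->; split => //.
have l0 : @lebesgue_measure R [set 0] = 0%E by exact: lebesgue_measure_set1.
by rewrite product_measure1E// [X in (X * _)%E]l0 mul0e.
Qed.

Lemma not_concentrated {R : realType} {d : nat} (mu : probability (Rd R d) R) : (0 < d)%N ->
  mu `<< lebesgueRd R d -> mu (~` [set (0 : 'rV[R]_d)]) != 0%E.
Proof.
move=> d0 ac; apply/eqP => muC; have mO := @measurable_origin R d.
have mu0 : mu [set (0 : 'rV[R]_d)] = 0%E.
  by have /null_content_dominatesP := ac; apply => //; exact: lebesgueRd_origin.
have := probability_setT mu; rewrite -(setUv [set (0 : 'rV[R]_d)]) measureU//; last 2 first.
- exact: measurableC.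
- exact: setICr.
rewrite [X in (_ + X)%E]muC [X in (X + _)%E]mu0 adde0 => /eqP; by rewrite eq_sym onee_eq0.
Qed.

Section Admissible.
Context {R : realType} {T : R} {d : nat}.
Hypothesis T0 : 0 < T.
Variables (W : 'rV[R]_d -> R) (mu_in mu_fin : probability (Rd R d) R).
Implicit Types (w : Omega R T d) (P : probability (Omega R T d) R).

Lemma solution_law_Gamma P : (exists Q, solution_law W mu_in P Q) ->
  solution_law W mu_in P (Gamma W mu_in P).
Proof. by move=> QP; rewrite /Gamma; case: pselect => // H; exact: projT2 (cid H). Qed.

(** Without a solution [Gamma] is the Dirac mass at the zero path; finite cost would then put all of
    [mu_in] at the origin, against its absolute continuity. *)
Lemma finite_cost_solution P : (0 < d)%N -> (free_energy W mu_in < +oo)%E ->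
  admissible mu_in mu_fin P -> (cost W mu_in P < +oo)%E -> exists Q, solution_law W mu_in P Q.
Proof.
move=> d0 Fin [_ P0 _]; have ac : mu_in `<< lebesgueRd R d.
  by move: Fin; rewrite /free_energy; case: ifPn => // /asboolP.
rewrite /cost /rel_entropy; case: ifPn => // /asboolP /null_content_dominatesP PG _.
apply: contrapT => nQ; have := not_concentrated d0 ac; apply/negP; rewrite negbK; apply/eqP.
have mO : measurable (~` [set (0 : 'rV[R]_d)] : set (Rd R d)) by apply: measurableC; exact: measurable_origin.
have mS : measurable (X 0 @^-1` (~` [set (0 : 'rV[R]_d)]) : set (Omega R T d)).
  by rewrite -[X in measurable X]setTI; exact: measurable_X.
rewrite -P0//; apply: PG => //; rewrite /Gamma; case: pselect => //= _.
rewrite diracE memNset//= => /=; apply; rewrite XE ?ev_point//; first by rewrite lexx ltW.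
Qed.

Lemma second_moment_norm (mu : probability (Rd R d) R) : second_moment_finite mu ->
  (\int[mu]_x (`|x : 'rV[R]_d|)%:E < +oo)%E.
Proof.
move=> m2; have mn : measurable_fun [set: Rd R d] (fun x : Rd R d => `|x : 'rV[R]_d|).
  apply: measurable_continuous_Rd; exact: norm_continuous.
apply: (@le_lt_trans _ _ (\int[mu]_x (1 + (enorm x ^+ 2)%:E))%E).
  apply: ge0_le_integralT => x; first by rewrite lee_fin.
  rewrite -EFinD lee_fin; have := norm_le_enorm x; have := sqr_ge0 (enorm x - 1).
  by rewrite sqrrB1; have := sqr_ge0 (enorm x); lra.
have me : measurable_fun [set: Rd R d] (fun x : Rd R d => enorm x ^+ 2 : R).
  rewrite (_ : (fun x => _) = (fun x : Rd R d => \sum_i (x : 'rV[R]_d) 0 i ^+ 2)); last first.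
    by apply/funext => x; rewrite enorm_sqr.
  by apply: measurable_sum => i; apply: measurable_funX; exact: measurable_coord.
rewrite ge0_integralD//; first last.
- by apply/measurable_EFinP.
- by move=> x _; rewrite lee_fin sqr_ge0.
have i1 : (\int[mu]_x 1 = 1)%E by rewrite integral_cst// [X in (_ * X)%E](probability_setT mu) mule1.
by rewrite i1 lte_add_pinfty// ltry.
Qed.

(** Straight lines between independent endpoints drawn from [mu_in] and [mu_fin]. *)
Lemma admissible_exists : second_moment_finite mu_in -> second_moment_finite mu_fin ->
  exists P, admissible mu_in mu_fin P.
Proof.
move=> /second_moment_norm m_in /second_moment_norm m_fin.
pose mm := (mu_in \x mu_fin)%E.
have mmT : mm setT = 1%E.
  have := product_measure1E mu_in mu_fin measurableT measurableT.
  by rewrite setXTT [X in (X * _)%E](probability_setT mu_in) [X in (_ * X)%E](probability_setT mu_fin) mule1.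
pose Pr : probability (Rd R d * Rd R d)%type R :=
  HB.pack mm (Measure_isProbability.Build _ _ _ mm mmT).
pose g (t : R) : R := clamp T t / T.
have g0 : g 0 = 0 by rewrite /g clamp_id ?mul0r// lexx ltW.
have gT : g T = 1 by rewrite /g clamp_id ?divff ?gt_eqF// lexx ltW.
have g01 t : 0 <= g t <= 1.
  have /andP[a b] := clamp_itv T0 t.
  by rewrite /g divr_ge0 ?(ltW T0)//= ler_pdivrMr// mul1r.
have cg : continuous g by move=> t; apply: cvgMl; exact: clamp_continuous.
pose path (e : Rd R d * Rd R d) : Omega R T d :=
  mkpath (fun t => (1 - g t) *: (e.1 : 'rV[R]_d) + g t *: (e.2 : 'rV[R]_d)).
have evp e t : ev (path e) t = (1 - g t) *: (e.1 : 'rV[R]_d) + g t *: (e.2 : 'rV[R]_d).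
  rewrite ev_mkpath /g ?clampK// => s; apply: cvgD.
    by apply: cvgZl; apply: cvgB; [exact: cvg_cst|exact: cg].
  by apply: cvgZl; exact: cg.
have mpath : measurable_fun setT path.
  apply: (measurable_path T0) => t c tT; under eq_fun do rewrite evp !mxE.
  apply: measurable_funD; apply: measurable_funM => //.
    exact: (measurableT_comp (measurable_coord c) measurable_fst).
  exact: (measurableT_comp (measurable_coord c) measurable_snd).
have [P PP] := has_law_distribution Pr mpath.
have T00 : 0 <= (0 : R) <= T by rewrite lexx ltW.
have TT : 0 <= T <= T by rewrite lexx ltW.
exists P; split.
- apply/(class_P1_first_moment T0 ltr01 (erefl _)).
  have mn : measurable_fun [set: Rd R d] (fun x : Rd R d => `|x : 'rV[R]_d|).
    by apply: measurable_continuous_Rd; exact: norm_continuous.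
  have law1 : has_law fst Pr mu_in.
    move=> A mA; rewrite (_ : fst @^-1` A = A `*` setT); last by apply/seteqP; split => e //= [].
    by rewrite [RHS]product_measure1E// [X in (_ * X)%E](probability_setT mu_fin) mule1.
  have law2 : has_law snd Pr mu_fin.
    move=> A mA; rewrite (_ : snd @^-1` A = setT `*` A); last by apply/seteqP; split => e //= [].
    by rewrite [RHS]product_measure1E// [X in (X * _)%E](probability_setT mu_in) mul1e.
  have i1 : Pr.-integrable setT (EFin \o (fun e : Rd R d * Rd R d => `|e.1 : 'rV[R]_d|)).
    apply: finite_ge0_integrable => //; first exact: (measurableT_comp mn measurable_fst).
    move: m_in; rewrite (ge0_integral_law measurable_fst law1)//; exact/measurable_EFinP.
  have i2 : Pr.-integrable setT (EFin \o (fun e : Rd R d * Rd R d => `|e.2 : 'rV[R]_d|)).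
    apply: finite_ge0_integrable => //; first exact: (measurableT_comp mn measurable_snd).
    move: m_fin; rewrite (ge0_integral_law measurable_snd law2)//; exact/measurable_EFinP.
  have mwd : measurable_fun setT (fun w : Omega R T d => wd (8 * 1) w point) by exact: measurable_wd.
  rewrite /first_moment; apply: (integrable_law mpath PP mwd).
  have i12 : Pr.-integrable setT (EFin \o (fun e => `|e.1 : 'rV[R]_d| + `|e.2 : 'rV[R]_d|)).
    exact: (integrableD measurableT i1 i2).
  apply: (dominated_integrable measurableT (measurableT_comp mwd mpath) _ i12) => e _.
  rewrite /= ger0_norm ?wd_ge0//; apply: wd_le => // t /andP[t0 tT].
  rewrite ev_point subr0 evp; have /andP[a0 a1] := g01 t.
  apply: (@le_trans _ _ (`|e.1 : 'rV[R]_d| + `|e.2 : 'rV[R]_d|)).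
    apply: (le_trans (ler_normD _ _)); rewrite !(normrZ (1 - g t)) !(normrZ (g t)); apply: lerD; apply: ler_piMl => //.
      by rewrite ger0_norm ?subr_ge0// gerBl.
    by rewrite (ger0_norm a0).
  by rewrite ler_peMl ?addr_ge0// -(@expR0 R) ler_expR !mulr_ge0.
- move=> A mA; have mXA : measurable (X 0 @^-1` A : set (Omega R T d)).
    by rewrite -[X in measurable X]setTI; exact: measurable_X.
  apply: etrans (PP _ mXA) _.
  have -> : path @^-1` (X 0 @^-1` A) = A `*` setT.
    apply/seteqP; split => e /=; rewrite XE// evp g0 subr0 scale1r scale0r addr0//.
    by case.
  by rewrite [LHS]product_measure1E// [X in (_ * X)%E](probability_setT mu_fin) mule1.
- move=> A mA; have mXA : measurable (X T @^-1` A : set (Omega R T d)).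
    by rewrite -[X in measurable X]setTI; exact: measurable_X.
  apply: etrans (PP _ mXA) _.
  have -> : path @^-1` (X T @^-1` A) = setT `*` A.
    apply/seteqP; split => e /=; rewrite XE// evp gT subrr scale0r scale1r add0r//.
    by case.
  by rewrite [LHS]product_measure1E// [X in (X * _)%E](probability_setT mu_in) mul1e.
Qed.
End Admissible.


(** * Limits of minimising sequences *)

Section Existence.
Context {R : realType} {T : R} {d : nat}.
Hypothesis T0 : 0 < T.
Hypothesis d0 : (0 < d)%N.
Variables (W : 'rV[R]_d -> R) (G : 'I_d -> 'rV[R]_d -> R) (L lam : R).
Hypothesis GE : forall i x, grad W x 0 i = G i x.
Hypothesis L0 : 0 < L.
Hypothesis GL : forall i x y, `|G i x - G i y| <= L * `|x - y|.
Hypothesis lamE : lam = 8 * L.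
Variables (mu_in mu_fin : probability (Rd R d) R).
Hypothesis hin2 : second_moment_finite mu_in.
Hypothesis hinF : (free_energy W mu_in < +oo)%E.
Implicit Types (w v y : Omega R T d) (P Q : probability (Omega R T d) R).

Let lam_ge0 : 0 <= lam. Proof. by rewrite lamE mulr_ge0 ?(ltW L0). Qed.
Let idl : lipmap (T := T) (d := d) lam 1 id := lipmap_id lam.
Let T00 : 0 <= (0 : R) <= T. Proof. by rewrite lexx ltW. Qed.
Let TT : 0 <= T <= T. Proof. by rewrite lexx ltW. Qed.

Let noise P w : Omega R T d := flow G 1 P id w w.

Let noise2 P : first_moment lam P -> lipmap lam 2 (noise P).
Proof.
move=> fmP; apply: (flow_lipmap T0 L0 GL lamE (normr1 _) fmP idl _ idl).
by rewrite ler01 ler1n.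
Qed.

Let mnoise P (fmP : first_moment lam P) : measurable_fun setT (noise P) :=
  lipmap_measurable T0 L0 lamE (noise2 fmP).

Lemma flow_start c Q K F w y : first_moment lam Q -> lipmap lam K F ->
  X 0 (flow G c Q F w y) = X 0 y.
Proof.
move=> fmQ FK; rewrite !XE// (ev_flow T0 L0 GL lamE c w y fmQ FK T00).
have -> : \row_i tint (T := T) (drift G Q F w i) 0 = 0 :> 'rV[R]_d.
  by apply/rowP => i; rewrite !mxE /tint clamp_id// set_itv1 Rintegral_set1.
by rewrite scaler0 addr0.
Qed.

Lemma preimage_X_measurable t (A : set (Rd R d)) : measurable A ->
  measurable (X t @^-1` A : set (Omega R T d)).
Proof. by move=> mA; rewrite -[X in measurable X]setTI; exact: measurable_X. Qed.

Lemma initial_second_moment Q : has_law (X 0) Q mu_in ->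
  (\int[Q]_w (`|ev w 0| ^+ 2)%:E <= (fine (\int[mu_in]_x (enorm x ^+ 2)%:E))%:E)%E.
Proof.
move=> law; have mn : measurable_fun [set: Rd R d] (fun x : Rd R d => `|x : 'rV[R]_d| ^+ 2 : R).
  by apply: measurable_funX; apply: measurable_continuous_Rd; exact: norm_continuous.
rewrite fineK; last first.
  by rewrite ge0_fin_numE// integral_ge0// => x _; rewrite lee_fin sqr_ge0.
have -> : (\int[Q]_w (`|ev w 0| ^+ 2)%:E = \int[mu_in]_x (`|x : 'rV[R]_d| ^+ 2)%:E)%E.
  rewrite (ge0_integral_law (measurable_X 0) law).
  - by apply: eq_integral => w _; rewrite XE.
  - exact/measurable_EFinP.
  - by move=> x; rewrite lee_fin sqr_ge0.
apply: ge0_le_integralT => x; first by rewrite lee_fin sqr_ge0.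
by rewrite lee_fin ler_sqr ?nnegrE ?enorm_ge0// norm_le_enorm.
Qed.

Lemma entropy_dual_mono C C' Q M : C <= C' -> entropy_dual C Q M -> entropy_dual C' Q M.
Proof.
by move=> CC D phi mphi bphi; apply: (le_trans (D phi mphi bphi)); rewrite lerD2r lerB.
Qed.

(** Lower semicontinuity of the entropy: for each test function the left side converges and the
    right side does not involve n except through the vanishing excess. *)
Lemma entropy_dual_limit C (Q_ : nat -> probability (Omega R T d) R) Q M :
  (forall n, entropy_dual (C + n.+1%:R^-1) (Q_ n) M) ->
  (forall A, measurable A -> fine (Q_ n A) @[n --> \oo] --> fine (Q A)) ->
  entropy_dual C Q M.
Proof.
move=> QC QQ phi mphi bphi; have [K phiK] := bphi.
apply/ler_addgt0Pr => e e0; have cv := setwise_cvg_bounded QQ mphi phiK.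
apply: (cvgr_to_le cv); apply: filterS (near_infty_natSinv_lt (PosNum e0)) => n /= ne.
apply: (le_trans (QC n phi mphi bphi)).
move: ne; move: (n.+1%:R^-1) (\int[M]_x _) => a b; lra.
Qed.

Lemma Gamma_noise P M : first_moment lam P -> noise_law mu_in M ->
  (exists Q, solution_law W mu_in P Q) -> has_law (noise P) (Gamma W mu_in P) M.
Proof.
move=> fmP MN /solution_law_Gamma sol.
have [M' M'N law] := solution_law_noise T0 GE L0 GL lamE fmP sol.
by move=> S mS; rewrite (noise_law_unique T0 MN M'N mS); exact: law.
Qed.

(** [Z] inverts the noise map of [P] by [flow_unique], so [P] and [Gamma W mu_in P] are the images
    of [Q] and [M] under the same map, and [entropy_dual_law] applies. *)
Lemma mean_field_cost Q M Z C Q0 P0 : first_moment lam Q -> lipmap lam 2 Z ->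
  (forall y, Z y = flow G (-1) Q Z (Z y) y) -> noise_law mu_in M -> entropy_dual C Q M ->
  solution_law W mu_in P0 Q0 ->
  forall P, has_law Z Q P -> (cost W mu_in P <= C%:E)%E.
Proof.
move=> fmQ Z2 ZE MN QM sol0 P PZ.
have fmP : first_moment lam P := first_moment_law T0 L0 lamE Z2 PZ fmQ.
have ZE' y : Z y = flow G (-1) P id (Z y) y.
  by rewrite (flow_law T0 L0 GL lamE _ _ _ idl Z2 PZ); exact: ZE.
have sol := solution_exists T0 GE L0 GL lamE fmP Z2 ZE' sol0.
have law := Gamma_noise fmP MN sol.
have mZ := lipmap_measurable T0 L0 lamE Z2.
apply: dual_rel_entropy; apply: (entropy_dual_law mZ PZ _ QM) => A mA.
have mZA : measurable (Z @^-1` A) by rewrite -[X in measurable X]setTI; exact: mZ.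
rewrite law//; congr (Gamma W mu_in P _).
have Zn w : Z (noise P w) = w.
  apply: (flow_unique T0 L0 GL lamE fmP idl (ZE' _)).
  exact: (flow_cancel T0 L0 GL lamE w fmP idl).
by apply/seteqP; split => w /=; rewrite Zn.
Qed.

(** For Lipschitz f, the integral of f(X_T) under [P] is the limit of the integrals of f(X_T o Z)
    under Q_n, that is, of f at the end of Z(noise of w) under P_n. Stability replaces this by
    f(w_T), whose integral is that of f against [mu_fin]. *)
Lemma final_marginal Q Z P (P_ Q_ : nat -> probability (Omega R T d) R) :
  lipmap lam 2 Z -> has_law Z Q P ->
  (forall n, first_moment lam (P_ n)) -> (forall n, has_law (noise (P_ n)) (P_ n) (Q_ n)) ->
  (forall n A, measurable A -> marginal (P_ n) T A = mu_fin A) ->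
  (forall A, measurable A -> fine (Q_ n A) @[n --> \oo] --> fine (Q A)) ->
  \int[P_ n]_w wd lam w (Z (noise (P_ n) w)) @[n --> \oo] --> (0 : R) ->
  forall A, measurable A -> marginal P T A = mu_fin A.
Proof.
move=> Z2 PZ fm PQ fin QQ stab; apply: measure_eq_lipschitz => f K fK f01.
have mZ := lipmap_measurable T0 L0 lamE Z2.
have K1 : 0 < `|K| + 1 by rewrite ltr_wpDl.
have fK1 (x y : 'rV[R]_d) : `|f x - f y| <= (`|K| + 1) * `|x - y|.
  by apply: (le_trans (fK x y)); rewrite ler_wpM2r// (le_trans (ler_norm _))// lerDl.
have mf : measurable_fun [set: Rd R d] (f : Rd R d -> R).
  by apply: measurable_continuous_Rd; exact: (lipschitz_continuous K1).
have fb (x : 'rV[R]_d) : `|f x| <= 1 by have /andP[a b] := f01 x; rewrite ger0_norm.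
have mfX : measurable_fun setT (fun w : Omega R T d => f (X T w)).
  exact: (measurableT_comp mf (measurable_X T)).
have mfXZ : measurable_fun setT (fun w : Omega R T d => f (X T (Z w))).
  exact: (measurableT_comp mfX mZ).
have lawP : has_law (X T) P (marginal P T) by [].
rewrite (Rintegral_law (measurable_X T) lawP mf) (Rintegral_law mZ PZ mfX).
have cv := setwise_cvg_bounded QQ mfXZ (fun w => fb _).
have c2 : \int[Q_ n]_w f (X T (Z w)) @[n --> \oo] --> \int[mu_fin]_x f x.
  apply/cvgrPdist_le => e e0; pose k := (`|K| + 1) * expR (lam * T).
  have k0 : 0 < k by rewrite mulr_gt0// expR_gt0.
  have ek : 0 < e / k by rewrite divr_gt0.
  move/cvgrPdist_le : stab => /(_ _ ek); apply: filterS => n.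
  rewrite sub0r normrN ger0_norm; last by apply: Rintegral_ge0 => w _; exact: wd_ge0.
  rewrite ler_pdivlMr// => le_e.
  have lawn : has_law (X T) (P_ n) mu_fin by move=> A mA; rewrite -(fin n A mA).
  have mn := mnoise (fm n).
  rewrite (Rintegral_law (measurable_X T) lawn mf) (Rintegral_law mn (PQ n) mfXZ).
  have mg : measurable_fun setT (fun w : Omega R T d => f (X T (Z (noise (P_ n) w)))).
    exact: (measurableT_comp mfXZ mn).
  rewrite -RintegralB//; [|exact: (bounded_integrable _ mfX (fun w => fb _))|exact: (bounded_integrable _ mg (fun w => fb _))].
  apply: le_trans le_e; rewrite mulrC.
  have wi := wd2_integrable T0 L0 lamE (fm n) idl (lipmap_comp Z2 (noise2 (fm n))).
  rewrite -(RintegralZl _ measurableT wi).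
  apply: normr_RintegralT; first exact: measurable_funB.
    exact: (integrableZl measurableT k wi).
  move=> w; apply: (le_trans (fK1 _ _)); rewrite /k -mulrA ler_pM2l// !XE//.
  exact: (ev_wd T0 L0 lamE).
exact: (cvg_unique _ cv c2).
Qed.

(** The compactness argument: pass to noise laws, extract a setwise limit, and return through the
    mean-field equation. *)
Lemma admissible_limit (m : R) (P_ : nat -> probability (Omega R T d) R) :
  (forall n, admissible mu_in mu_fin (P_ n)) ->
  (forall n, (cost W mu_in (P_ n) <= (m + n.+1%:R^-1)%:E)%E) ->
  exists P, admissible mu_in mu_fin P /\ (cost W mu_in P <= m%:E)%E.
Proof.
move=> adm costP.
have fm n : first_moment lam (P_ n).
  by have [P1 _ _] := adm n; apply/(class_P1_first_moment T0 L0 lamE).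
have sol n : exists Q, solution_law W mu_in (P_ n) Q.
  apply: (finite_cost_solution T0 d0 hinF (adm n)).
  by apply: (le_lt_trans (costP n)); rewrite ltry.
have [Q0 sol0] := sol 0%N.
have [M MN _] := solution_law_noise T0 GE L0 GL lamE (fm 0%N) sol0.
have /choice[Q_ PQ] : forall n, exists Q : probability (Omega R T d) R, has_law (noise (P_ n)) (P_ n) Q.
  by move=> n; exact: has_law_distribution (mnoise (fm n)).
have Q_ent n : entropy_dual (m + n.+1%:R^-1) (Q_ n) M.
  apply: (entropy_dual_law (mnoise (fm n)) (PQ n) (Gamma_noise (fm n) MN (sol n))).
  exact: rel_entropy_dual (costP n).
have Q_ent1 n : entropy_dual (m + 1) (Q_ n) M.
  by apply: entropy_dual_mono (Q_ent n); rewrite lerD2l invf_le1// ler1n.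
have Q_start n : has_law (X 0) (Q_ n) mu_in.
  move=> A mA; have [_ <- // _] := adm n; rewrite PQ; last exact: preimage_X_measurable.
  by congr (P_ n _); apply/seteqP; split => w /=; rewrite (flow_start _ _ _ (fm n) idl).
have [Q [n_ [n_ge QQ]]] := setwise_compact Q_ent1 (@cylinder_setI R T d)
  (fun n => @measurable_cylinder R T d _) (@measurable_sub_cylinder R T d T0).
(* Since n_j >= j, the excess along the subsequence is still at most 1/(j+1). *)
have Q_ent' j : entropy_dual (m + j.+1%:R^-1) (Q_ (n_ j)) M.
  apply: entropy_dual_mono (Q_ent (n_ j)); rewrite lerD2l lef_pV2 ?posrE//.
  by rewrite ler_nat ltnS.
have QM := entropy_dual_limit Q_ent' QQ.
have QM1 : entropy_dual (m + 1) Q M by apply: entropy_dual_mono QM; rewrite lerDl.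
have Qstart : has_law (X 0) Q mu_in.
  move=> A mA; have mXA := preimage_X_measurable 0 mA.
  have c1 := QQ _ mXA.
  have c2 : fine (Q_ (n_ j) (X 0 @^-1` A)) @[j --> \oo] --> fine (mu_in A).
    rewrite (_ : (fun j => _) = (fun=> fine (mu_in A))); first exact: cvg_cst.
    by apply/funext => j; rewrite (Q_start (n_ j) A mA).
  have f1 : Q (X 0 @^-1` A) \is a fin_num by exact: fin_num_measure.
  have f2 : mu_in A \is a fin_num by exact: fin_num_measure.
  by rewrite -(fineK f1) -(fineK f2); congr (_%:E); exact: (cvg_unique _ c2 c1).
have [K KP] := second_moment_bound T0 (fun i k c V ik mV => noise_law_increment c MN ik mV)
  (m + 1) (fine (\int[mu_in]_x (enorm x ^+ 2)%:E)) d0 lam_ge0.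
have Q_2 n : (\int[Q_ n]_w (wd lam w point ^+ 2)%:E <= K%:E)%E.
  by apply: KP => //; exact: initial_second_moment.
have Q2 : (\int[Q]_w (wd lam w point ^+ 2)%:E <= K%:E)%E.
  by apply: KP => //; exact: initial_second_moment.
have [fmQ _] := first_moment_sqr T0 L0 lamE Q2.
have [Z [Z2 ZE]] := mean_field_solution T0 L0 GL lamE fmQ.
have [P PZ] := has_law_distribution Q (lipmap_measurable T0 L0 lamE Z2).
exists P; split; last exact: (mean_field_cost fmQ Z2 ZE MN QM sol0 PZ).
split.
- apply/(class_P1_first_moment T0 L0 lamE).
  exact: (first_moment_law T0 L0 lamE Z2 PZ fmQ).
- move=> A mA; have mXA := preimage_X_measurable 0 mA.
  apply: etrans (PZ _ mXA) _; rewrite Qstart//; congr (Q _).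
  by apply/seteqP; split => w /=; rewrite ZE (flow_start _ _ _ fmQ Z2).
- apply: (final_marginal Z2 PZ (fun j => fm (n_ j)) (fun j => PQ (n_ j)) _ QQ).
    by move=> j A mA; have [_ _] := adm (n_ j); exact.
  exact: (stability T0 L0 GL lamE (fun j => Q_ent1 (n_ j)) QQ (fun j => Q_2 (n_ j)) Q2
    (fun j => fm (n_ j)) (fun j => PQ (n_ j)) Z2 ZE).
Qed.

End Existence.


(** The test function 0 shows that every real upper bound is nonnegative; this also rules out the
    value -oo. *)
Lemma rel_entropy_ge0 dsp (E : measurableType dsp) (R : realType) (P Q : probability E R) :
  (0 <= rel_entropy P Q)%E.
Proof.
have C0 C : (rel_entropy P Q <= C%:E)%E -> 0 <= C.
  move=> /rel_entropy_dual D; have := D (fun=> 0) (measurable_cst _).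
  rewrite !Rintegral_cstT expR0 subrK; apply; exists 0 => x; by rewrite normr0.
move: C0; case: (rel_entropy P Q) => [r| |] C0; first by rewrite lee_fin C0.
  by rewrite leey.
by have := C0 (-1) (leNye _); rewrite oppr_ge0 ler10.
Qed.

Theorem proposition1p1 (R : realType) (d : nat) (hd : (1 <= d)%N)
    (T : R) (hT : 0 < T)
    (W : 'rV[R]_d -> R) (hW : classC2 W) (hWsym : forall z, W z = W (- z))
    (hWbound : (ereal_sup [set (`|(v *m hessian W z *m v^T) 0 0|%R)%:E
                  | z in [set: 'rV[R]_d] & v in [set v | enorm v = 1%R]] < +oo)%E)
    (mu_in mu_fin : probability (Rd R d) R)
    (hin2 : second_moment_finite mu_in) (hfin2 : second_moment_finite mu_fin)
    (hinF : (free_energy W mu_in < +oo)%E)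
    (hfinF : (free_energy W mu_fin < +oo)%E) :
  exists P : probability (Omega R T d) R, mfsp_optimal W mu_in mu_fin P.
Proof.
have [K hessK] := hessian_bound hWbound.
pose L := 6 * `|K| + 1; have L0 : 0 < L by rewrite ltr_wpDl// mulr_ge0.
have GL i x y : `|partial i W x - partial i W y| <= L * `|x - y|.
  apply: partial_lipschitz => // z v; apply: (le_trans (hessK z v)).
  by rewrite ler_wpM2r ?sqr_ge0// ler_norm.
have GE i x : grad W x 0 i = partial i W x by rewrite mxE.
have value_le (P : probability (Omega R T d) R) : admissible mu_in mu_fin P -> (mfsp_value (T := T) W mu_in mu_fin <= cost W mu_in P)%E.
  by move=> adm; apply: ereal_inf_lbound; exists P.
have value_ge0 : (0 <= mfsp_value (T := T) W mu_in mu_fin)%E.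
  by apply: le_ereal_inf_tmp => _ [P _ <-]; exact: rel_entropy_ge0.
(* With an infinite infimum every admissible law is optimal; otherwise a sequence within 1/(n+1) of
   the infimum feeds [admissible_limit]. *)
have [voo|] := eqVneq (mfsp_value (T := T) W mu_in mu_fin) +oo%E.
  have [P adm] := admissible_exists hT hin2 hfin2; exists P; split => //.
  by apply/eqP; rewrite eq_le value_le// voo leey.
move=> vfin; have vnum : mfsp_value (T := T) W mu_in mu_fin \is a fin_num.
  by rewrite ge0_fin_numE// ltey.
have /choice[P_ P_P] : forall n, exists P : probability (Omega R T d) R, admissible mu_in mu_fin P /\
    (cost W mu_in P <= (fine (mfsp_value (T := T) W mu_in mu_fin) + n.+1%:R^-1)%:E)%E.
  move=> n; have n0 : 0 < n.+1%:R^-1 :> R by rewrite invr_gt0.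
  have [_ [P adm <-] le] := lb_ereal_inf_adherent n0 vnum; exists P; split => //.
  by rewrite EFinD fineK// ltW.
have [P [adm le]] := admissible_limit hT hd GE L0 GL erefl hin2 hinF
  (fun n => (P_P n).1) (fun n => (P_P n).2).
exists P; split => //; apply/eqP; rewrite eq_le value_le// andbT.
by rewrite -[leRHS]fineK.
Qed.
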